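(* Let $p\ge2$, $f\in L^{p/(p-1)}(\omega_2)$, and let $H=\tilde H_p$, i.e. $$H(z)=\left(F^p(Z_1)+G^p(Z_2)\right)^{1/p},\qquad z=(Z_1,Z_2)\in\mathbb{R}^m\times\mathbb{R}^{n-m},$$ with $F:\mathbb{R}^m\to\mathbb{R}$ and $G:\mathbb{R}^{n-m}\to\mathbb{R}$ as in the context. Let $u_\ell\in W^{1,p}_0(\Omega_\ell)$ be the weak solution of $-\mathrm{div}(H^{p-1}(\nabla u_\ell)\nabla H(\nabla u_\ell))=f(X_2)$ in $\Omega_\ell$, and let $u_\infty\in W^{1,p}_0(\omega_2)$ be the weak solution of $-\mathrm{div}(H^{p-1}(\nabla_2u_\infty)\nabla_{Z_2}H(\nabla_2u_\infty))=f(X_2)$ in $\omega_2$, extended to $\Omega_\ell$ as a function constant in $X_1$. Then there exist positive constants $C$ and $\beta$, both independent of $\ell$, such that $$\|\nabla(u_\ell-u_\infty)\|_{L^p(\Omega_{\ell/2})}\le C e^{-\beta\ell}.$$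
   Context: Let $1\le m<n$, let $\omega_1\subset\mathbb{R}^m$ be open, bounded and convex with $0\in\omega_1$, and let $\omega_2\subset\mathbb{R}^{n-m}$ be open and bounded. For $\ell>0$ set $\Omega_\ell=\ell\omega_1\times\omega_2\subset\mathbb{R}^n$. Points are written $x=(X_1,X_2)$ with $X_1\in\mathbb{R}^m$, $X_2\in\mathbb{R}^{n-m}$; $\nabla_{Z_2}H$ is the gradient of $H$ in its last $n-m$ variables; $\nabla_2:=(0,\dots,0,\partial_{x_{m+1}},\dots,\partial_{x_n})\in\mathbb{R}^n$. Each of $F$ and $G$ is nonnegative, convex, vanishes only at $0$, satisfies $F(tZ_1)=|t|F(Z_1)$ (respectively $G(tZ_2)=|t|G(Z_2)$) for all $t\in\mathbb{R}$, and is $C^1$ away from the origin. In addition there are constants $c_1,\theta_1,\theta_2>0$ such that for all $Z_1,W_1\in\mathbb{R}^m$ and $Z_2,W_2\in\mathbb{R}^{n-m}$: $$\langle F^{p-1}(Z_1)\nabla F(Z_1)-F^{p-1}(W_1)\nabla F(W_1),\,Z_1-W_1\rangle\ge c_1|Z_1-W_1|^p,$$ $$\langle G^{p-1}(Z_2)\nabla G(Z_2)-G^{p-1}(W_2)\nabla G(W_2),\,Z_2-W_2\rangle\ge c_1|Z_2-W_2|^p,$$ $$\theta_1|Z_1|\le F(Z_1)\le\theta_2|Z_1|,\qquad\theta_1|Z_2|\le G(Z_2)\le\theta_2|Z_2|.$$ The fields $F^{p-1}\nabla F$, $G^{p-1}\nabla G$, $H^{p-1}\nabla H$ are understood to be $0$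 at the origin. Weak solution: $u\in W^{1,p}_0(\Omega_\ell)$ with $\int_{\Omega_\ell}H^{p-1}(\nabla u)\langle\nabla H(\nabla u),\nabla\phi\rangle\,dx=\int_{\Omega_\ell}f(X_2)\phi\,dx$ for all $\phi\in W^{1,p}_0(\Omega_\ell)$; respectively $w\in W^{1,p}_0(\omega_2)$ with $\int_{\omega_2}H^{p-1}(0,\nabla_{X_2}w)\langle\nabla_{Z_2}H(0,\nabla_{X_2}w),\nabla_{X_2}\phi\rangle\,dX_2=\int_{\omega_2}f\phi\,dX_2$ for all $\phi\in W^{1,p}_0(\omega_2)$. *)

(* Defs.v *)
From HB Require Import structures.
From mathcomp Require Import all_boot all_order all_algebra.
From mathcomp Require Import all_classical all_reals all_analysis.

Set Implicit Arguments.
Unset Strict Implicit.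
Unset Printing Implicit Defensive.

Import Order.TTheory GRing.Theory Num.Theory.
Import numFieldNormedType.Exports.

Local Open Scope classical_set_scope.
Local Open Scope ring_scope.

(* R^n is ['rV[R]_n]. Its sigma-algebra is the one generated by the
   coordinates; n being finite, this is the Borel sigma-algebra. *)
Definition rV_display : measure_display.
Proof. exact: default_measure_display. Qed.

Section measurable_rV.
Context {R : realType} (n : nat).

Let coor (i : 'I_n) (x : 'rV[R]_n) : measurableTypeR R := x ord0 i.

Let rV_set0 : g_sigma_preimage coor set0.
Proof. exact: sigma_algebra0. Qed.

Let rV_setC A : g_sigma_preimage coor A -> g_sigma_preimage coor (~` A).
Proof. exact: sigma_algebraC. Qed.

Let rV_bigcup (F : _^nat) : (forall i, g_sigma_preimage coor (F i)) ->
  g_sigma_preimage coor (\bigcup_i (F i)).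
Proof. exact: sigma_algebra_bigcup. Qed.

HB.instance Definition _ := @isMeasurable.Build rV_display
  'rV[R]_n (g_sigma_preimage coor) rV_set0 rV_setC rV_bigcup.

Lemma measurable_coord (i : 'I_n) :
  measurable_fun [set: 'rV[R]_n] (fun x => x ord0 i : measurableTypeR R).
Proof.
move=> _ Y mY; rewrite setTI; apply: sub_sigma_algebra => /=.
rewrite -bigcup_seq/=; exists i => /=; first by rewrite mem_index_enum.
by exists Y => //; rewrite setTI.
Qed.

Lemma measurable_fun_rVP d (T : measurableType d) (f : T -> 'rV[R]_n) :
  (forall i, measurable_fun [set: T] (fun x => f x ord0 i : measurableTypeR R))
  -> measurable_fun [set: T] f.
Proof.
move=> mf _ A mA; rewrite setTI.
have : g_sigma_preimage coor `<=` [set B | measurable (f @^-1` B)].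
  apply: smallest_sub.
    split => /= [|B mB|F mF]; first by rewrite preimage_set0.
      by rewrite setTD preimage_setC; exact: measurableC.
    by rewrite preimage_bigcup; exact: bigcup_measurable.
  rewrite -bigcup_seq => B [i _ /= [Y mY <-]].
  by rewrite setTI; have := mf i measurableT Y mY; rewrite setTI.
by apply.
Qed.

End measurable_rV.

Section lebesgue_measure_rV.
Context {R : realType}.

Definition rV_cons n (z : measurableTypeR R * 'rV[R]_n) : 'rV[R]_n.+1 :=
  row_mx (const_mx z.1 : 'rV_1) z.2.

Definition rV_uncons n (x : 'rV[R]_n.+1) : measurableTypeR R * 'rV[R]_n :=
  (x ord0 ord0, rsubmx (x : 'rV_(1 + n))).

Lemma rV_consK n : cancel (@rV_cons n) (@rV_uncons n).
Proof.
case=> a v; congr pair; last exact: row_mxKr.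
have -> : ord0 = lshift n ord0 :> 'I_(1 + n) by apply/val_inj.
by apply: etrans (row_mxEl _ _ _ _) _; rewrite mxE.
Qed.

Lemma measurable_rV_cons n : measurable_fun setT (@rV_cons n).
Proof.
apply: measurable_fun_rVP => i; rewrite /rV_cons.
case: (splitP (i : 'I_(1 + n))) => [j ij|j ij].
  apply: (eq_measurable_fun fst) => //= z _.
  have -> : i = lshift n j by apply/val_inj.
  by apply/esym; apply: etrans (row_mxEl _ _ _ _) _; rewrite mxE.
apply: (eq_measurable_fun (fun z : measurableTypeR R * 'rV[R]_n =>
    z.2 ord0 j : measurableTypeR R)) => //= [z _|].
  have -> : i = rshift 1 j by apply/val_inj.
  by apply/esym; exact: row_mxEr.
by apply: (measurableT_comp (measurable_coord j)).
Qed.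

Lemma measurable_rV_uncons n : measurable_fun setT (@rV_uncons n).
Proof.
apply/measurable_fun_pairP; split; first exact: measurable_coord.
apply: measurable_fun_rVP => i.
apply: (eq_measurable_fun (fun z : 'rV[R]_n.+1 => z ord0 (rshift 1 i))).
  by move=> z _ /=; rewrite mxE.
exact: measurable_coord.
Qed.

Section cons.
Variables (n : nat) (mu : {sigma_finite_measure set 'rV[R]_n -> \bar R}).

Definition cons_measure : set 'rV[R]_n.+1 -> \bar R :=
  pushforward (lebesgue_measure \x mu)%E (@rV_cons n).

Let cons_measure0 : cons_measure set0 = 0%E.
Proof. by rewrite /cons_measure /pushforward preimage_set0 measure0. Qed.

Let cons_measure_ge0 A : (0 <= cons_measure A)%E.
Proof. by rewrite /cons_measure /pushforward; exact: measure_ge0. Qed.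

Let cons_measure_sigma_additive : semi_sigma_additive cons_measure.
Proof.
have mpre A : measurable A -> measurable (@rV_cons n @^-1` A).
  by move=> mA; rewrite -[X in measurable X]setTI; exact: measurable_rV_cons.
move=> F mF tF mUF; rewrite /cons_measure /pushforward preimage_bigcup.
apply: measure_semi_sigma_additive.
- by move=> k; exact: mpre.
- apply/trivIsetP => /= i j _ _ ij; rewrite -preimage_setI.
  by move/trivIsetP : tF => /(_ _ _ _ _ ij) ->//; rewrite preimage_set0.
- by rewrite -preimage_bigcup; exact: mpre.
Qed.

HB.instance Definition _ := isMeasure.Build _ _ _
  cons_measure cons_measure0 cons_measure_ge0 cons_measure_sigma_additive.

Let cons_measure_sigma_finite : sigma_finite setT cons_measure.
Proof.
have /sigma_finiteP[F [TF ndF Foo]] := sigma_finiteT (@lebesgue_measure R).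
have /sigma_finiteP[G [TG ndG Goo]] := sigma_finiteT mu.
exists (fun k => @rV_uncons n @^-1` (F k `*` G k)).
  rewrite -preimage_bigcup (_ : \bigcup_k _ = setT) ?preimage_setT//.
  rewrite -subTset => -[a v] _.
  have [i _ Fi] : (\bigcup_k F k) a by rewrite -TF.
  have [j _ Gj] : (\bigcup_k G k) v by rewrite -TG.
  exists (maxn i j) => //; split => /=.
    by move: a Fi; exact/subsetPset/ndF/leq_maxl.
  by move: v Gj; exact/subsetPset/ndG/leq_maxr.
move=> k; have [mF Fk] := Foo k; have [mG Gk] := Goo k.
have mFG : measurable (F k `*` G k) by exact: measurableX.
split; first by rewrite -[X in measurable X]setTI; exact: measurable_rV_uncons.
rewrite /cons_measure /pushforward -comp_preimage.
rewrite (_ : _ \o _ = id) ?preimage_id; last exact/funext/rV_consK.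
by rewrite product_measure1E// lte_mul_pinfty// ge0_fin_numE.
Qed.

HB.instance Definition _ := Measure_isSigmaFinite.Build _ _ _
  cons_measure cons_measure_sigma_finite.

End cons.

Fixpoint lebesgue_rV n : {sigma_finite_measure set 'rV[R]_n -> \bar R} :=
  if n is n'.+1 then cons_measure (lebesgue_rV n') else \d_(0 : 'rV[R]_0).

(* [lebesgue_rV n] is the Lebesgue measure: boxes have the expected volume. *)
Lemma lebesgue_rV_box n (A : 'I_n -> set (measurableTypeR R)) :
  (forall i, measurable (A i)) ->
  lebesgue_rV n [set x | forall i, A i (x ord0 i)] =
  (\prod_(i < n) lebesgue_measure (A i))%E.
Proof.
elim: n A => [|n IHn] A mA.
  rewrite big_ord0 /= /dirac indicE mem_set//.
  by case.
rewrite big_ord_recl -(IHn (fun i => A (lift ord0 i)))//.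
pose B := [set x : 'rV[R]_n | forall i, A (lift ord0 i) (x ord0 i)].
have mB : measurable B.
  rewrite (_ : B = \bigcap_(i in [set: 'I_n])
      ((fun x : 'rV[R]_n => x ord0 i) @^-1` A (lift ord0 i))).
    apply: fin_bigcap_measurable => // i _.
    rewrite -[X in measurable X]setTI.
    exact: (measurable_coord i measurableT (mA _)).
  by apply/seteqP; split => [x xB i _|x xB i]; exact: xB.
have <- := product_measure1E lebesgue_measure (lebesgue_rV n) (mA ord0) mB.
rewrite /= /cons_measure /pushforward; congr (product_measure1 _ _ _).
apply/seteqP; split => -[a v] /=.
  move=> avA; have := rV_consK (a, v).
  case=> a0 v0; split=> [|i]; first by rewrite -a0; exact: avA.
  rewrite -v0 mxE (_ : rshift 1 i = lift ord0 i); first exact: avA.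
  exact/val_inj.
have [a0 v0] : rV_uncons (rV_cons (a, v)) = (a, v) by exact: rV_consK.
case=> Aa Av i; case: (unliftP ord0 i) => [j ->|->]; last by rewrite a0.
have := Av j; rewrite -{1}v0 mxE.
by have -> : rshift 1 j = lift ord0 j by exact/val_inj.
Qed.

End lebesgue_measure_rV.

Section euclidean.
Context {R : realType} {n : nat}.
Implicit Types (x y : 'rV[R]_n) (phi : 'rV[R]_n -> R) (D : set 'rV[R]_n).

Definition dot x y : R := \sum_i x ord0 i * y ord0 i.

(* The norm of the library on row vectors is the sup norm. *)
Definition enorm x : R := Num.sqrt (dot x x).

Definition partial (i : 'I_n) phi x : R := 'D_(delta_mx ord0 i) phi x.

Definition grad phi x : 'rV[R]_n := \row_i partial i phi x.

Fixpoint Ck (k : nat) phi : Prop :=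
  continuous phi /\
  (if k is k'.+1 then forall i : 'I_n,
     (forall x, derivable phi x (delta_mx ord0 i)) /\ Ck k' (partial i phi)
   else True).

Definition smooth phi : Prop := forall k, Ck k phi.

(* C_c^oo(D), as functions on the whole of R^n *)
Definition test_function D phi : Prop :=
  [/\ smooth phi, compact (closure [set x | phi x != 0]) &
      closure [set x | phi x != 0] `<=` D].

End euclidean.

Section sobolev.
Context {R : realType} {n : nat}.
Local Notation mu := (@lebesgue_rV R n).
Implicit Types (D : set 'rV[R]_n) (p : R) (u phi : 'rV[R]_n -> R)
  (g A : 'rV[R]_n -> 'rV[R]_n).

(* Functions on [D] are represented by total functions whose values outside of
   [D] are irrelevant, and elements of L^p by Borel representatives. *)
Definition LpN D p u : \bar R := 'N[mu]_(p%:E)[EFin \o (u \_ D)].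

Definition in_Lp D p u : Prop := measurable_fun D u /\ (LpN D p u < +oo)%E.

Definition in_Lp_vec D p g : Prop :=
  measurable_fun D g /\ (LpN D p (enorm \o g) < +oo)%E.

Definition weak_gradient D u g : Prop :=
  forall phi, test_function D phi -> forall i : 'I_n,
    \int[mu]_(x in D) (u x * partial i phi x) =
    - \int[mu]_(x in D) (g x ord0 i * phi x).

(* [W1p D p u g]: u is in W^{1,p}(D), with gradient g *)
Definition W1p D p u g : Prop :=
  [/\ in_Lp D p u, in_Lp_vec D p g & weak_gradient D u g].

(* [W1p0 D p u g]: u is in W^{1,p}_0(D), the closure of C_c^oo(D) in
   W^{1,p}(D), with gradient g *)
Definition W1p0 D p u g : Prop :=
  W1p D p u g /\
  exists phi_ : nat -> 'rV[R]_n -> R,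
    [/\ forall k, test_function D (phi_ k),
        LpN D p (u \- phi_ k) @[k --> \oo] --> 0%E &
        LpN D p (fun x => enorm (g x - grad (phi_ k) x)) @[k --> \oo] --> 0%E].

(* [u] is a weak solution in W^{1,p}_0(D) of - div (A (grad u)) = f *)
Definition weak_solution D p A (f u : 'rV[R]_n -> R) : Prop :=
  exists Du, W1p0 D p u Du /\
    forall phi Dphi, W1p0 D p phi Dphi ->
      \int[mu]_(x in D) dot (A (Du x)) (Dphi x) =
      \int[mu]_(x in D) (f x * phi x).

End sobolev.

Section integrands.
Context {R : realType}.

(* The field F^(p-1) grad F. When F 0 = 0 and 1 < p it vanishes at the origin,
   whatever the value of [grad F 0]. *)
Definition flux {n} (p : R) (F : 'rV[R]_n -> R) (z : 'rV[R]_n) : 'rV[R]_n :=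
  F z `^ (p - 1) *: grad F z.

Record integrand {n} (p c1 theta1 theta2 : R) (F : 'rV[R]_n -> R) : Prop := {
  integrand_ge0 : forall z, 0 <= F z ;
  integrand_convex :
    convex_function [set: convex_lmodType 'rV[R]_n] (F : _ -> R^o) ;
  integrand_eq0 : forall z, F z = 0 <-> z = 0 ;
  integrand_homogeneous : forall t z, F (t *: z) = `|t| * F z ;
  integrand_C1 : forall z, z != 0 ->
    differentiable F z /\ {for z, continuous (grad F)} ;
  integrand_monotone : forall z w,
    c1 * enorm (z - w) `^ p <= dot (flux p F z - flux p F w) (z - w) ;
  integrand_growth : forall z,
    theta1 * enorm z <= F z /\ F z <= theta2 * enorm z }.

Definition Htilde {m k} (p : R) (F : 'rV[R]_m -> R) (G : 'rV[R]_k -> R)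
    (z : 'rV[R]_(m + k)) : R :=
  (F (lsubmx z) `^ p + G (rsubmx z) `^ p) `^ p^-1.

(* H^(p-1)(0, z2) grad_{Z_2} H (0, z2) *)
Definition flux2 {m k} (p : R) (H : 'rV[R]_(m + k) -> R) (z2 : 'rV[R]_k)
    : 'rV[R]_k :=
  H (row_mx 0 z2) `^ (p - 1) *: rsubmx (grad H (row_mx 0 z2)).

Definition cylinder {m k} (l : R) (omega1 : set 'rV[R]_m)
    (omega2 : set 'rV[R]_k) : set 'rV[R]_(m + k) :=
  [set x | [set l *: y | y in omega1] (lsubmx x) /\ omega2 (rsubmx x)].

End integrands.

(* Main.v *)
(* With w = u_inf (x_2) and v = u_l - w, the field of H = tilde H_p splits as
   H^(p-1) grad H (Z) = (F^(p-1) grad F (Z_1), G^(p-1) grad G (Z_2)), so that w,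
   extended constantly in X_1, solves the equation on the cylinder and
   int <A(Du_l) - A(Dw), Dphi> = 0 for phi in W^{1,p}_0. Testing with phi = rho v,
   where rho depends on X_1 only and cuts off the cube of half-width s + L, strong
   monotonicity bounds the energy int |Dv|^p over the cube of half-width s.
   Since the first component of Dw is 0, the error term is at most
   (C / L) int |Dv|^(p-1) |v|, and the Poincare inequality in an X_2-direction turns
   |v| into |Dv|: E(s) <= (C' / L) E(s + 2L). Taking L large and iterating about l / L
   times gives E <= e^(1 - g l) int |Dv|^p over the whole cylinder, the last integral
   being O(l^m) by the equations. A number of cubes independent of l covers the half
   cylinder. *)
Require Import Defs.
From HB Require Import structures.
From mathcomp Require Import all_boot all_order all_algebra.
From mathcomp Require Import all_classical all_reals all_analysis.
From mathcomp Require Import measurable_realfun ring lra.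

Set Implicit Arguments.
Unset Strict Implicit.
Unset Printing Implicit Defensive.

Import Order.TTheory GRing.Theory Num.Theory.
Import numFieldNormedType.Exports.

Local Open Scope classical_set_scope.
Local Open Scope ring_scope.

(** * Borel sets and measurable maps of R^n *)

(** The function [err] is not in W^{1,p}_0 of the cylinder, since the extension of w does not vanish
    on the ends, where X_1 is in the boundary of l omega1. It is handled as a limit of smooth
    functions without boundary condition ([smooth_approx]), and only its products with cutoffs in
    X_1 are admissible tests. The Poincare inequality meets the same obstacle: it is applied to v
    times a second cutoff, wider than the first by L. This cutoff is constant in X_2 and the
    inequality involves one derivative in X_2, so no multiple of v comes back on the right. The
    cutoffs are products of exp(-1/t) profiles, not equal to 1 on the inner cube but at least kappa
    = e^(-2m) there; only constants change. Cubes centred at (l/2) y with y in omega1 replace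
    dilates of omega1: if omega1 contains the cube of half-width r around 0, convexity leaves room l
    r / 2 around each centre, so all energies run from half-width l r / 8 up to at most l r / 2 with
    a common number of steps. The factor l^m of the global bound is absorbed by giving up half of
    the exponent. *)

Section borel_rV.
Context {R : realType} {n : nat}.
Implicit Types A : set 'rV[R]_n.

Lemma measurable_coord_set (i : 'I_n) (Y : set (measurableTypeR R)) :
  measurable Y -> measurable [set x : 'rV[R]_n | Y (x ord0 i)].
Proof.
by move=> mY; have := measurable_coord i measurableT mY; rewrite setTI.
Qed.

Lemma measurable_rV_forall (P : 'I_n -> set 'rV[R]_n) :
  (forall i, measurable (P i)) -> measurable [set x | forall i, P i x].
Proof.
move=> mP; rewrite (_ : [set _ | _] = \bigcap_(i in [set: 'I_n]) P i).
  by apply: fin_bigcap_measurable => // i _; exact: mP.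
by apply/seteqP; split => [x xP i _|x xP i]; exact: xP.
Qed.

Lemma rV_ballP (x : 'rV[R]_n) (e : R) (y : 'rV[R]_n) : 0 < e ->
  ball x e y <-> forall i, `|x ord0 i - y ord0 i| < e.
Proof.
move=> e0; split=> [[_ xy] i|xy]; first exact: xy.
by split=> // i j; rewrite (ord1 i); exact: xy.
Qed.

(** The sigma-algebra is generated by the coordinates, so an open set has to be reached through
    countably many boxes: those with rational centre and half-width 1/(N+1) that lie inside [A]. *)
Lemma open_measurable_rV A : open A -> measurable A.
Proof.
move=> oA.
pose box (q : 'rV[rat]_n * nat) : set 'rV[R]_n :=
  [set y | forall i, `|ratr (q.1 ord0 i) - y ord0 i| < q.2.+1%:R^-1].
pose B q := if `[< box q `<=` A >] then box q else set0.
have -> : A = \bigcup_q B q.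
  apply/seteqP; split => [x Ax|x [q _]]; last first.
    by rewrite /B; case: asboolP => [qA /qA|].
  have /nbhs_ballP[e /= e0 eA] : nbhs x A by exact: open_nbhs_nbhs.
  (* With 1/(N+1) < e/2 and a centre within 1/(N+1) of x, every point of the box is within e of
     x. *)
  have [N _ Ne] := near_infty_natSinv_lt (PosNum (divr_gt0 e0 (ltr0Sn R 1))).
  have {Ne} : N.+1%:R^-1 < e / 2 by exact: (Ne N (leqnn N)).
  have : 0 < N.+1%:R^-1 :> R by rewrite invr_gt0.
  set d := N.+1%:R^-1 => d0 de.
  have qP i : {q : rat | `|ratr q - x ord0 i| < d}.
    apply: cid; have : x ord0 i - d < x ord0 i + d by lra.
    move=> /rat_in_itvoo[q]; rewrite in_itv/= => /andP[q1 q2].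
    by exists q; rewrite ltr_norml; apply/andP; split; lra.
  pose q : 'rV[rat]_n := \row_i projT1 (qP i).
  have xq : box (q, N) x by move=> i; rewrite mxE; exact: (projT2 (qP i)).
  exists (q, N) => //; rewrite /B; case: asboolP => // -[].
  move=> y yq; apply: eA; apply/rV_ballP => // i.
  have /= := xq i; have /= := yq i; rewrite -/d !ltr_norml => /andP[? ?] /andP[? ?].
  by apply/andP; split; lra.
apply: countable_bigcupT_measurable => [|q]; first exact: countableP.
rewrite /B; case: asboolP => // _; apply: measurable_rV_forall => i.
apply: (@measurable_coord_set i
  [set t : measurableTypeR R | `|ratr (q.1 ord0 i) - t| < q.2.+1%:R^-1]).
set c := ratr _; set d := _^-1.
have := @measurable_itv R `]c - d, c + d[.
congr (measurable _); apply/seteqP; split => t /=; rewrite in_itv/= ltr_norml.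
  by move=> /andP[? ?]; apply/andP; split; lra.
by move=> /andP[? ?]; apply/andP; split; lra.
Qed.

Lemma continuous_measurable_rV (g : 'rV[R]_n -> R) :
  continuous g -> measurable_fun setT (g : _ -> measurableTypeR R).
Proof.
move=> /continuousP cg; apply: (measurability _ (RGenOpens.measurableE R)).
move=> _ [_ [a [b ->] <-]]; rewrite setTI; apply: open_measurable_rV.
by apply: cg; exact: interval_open.
Qed.

(** Extending [g] by 0 outside [E] reduces to [measurable_fun_rVP], which concerns maps on the whole
    source. *)
Lemma measurable_fun_rV_on d (T : measurableType d) (E : set T)
    (g : T -> 'rV[R]_n) :
  (forall i, measurable_fun E (fun x => g x ord0 i : measurableTypeR R)) ->
  measurable_fun E g.
Proof.
move=> mg mE; have gE i : measurable_fun setT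
    (fun x => (if x \in E then g x else 0) ord0 i : measurableTypeR R).
  have := (measurable_restrictT (fun x => g x ord0 i : measurableTypeR R) mE).1 (mg i).
  by congr (measurable_fun _ _); apply/funext => x; rewrite patchE; case: ifPn; rewrite ?mxE.
have mgE := measurable_fun_rVP gE.
have mgE' := measurable_funS measurableT (@subsetT _ E) mgE.
suff : measurable_fun E g by apply.
by apply: eq_measurable_fun mgE' => x xE /=; rewrite xE.
Qed.

Lemma measurable_rsubmx m : measurable_fun setT (@rsubmx R 1 m n).
Proof.
apply: measurable_fun_rV_on => i; under eq_fun do rewrite mxE.
exact: measurable_coord.
Qed.

Lemma measurable_lsubmx m : measurable_fun setT (@lsubmx R 1 n m).
Proof.
apply: measurable_fun_rV_on => i; under eq_fun do rewrite mxE.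
exact: measurable_coord.
Qed.

Lemma measurable_fun_coord d (T : measurableType d) (E : set T)
    (g : T -> 'rV[R]_n) i : measurable_fun E g ->
  measurable_fun E (fun x => g x ord0 i : measurableTypeR R).
Proof. by move=> mg; exact: (measurableT_comp (measurable_coord i) mg). Qed.

Lemma measurable_fun_dot d (T : measurableType d) (E : set T)
    (g h : T -> 'rV[R]_n) : measurable_fun E g -> measurable_fun E h ->
  measurable_fun E (fun x => dot (g x) (h x) : measurableTypeR R).
Proof.
move=> mg mh; apply: measurable_sum => i.
by apply: measurable_funM; exact: measurable_fun_coord.
Qed.

Lemma measurable_fun_enorm d (T : measurableType d) (E : set T)
    (g : T -> 'rV[R]_n) : measurable_fun E g ->
  measurable_fun E (fun x => enorm (g x) : measurableTypeR R).
Proof.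
move=> mg; apply: (@measurableT_comp _ _ _ _ _ _ (@Num.sqrt R)).
  by apply: continuous_measurable_fun; exact: sqrt_continuous.
exact: measurable_fun_dot.
Qed.

End borel_rV.

(** * Functions of class C^k *)

Section continuous_rV.
Context {R : realType}.

Lemma cvg_rV (T : Type) (F : set_system T) (FF : Filter F) n
    (g : T -> 'rV[R]_n) (l : 'rV[R]_n) :
  (forall i, g x ord0 i @[x --> F] --> l ord0 i) -> g @ F --> l.
Proof.
move=> gl; apply/cvg_ballP => e e0.
have : \forall x \near F, forall i, ball (l ord0 i) e (g x ord0 i).
  by apply: filter_forall => i; exact: (cvg_ball (gl i)).
by apply: filterS => x gx; split => // i j; rewrite (ord1 i); exact: gx.
Qed.

Lemma continuous_rV (T : topologicalType) n (g : T -> 'rV[R]_n) :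
  (forall i, continuous (fun x => g x ord0 i)) -> continuous g.
Proof. by move=> cg x; apply: cvg_rV => i; exact: cg. Qed.

Lemma continuous_addf (T : topologicalType) (f g : T -> R) :
  continuous f -> continuous g -> continuous (fun x => f x + g x).
Proof. by move=> cf cg x; apply: continuousD; [exact: cf|exact: cg]. Qed.

Lemma continuous_mulf (T : topologicalType) (f g : T -> R) :
  continuous f -> continuous g -> continuous (fun x => f x * g x).
Proof. by move=> cf cg x; apply: continuousM; [exact: cf|exact: cg]. Qed.

Lemma continuous_coord n (i : 'I_n) : continuous (fun x : 'rV[R]_n => x ord0 i).
Proof. exact: coord_continuous. Qed.

Lemma continuous_fun_coord (T : topologicalType) n (g : T -> 'rV[R]_n) i :
  continuous g -> continuous (fun x => g x ord0 i).
Proof.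
move=> cg x; apply: (@continuous_comp _ _ _ g (fun y : 'rV[R]_n => y ord0 i)).
  exact: cg.
exact: continuous_coord.
Qed.

Lemma continuous_row_mx m k (T : topologicalType) (f : T -> 'rV[R]_m)
    (g : T -> 'rV[R]_k) : continuous f -> continuous g ->
  continuous (fun x => row_mx (f x) (g x)).
Proof.
move=> cf cg; apply: continuous_rV => i.
case: (split_ordP i) => j ->.
  by under eq_fun do rewrite row_mxEl; exact: continuous_fun_coord.
by under eq_fun do rewrite row_mxEr; exact: continuous_fun_coord.
Qed.

Lemma continuous_rV_cons n (T : topologicalType) (f : T -> R)
    (g : T -> 'rV[R]_n) : continuous f -> continuous g ->
  continuous (fun x => rV_cons (f x, g x)).
Proof.
move=> cf cg; apply: (@continuous_row_mx 1 n) => //.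
by apply: continuous_rV => i; under eq_fun do rewrite mxE.
Qed.

Lemma rV_consE0 n (a : R) (v : 'rV[R]_n) : rV_cons (a, v) ord0 ord0 = a.
Proof. by have [] := rV_consK (a, v). Qed.

Lemma rV_consES n (a : R) (v : 'rV[R]_n) (i : 'I_n) :
  rV_cons (a, v) ord0 (lift ord0 i) = v ord0 i.
Proof.
have -> : lift ord0 i = rshift 1 i by exact/val_inj.
exact: (@row_mxEr _ 1 1 n).
Qed.

Lemma rV_cons_row_mx m k (a : R) (x : 'rV[R]_m) (y : 'rV[R]_k) :
  rV_cons (a, row_mx x y) = row_mx (rV_cons (a, x)) y :> 'rV[R]_(m.+1 + k).
Proof.
apply/rowP => i; case: (unliftP (ord0 : 'I_(m + k).+1) i) => [j ->|->].
  rewrite rV_consES; case: (split_ordP j) => l ->.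
    rewrite row_mxEl (_ : lift _ _ = lshift k (lift ord0 l)); last exact/val_inj.
    by rewrite row_mxEl rV_consES.
  rewrite row_mxEr (_ : lift _ _ = rshift m.+1 l); last exact/val_inj.
  by rewrite row_mxEr.
rewrite rV_consE0 (_ : ord0 = lshift k ord0 :> 'I_(m.+1 + k)); last exact/val_inj.
by rewrite row_mxEl rV_consE0.
Qed.

End continuous_rV.

Section derive_affine.
Context {R : realType}.

(** Along the direction [v] the map [T] is affine, so the two difference quotients are the same
    function of h. With [w = 0] this covers directions killed by [T], such as the X_1 directions
    under the projection on X_2. *)
Lemma derive_comp_affine (U V W : normedModType R) (T : U -> V) (f : V -> W)
    x v w : (forall h : R, T (h *: v + x) = h *: w + T x) ->
  (derivable (f \o T) x v <-> derivable f (T x) w) /\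
  'D_v (f \o T) x = 'D_w f (T x).
Proof.
move=> TE; rewrite /derivable /derive.
have -> : (fun h : R => h^-1 *: (((f \o T) \o shift x) (h *: v) - (f \o T) x)) =
          (fun h : R => h^-1 *: ((f \o shift (T x)) (h *: w) - f (T x))).
  by apply/funext => h /=; rewrite TE.
by [].
Qed.

Lemma partial_eq0 n (K : set 'rV[R]_n) (g : 'rV[R]_n -> R) i : closed K ->
  (forall x, ~ K x -> g x = 0) -> forall x, ~ K x -> partial i g x = 0.
Proof.
move=> cK gK x Kx; rewrite /partial -(derive_cst (0 : R) x (delta_mx ord0 i)).
apply: near_eq_derive.
have : nbhs x (~` K) by apply: open_nbhs_nbhs; split => //; exact: closed_openC.
by apply: filterS => y Ky; rewrite gK.
Qed.

End derive_affine.

Section Ck_theory.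
Context {R : realType}.

Section dim.
Context {n : nat}.
Implicit Types f g : 'rV[R]_n -> R.

Lemma Ck_continuous j f : Ck j f -> continuous f.
Proof. by case: j => [|j] []. Qed.

Lemma CkW j f : Ck j.+1 f -> Ck j f.
Proof.
elim: j f => [|j IHj] f [cf df]; split => // i.
by have [dfi Cfi] := df i; split => //; exact: IHj.
Qed.

Lemma Ck1P f : Ck 1 f <-> continuous f /\ forall i,
  (forall x, derivable f x (delta_mx ord0 i)) /\ continuous (partial i f).
Proof.
split=> [[cf df]|[cf df]]; split=> // i; have [? Cf] := df i; split=> //.
by case: Cf.
Qed.

Lemma Ck_cst j (c : R) : Ck j (cst c : 'rV[R]_n -> R).
Proof.
elim: j c => [|j IHj] c; split=> // ; try exact: cst_continuous.
move=> i; split=> [x|]; first exact: derivable_cst.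
rewrite (_ : partial i _ = cst 0) //; apply/funext => x.
exact: derive_cst.
Qed.

Lemma partialD f g i x : derivable f x (delta_mx ord0 i) ->
  derivable g x (delta_mx ord0 i) ->
  partial i (fun y => f y + g y) x = partial i f x + partial i g x.
Proof. exact: deriveD. Qed.

Lemma partialB f g i x : derivable f x (delta_mx ord0 i) ->
  derivable g x (delta_mx ord0 i) ->
  partial i (fun y => f y - g y) x = partial i f x - partial i g x.
Proof. exact: deriveB. Qed.

Lemma partialM f g i x : derivable f x (delta_mx ord0 i) ->
  derivable g x (delta_mx ord0 i) ->
  partial i (fun y => f y * g y) x = f x * partial i g x + partial i f x * g x.
Proof.
move=> df dg; apply: etrans (deriveM df dg) _.
by congr (_ + _); exact: mulrC.
Qed.

Lemma CkD j f g : Ck j f -> Ck j g -> Ck j (fun y => f y + g y).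
Proof.
elim: j f g => [|j IHj] f g [cf df] [cg dg]; split=> //.
- by move=> x; apply: continuousD; [exact: cf|exact: cg].
- by move=> x; apply: continuousD; [exact: cf|exact: cg].
move=> i; have [dfi Cfi] := df i; have [dgi Cgi] := dg i; split=> [x|].
  exact: derivableD.
rewrite (_ : partial i _ = fun y => partial i f y + partial i g y).
  exact: IHj.
by apply/funext => x; exact: partialD.
Qed.

Lemma CkM j f g : Ck j f -> Ck j g -> Ck j (fun y => f y * g y).
Proof.
elim: j f g => [|j IHj] f g.
  by move=> [cf _] [cg _]; split=> // x; apply: continuousM; [exact: cf|exact: cg].
move=> Cf Cg; have [cf df] := Cf; have [cg dg] := Cg; split.
  by move=> x; apply: continuousM; [exact: cf|exact: cg].
move=> i; have [dfi Cfi] := df i; have [dgi Cgi] := dg i; split=> [x|].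
  exact: derivableM.
rewrite (_ : partial i _ = fun y => f y * partial i g y + partial i f y * g y).
  by apply: CkD; apply: IHj => //; exact: CkW.
by apply/funext => x; exact: partialM.
Qed.

Lemma CkB j f g : Ck j f -> Ck j g -> Ck j (fun y => f y - g y).
Proof.
move=> Cf Cg; rewrite (_ : (fun _ => _) = fun y => f y + cst (-1) y * g y).
  by apply: CkD => //; apply: CkM => //; exact: Ck_cst.
by apply/funext => y /=; rewrite mulN1r.
Qed.

Lemma Ck_prod j (I : Type) (s : seq I) (f : I -> 'rV[R]_n -> R) :
  (forall i, Ck j (f i)) -> Ck j (fun y => \prod_(i <- s) f i y).
Proof.
move=> Cf; elim: s => [|i s IHs].
  by under eq_fun do rewrite big_nil; exact: (Ck_cst j 1).
by under eq_fun do rewrite big_cons; exact: CkM.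
Qed.

Lemma smooth_derivable f i x : smooth f -> derivable f x (delta_mx ord0 i).
Proof. by move=> /(_ 1%N) [_ /(_ i)[]]. Qed.

Lemma smooth_continuous f : smooth f -> continuous f.
Proof. by move=> /(_ 0%N) []. Qed.

Lemma smooth_partial f i : smooth f -> smooth (partial i f).
Proof. by move=> sf j; have [_ /(_ i)[]] := sf j.+1. Qed.

Lemma smoothM f g : smooth f -> smooth g -> smooth (fun y => f y * g y).
Proof. by move=> sf sg j; exact: CkM. Qed.

Lemma smoothB f g : smooth f -> smooth g -> smooth (fun y => f y - g y).
Proof. by move=> sf sg j; exact: CkB. Qed.

(** In the direction e_i only the coordinate i can move, so the difference quotient is that of the
    one-variable function [q] at 0. *)
Lemma is_derive_comp_coord (h h' : R -> R) (i0 i : 'I_n) (a b : R) (x : 'rV[R]_n) :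
  (forall t : R, is_derive t 1 h (h' t)) ->
  is_derive x (delta_mx ord0 i) (fun x : 'rV[R]_n => h (a * x ord0 i0 + b))
    ((i == i0)%:R * a * h' (a * x ord0 i0 + b)).
Proof.
move=> dh.
have E (s : R) : (fun x : 'rV[R]_n => h (a * x ord0 i0 + b)) (s *: delta_mx ord0 i + x) =
    h (s * ((i == i0)%:R * a) + (a * x ord0 i0 + b)).
  by rewrite !mxE eqxx/= eq_sym; congr h; ring.
set c := (i == i0)%:R * a in E *.
pose q (s : R) := h (s * c + (a * x ord0 i0 + b)).
have dq : is_derive (0 : R) 1 q (c * h' (a * x ord0 i0 + b)).
  have dl : is_derive (0 : R) 1 (fun s : R => s * c + (a * x ord0 i0 + b)) c.
    change (is_derive (0 : R) 1 ((id : R -> R) * cst c + cst (a * x ord0 i0 + b)) c).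
    by apply: is_derive_eq; rewrite scale0r add0r addr0 [_ *: _]mulr1.
  have dh0 := dh (0 * c + (a * x ord0 i0 + b)).
  have := @is_derive1_comp _ h _ 0 _ _ dh0 dl.
  by rewrite mul0r add0r [X in is_derive _ _ _ X -> _]mulrC.
have E2 : (fun s : R => s^-1 *: (((fun x : 'rV[R]_n => h (a * x ord0 i0 + b)) \o shift x)
      (s *: delta_mx ord0 i) - h (a * x ord0 i0 + b))) =
    (fun s : R => s^-1 *: ((q \o shift 0) (s *: 1) - q 0)).
  apply/funext => s; rewrite /= E /q mul0r add0r addr0.
  by rewrite [s *: 1]mulr1.
case: dq => dq1 dq2; apply: DeriveDef; rewrite /derivable /derive.
  by rewrite E2.
by rewrite E2.
Qed.

(* The class [S] collects the successive derivatives of one function of a real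
   variable. *)
Lemma Ck_comp_coord (S : set (R -> R)) (i0 : 'I_n) (a b : R) :
  (forall h, S h -> exists2 h', S h' & forall t : R, is_derive t 1 h (h' t)) ->
  forall j h, S h -> Ck j (fun x : 'rV[R]_n => h (a * x ord0 i0 + b)).
Proof.
move=> Sd; have cS h : S h -> continuous h.
  move=> /Sd[h' _ dh] t; apply: differentiable_continuous.
  by apply/derivable1_diffP; exact: ex_derive.
have cL h : S h -> continuous (fun x : 'rV[R]_n => h (a * x ord0 i0 + b)).
  move=> Sh x; apply: (@continuous_comp _ _ _ (fun x : 'rV[R]_n => a * x ord0 i0 + b)).
    apply: continuousD; last exact: cst_continuous.
    by apply: continuousM; [exact: cst_continuous|exact: continuous_coord].
  exact: cS.
elim=> [|j IHj] h Sh; first by split=> //; exact: cL.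
split; [exact: cL|move=> i].
have [h' Sh' dh] := Sd _ Sh.
have dhL x := is_derive_comp_coord i0 i a b x dh.
split=> [x|]; first by case: (dhL x).
rewrite (_ : partial i _ = fun x => cst ((i == i0)%:R * a) x * h' (a * x ord0 i0 + b)).
  by apply: CkM; [exact: Ck_cst|exact: IHj].
by apply/funext => x; rewrite /partial; case: (dhL x).
Qed.

End dim.

(** The map [s] records where [T] sends each coordinate direction, [None] standing for 0. Each
    partial derivative of the composite is then 0 or a partial derivative of f composed with [T],
    which closes the induction on the order. *)
Lemma Ck_comp_affine m n (T : 'rV[R]_m -> 'rV[R]_n) (s : 'I_m -> option 'I_n) :
  continuous T ->
  (forall x i (h : R), T (h *: delta_mx ord0 i + x) =
    h *: (if s i is Some j then delta_mx ord0 j else 0) + T x) ->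
  forall j f, Ck j f -> Ck j (f \o T).
Proof.
move=> cT TE; elim=> [|j IHj] f Cf.
  by split=> // x; apply: continuous_comp; [exact: cT|exact: (Ck_continuous Cf)].
have [cf df] := Cf.
split=> [x|i]; first by apply: continuous_comp; [exact: cT|exact: cf].
have TEi x := derive_comp_affine f (TE x i).
case si : (s i) TEi => [j'|] TEi.
  have [df' Cf'] := df j'.
  split=> [x|]; first exact/(TEi x).1.
  rewrite (_ : partial i (f \o T) = partial j' f \o T); first exact: IHj.
  by apply/funext => x; exact: (TEi x).2.
split=> [x|]; first by apply/(TEi x).1; exact: derivable0.
rewrite (_ : partial i (f \o T) = cst 0); first exact: Ck_cst.
by apply/funext => x; rewrite /partial (TEi x).2 derive0.
Qed.

End Ck_theory.

(** * Integration on R^n *)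

Section box.
Context {R : realType} {n : nat}.
Local Notation mu := (@lebesgue_rV R n).

Definition box (M : R) : set 'rV[R]_n := [set x | forall i, `|x ord0 i| <= M].

Lemma box_compact M : compact (box M).
Proof.
have := @rV_compact R n (fun _ => `[- M, M]%classic) (fun _ => @segment_compact _ _ _).
by congr compact; apply/seteqP; split=> x xM i; have := xM i; rewrite /= in_itv/= ler_norml.
Qed.

Lemma box_closed M : closed (box M).
Proof.
by apply: compact_closed; [exact: norm_hausdorff|exact: box_compact].
Qed.

Lemma box_measurable M : measurable (box M).
Proof.
rewrite -(setCK (box M)); apply: measurableC; apply: open_measurable_rV.
exact/closed_openC/box_closed.
Qed.

Lemma box_volume M : mu (box M) = ((2 * Num.max M 0) ^+ n)%:E.
Proof.
have -> : ((2 * Num.max M 0) ^+ n)%:E =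
    (\prod_(i < n) lebesgue_measure `[(- M)%R, M]%classic)%E.
  rewrite -[n in X in X%:E]card_ord -prodr_const -prodEFin.
  apply: eq_bigr => i _; rewrite lebesgue_measure_itv/= lte_fin -EFinD.
  case: ltP => MM; congr EFin; first by rewrite max_l; lra.
  by rewrite max_r; lra.
rewrite -(lebesgue_rV_box (fun _ => @measurable_itv R `[- M, M])).
by congr (mu _); apply/seteqP; split=> x xM i; have := xM i; rewrite /= in_itv/= ler_norml.
Qed.

Lemma box_fin M : (mu (box M) < +oo)%E.
Proof. by rewrite box_volume ltry. Qed.

Lemma integrable_csupp (g : 'rV[R]_n -> R) M : continuous g ->
  (forall x, ~ box M x -> g x = 0) -> mu.-integrable setT (EFin \o g).
Proof.
move=> cg gM; have mg := continuous_measurable_rV cg.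
apply/(eq_integrable measurableT ((EFin \o g) \_ (box M))).
  by move=> x _; rewrite patchE; case: ifPn => // /negP; rewrite inE => /gM/= ->.
apply: (integrable_mkcond _ (box_measurable M)).1.
apply: measurable_bounded_integrable.
- exact: box_measurable.
- exact: box_fin.
- exact: measurable_funTS.
have /compact_bounded : compact (g @` box M).
  by apply: (continuous_compact (continuous_subspaceT cg)); exact: box_compact.
case=> B [Br gB]; exists B; split=> // N BN x xM; apply: (gB N BN).
by exists x.
Qed.

End box.

Section fubini_cons.
Context {R : realType} {n : nat}.
Local Notation mu := (@lebesgue_rV R).
Local Notation leb := (@lebesgue_measure R).

Lemma ge0_integral_rV_cons (K : 'rV[R]_n.+1 -> \bar R) :
  measurable_fun setT K -> (forall x, 0 <= K x)%E ->
  (\int[mu n.+1]_x K x =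
   \int[leb]_a \int[mu n]_v K (rV_cons (a, v)))%E.
Proof.
move=> mK K0; rewrite /= /cons_measure ge0_integral_pushforward//;
  last exact: measurable_rV_cons.
rewrite preimage_setT (fubini_tonelli1 (K \o @rV_cons R n))//.
  by apply: measurableT_comp => //; exact: measurable_rV_cons.
by move=> z; exact: K0.
Qed.

Section integrable.
Variable K : 'rV[R]_n.+1 -> R.
Hypothesis iK : (mu n.+1).-integrable setT (EFin \o K).

Let iK' : (leb \x mu n)%E.-integrable setT (EFin \o (K \o @rV_cons R n)).
Proof.
have /integrableP[mK Koo] := iK; apply/integrableP; split.
  by apply: (measurableT_comp (f := EFin \o K)) => //; exact: measurable_rV_cons.
move: Koo; rewrite /= /cons_measure ge0_integral_pushforward//.
  exact: measurable_rV_cons.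
by apply: (measurableT_comp (f := abse) _ mK); exact: abse_measurable.
Qed.

Lemma ae_integrable_rV_cons :
  {ae leb, forall a, (mu n).-integrable setT (fun v => (K (rV_cons (a, v)))%:E)}.
Proof. exact: (ae_integrable1 iK'). Qed.

Lemma measurable_integral_rV_cons :
  measurable_fun setT (fun a => (\int[mu n]_v (K (rV_cons (a, v)))%:E)%E).
Proof. exact: (measurable_fubini_F iK'). Qed.

Lemma integral_rV_cons :
  (\int[mu n.+1]_x (K x)%:E =
   \int[leb]_a \int[mu n]_v (K (rV_cons (a, v)))%:E)%E.
Proof.
have := integral12_prod_meas1 iK'; rewrite /fubini_F => ->.
rewrite /= /cons_measure integral_pushforward//.
- exact: measurable_rV_cons.
- by have /integrableP[] := iK.
Qed.

Lemma integral_rV_cons_swap :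
  (\int[mu n.+1]_x (K x)%:E =
   \int[mu n]_v \int[leb]_a (K (rV_cons (a, v)))%:E)%E.
Proof. by rewrite integral_rV_cons; exact: Fubini iK'. Qed.

End integrable.
End fubini_cons.

(** * Integrals of derivatives of compactly supported functions *)

Section integral_partial.
Context {R : realType}.
Local Notation mu := (@lebesgue_rV R).
Local Notation leb := (@lebesgue_measure R).

(** The fundamental theorem of calculus on [-B, B]: q vanishes at both ends, and q' vanishes beyond
    them because q is 0 near such points. *)
Lemma integral_derive_csupp (q q' : R -> R) (M : R) :
  (forall a : R, is_derive a 1 q (q' a)) -> continuous q' ->
  (forall a, M < `|a| -> q a = 0) -> (\int[leb]_a (q' a)%:E = 0)%E.
Proof.
move=> dq cq' qM; set B : R := `|M| + 1.
have MB : M < B by rewrite /B (le_lt_trans (ler_norm _))// ltrDl.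
have B0 : 0 < B by rewrite /B ltr_wpDl.
have q'M a : B < `|a| -> q' a = 0.
  move=> Ba; have -> : q' a = 'D_1 q a by case: (dq a).
  rewrite -(derive_cst (0 : R) a 1); apply: near_eq_derive.
  have /cvgr_gt/(_ _ Ba) := @norm_continuous _ R a.
  by apply: filterS => y By; rewrite qM// (lt_trans MB).
transitivity (\int[leb]_(a in `[(- B)%R, B]) (q' a)%:E)%E.
  rewrite [RHS]integral_mkcond; apply: eq_integral => a _.
  rewrite patchE; case: ifPn => // aB; rewrite q'M// ltNge ler_norml.
  by apply: contra aB => aB; rewrite inE/= in_itv/=.
rewrite (@continuous_FTC2 _ q' q).
- have -> : q B = 0 by apply: qM; rewrite ger0_norm// ltW.
  by have -> : q (- B) = 0; [apply: qM; rewrite normrN ger0_norm// ltW|rewrite subee].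
- by lra.
- exact: continuous_subspaceT.
- have cq : continuous q.
    move=> a; apply: differentiable_continuous.
    by apply/derivable1_diffP; case: (dq a).
  split=> [a _||]; first by case: (dq a).
    exact/cvg_at_right_filter/cq.
  exact/cvg_at_left_filter/cq.
- by move=> a _; rewrite derive1E; case: (dq a).
Qed.

Lemma rV_cons_tail_affine n (a : R) (j : 'I_n) (v : 'rV[R]_n) (h : R) :
  rV_cons (a, h *: delta_mx ord0 j + v) =
  h *: delta_mx ord0 (lift ord0 j) + rV_cons (a, v).
Proof.
apply/rowP => l; case: (unliftP ord0 l) => [l' ->|->].
  by rewrite !(rV_consES, mxE) (inj_eq lift_inj).
by rewrite !(rV_consE0, mxE)/= mulr0 add0r.
Qed.

Lemma rV_cons_head_affine n (a : R) (v : 'rV[R]_n) (h : R) :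
  rV_cons (h *: 1 + a, v) = h *: delta_mx ord0 ord0 + rV_cons (a, v).
Proof.
apply/rowP => l; case: (unliftP ord0 l) => [l' ->|->].
  by rewrite !(rV_consES, mxE)/= mulr0 add0r.
by rewrite !(rV_consE0, mxE).
Qed.

(** Induction on the dimension, splitting off the first coordinate. For a later direction the inner
    integral over each slice vanishes by induction; for the first direction the order of integration
    is exchanged and the one-dimensional case applies on each line. *)
Theorem integral_partial n (g : 'rV[R]_n -> R) (i : 'I_n) M :
  Ck 1 g -> (forall x, ~ box M x -> g x = 0) ->
  (\int[mu n]_x (partial i g x)%:E = 0)%E.
Proof.
elim: n g i => [g [//]|n IHn g i Cg gM].
have [cg dg] := (Ck1P g).1 Cg; have [dgi cgi] := dg i.
have ig : (mu n.+1).-integrable setT (EFin \o partial i g).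
  exact: (integrable_csupp cgi (partial_eq0 i (@box_closed R n.+1 M) gM)).
have consM a (v : 'rV[R]_n) : box M (rV_cons (a, v)) -> `|a| <= M /\ box M v.
  move=> avM; split=> [|j]; first by have := avM ord0; rewrite rV_consE0.
  by have := avM (lift ord0 j); rewrite rV_consES.
case: (unliftP ord0 i) ig cgi dgi => [j ->|->] ig cgi dgi.
  rewrite integral_rV_cons//; apply: integral0_eq => a _.
  pose ga (v : 'rV[R]_n) := g (rV_cons (a, v)).
  have Ta := rV_cons_tail_affine a j.
  rewrite -(IHn ga j); last 2 first.
  - apply: (@Ck_comp_affine _ _ _ (fun v => rV_cons (a, v)) (fun j => Some (lift ord0 j))) => //.
      by apply: continuous_rV_cons; [exact: cst_continuous|move=> x; exact: cvg_id].
    by move=> x j' h; exact: rV_cons_tail_affine.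
  - by move=> v vM; apply: gM => /consM[].
  apply: eq_integral => v _; congr EFin.
  by have [_ /esym] := derive_comp_affine g (Ta v).
rewrite integral_rV_cons_swap//; apply: integral0_eq => v _.
pose T a := rV_cons (a, v).
have cT : continuous T.
  by apply: continuous_rV_cons; [move=> x; exact: cvg_id|exact: cst_continuous].
apply: (@integral_derive_csupp (g \o T) _ M).
- move=> a; have [d1 d2] := @derive_comp_affine R R _ _ T g a 1 _ (rV_cons_head_affine a v).
  by split; [exact/d1|exact: d2].
- by move=> a; apply: (continuous_comp (cT a)); exact: cgi.
- by move=> a Ma; apply: gM => /consM[]; rewrite leNgt Ma.
Qed.

End integral_partial.

(** * Integration by slices in X_1 and X_2 *)

Section slices.
Context {R : realType}.
Local Notation mu := (@lebesgue_rV R).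
Local Notation leb := (@lebesgue_measure R).

(** This form of Fubini turns an identity in omega2, valid on each slice X_1 = const, into an
    identity on the cylinder. *)
Lemma integral_slices_eq0 m k (K : 'rV[R]_(m + k) -> R) :
  (mu (m + k)).-integrable setT (EFin \o K) ->
  (forall x1, \int[mu k]_x2 (K (row_mx x1 x2))%:E = 0)%E ->
  (\int[mu (m + k)]_x (K x)%:E = 0)%E.
Proof.
elim: m K => [K _ K0|m IHm K iK K0].
  rewrite -(K0 0); apply: eq_integral => x _.
  by congr (EFin (K _)); rewrite [row_mx _ _]row_thin_mx.
rewrite (@integral_rV_cons _ (m + k) K iK).
(* The integrals over slices vanish for every x1, but the integrability that the induction needs is
   known only for almost every first coordinate. *)
rewrite (ae_eq_integral (cst 0%E)) ?integral0//.
  exact: measurable_integral_rV_cons iK.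
have := ae_integrable_rV_cons iK; apply: filterS => a ia _.
apply: IHm => // x1; rewrite -(K0 (rV_cons (a, x1))).
by apply: eq_integral => x2 _; rewrite -rV_cons_row_mx.
Qed.

(** Source of the factor l^m: a function of X_2 alone is integrated over a box in X_1, one
    coordinate at a time. For m = 0 both the box condition and the factor are trivial. *)
Lemma ge0_integral_box_tail m k (g : 'rV[R]_k -> \bar R) M :
  measurable_fun setT g -> (forall x, 0 <= g x)%E ->
  (\int[mu (m + k)]_(x in [set x | box M (lsubmx x)]) g (rsubmx x) =
   ((2 * Num.max M 0) ^+ m)%:E * \int[mu k]_x2 g x2)%E.
Proof.
move=> mg g0; elim: m => [|m IHm].
  rewrite expr0 mul1e (_ : [set _ | _] = setT); last first.
    by apply/seteqP; split => // x _ [].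
  apply: eq_integral => x _; congr g; apply/rowP => i.
  by rewrite mxE; congr (x _ _); exact/val_inj.
rewrite integral_mkcond.
have mD j : measurable [set x : 'rV[R]_(j + k) | box M (lsubmx x)].
  have := @measurable_lsubmx R j k measurableT _ (@box_measurable R j M).
  by rewrite setTI.
have mK j : measurable_fun setT
    ((fun x : 'rV[R]_(j + k) => g (rsubmx x)) \_ [set x | box M (lsubmx x)]).
  apply: (measurable_restrictT _ (mD j)).1.
  have m1 : measurable_fun setT (g \o @rsubmx R 1 j k).
    by apply: measurableT_comp => //; exact: measurable_rsubmx.
  exact: measurable_funTS m1.
rewrite (@ge0_integral_rV_cons R (m + k) _ (mK m.+1)); last first.
  by move=> x; rewrite patchE; case: ifP.
transitivity (\int[leb]_(a in `[(- M)%R, M]) (((2 * Num.max M 0) ^+ m)%:E * \int[mu k]_x2 g x2))%E.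
  rewrite [RHS]integral_mkcond; apply: eq_integral => a _.
  have E (v : 'rV[R]_(m + k)) : 
    ((fun x : 'rV[R]_(m.+1 + k) => g (rsubmx x)) \_ [set x | box M (lsubmx x)]) (rV_cons (a, v))
    = if `|a| <= M then ((fun x : 'rV[R]_(m + k) => g (rsubmx x)) \_ [set x | box M (lsubmx x)]) v else 0%E.
    rewrite -[v]hsubmxK rV_cons_row_mx !patchE.
    rewrite !row_mxKr; have -> : (row_mx (rV_cons (a, lsubmx v)) (rsubmx v)
         \in [set x : 'rV[R]_(m.+1 + k) | box M (lsubmx x)]) =
       (`|a| <= M) && (row_mx (lsubmx v) (rsubmx v) \in [set x | box M (lsubmx x)]).
      apply/idP/andP; rewrite !inE /= !row_mxKl.
        move=> aM; split; first by have := aM ord0; rewrite rV_consE0.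
        by move=> i; have := aM (lift ord0 i); rewrite rV_consES.
      move=> [aM vM] i; case: (unliftP ord0 i) => [j ->|->]; first by rewrite rV_consES.
      by rewrite rV_consE0.
    by case: (_ <= _).
  under eq_integral do rewrite E.
  rewrite patchE mem_setE/= in_itv/= ler_norml; case: ifP => _.
    by rewrite -IHm [RHS]integral_mkcond.
  by rewrite integral0.
rewrite integral_cst//= lebesgue_measure_itv/= lte_fin -EFinD.
have -> : (if - M < M then (M - - M)%:E else 0%E) = (2 * Num.max M 0)%:E.
  case: ltP => MM; congr EFin; first by rewrite max_l; lra.
  by rewrite max_r; lra.
by rewrite muleC exprS EFinM muleA.
Qed.

End slices.

(** * Flat functions and powers *)

Section flat.
Context {R : realType}.

(** The difference quotient at 0 is at most C |h|. This treats the point 0 both for the [flat]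
    functions and for |t|^p with p >= 2. *)
Lemma is_derive0_quadratic (g : R -> R) (C : R) : g 0 = 0 ->
  (\forall h \near (0 : R), `|g h| <= C * h ^+ 2) -> is_derive (0 : R) 1 g 0.
Proof.
move=> g0 gC.
have Q0 : h^-1 *: ((g \o shift 0) (h *: (1 : R)) - g 0) @[h --> 0^'] --> (0 : R).
  apply: (@squeeze_cvgr _ _ _ _ (fun h => - (C * `|h|)) (fun h => C * `|h|)).
  - near=> h; have h0 : h != 0 by near: h; exact: nbhs_dnbhs_neq.
    have gh : `|g h| <= C * h ^+ 2 by near: h; exact: (nbhs_dnbhs gC).
    rewrite -ler_norml g0 subr0 /= addr0 [h *: 1]mulr1 normrM normfV.
    rewrite ler_pdivrMl ?normr_gt0//; apply: le_trans gh _.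
    by rewrite -real_normK ?num_real// expr2 mulrCA.
  - rewrite -[X in _ --> X]oppr0; apply: cvgN.
    rewrite -[X in _ --> X](mulr0 C); apply: cvgM; first exact: cvg_cst.
    rewrite -[X in _ --> X](@normr0 _ R).
    by apply: cvg_within_filter; exact: norm_continuous.
  - rewrite -[X in _ --> X](mulr0 C); apply: cvgM; first exact: cvg_cst.
    rewrite -[X in _ --> X](@normr0 _ R).
    by apply: cvg_within_filter; exact: norm_continuous.
by split; [apply/cvg_ex; exists 0|exact/cvg_lim].
Unshelve. all: by end_near. Qed.

(** A single term of the exponential series. It controls the flat profile and later absorbs the
    power l^m. *)
Lemma expr_le_expR n (y : R) : 0 <= y -> y ^+ n <= n`!%:R * expR y.
Proof.
case: n => [|n] y0.
  rewrite expr0 fact0 mul1r; have := expR_ge1Dx y; lra.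
rewrite mulrC -ler_pdivrMr ?ltr0n ?fact_gt0//.
by have := expR_ge1Dxn n y0; lra.
Qed.

(* [exp(-1/t)], extended by [0]; the factor [P(1/t)] makes the class closed under
   differentiation. *)
Definition flat (P : {poly R}) (t : R) : R :=
  if 0 < t then P.[t^-1] * expR (- t^-1) else 0.

(** Since the derivative of 1/t is -1/t^2, differentiating P(1/t) e^(-1/t) gives t^(-2) (P -
    P')(1/t) e^(-1/t). *)
Definition flat_deriv (P : {poly R}) : {poly R} := 'X^2 * (P - P^`()).

(** With y = 1/t, the sum of the |P_i| y^(i+2) has to be at most a multiple of e^y; this holds term
    by term, as y^(i+2) <= (i+2)! e^y. *)
Lemma flat_quadratic (P : {poly R}) : exists C, forall t, `|flat P t| <= C * t ^+ 2.
Proof.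
exists (\sum_(i < size P) `|P`_i| * (i + 2)`!%:R) => t.
rewrite /flat; case: ifPn => [t0|_]; last first.
  by rewrite normr0 mulr_ge0 ?sqr_ge0// sumr_ge0// => i _; rewrite mulr_ge0.
set y := t^-1; have y0 : 0 < y by rewrite invr_gt0.
have -> : t ^+ 2 = (y ^+ 2)^-1 by rewrite /y exprVn invrK.
rewrite ler_pdivlMr ?exprn_gt0// normrM [`|expR _|]ger0_norm ?expR_ge0// expRN.
rewrite mulrAC ler_pdivrMr ?expR_gt0// horner_coef.
apply: le_trans (ler_wpM2r (sqr_ge0 _) (ler_norm_sum _ _ _)) _.
rewrite mulr_suml mulr_suml; apply: ler_sum => i _.
rewrite normrM normrX [`|y|]gtr0_norm// -mulrA -exprD -mulrA ler_wpM2l//.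
exact/expr_le_expR/ltW.
Qed.

Lemma is_derive_flat (P : {poly R}) (t : R) :
  is_derive t 1 (flat P) (flat (flat_deriv P) t).
Proof.
have [t0|t0|->] := ltgtP t 0.
- have -> : flat (flat_deriv P) t = 0 by rewrite /flat ltNge ltW.
  apply: (near_eq_is_derive _ (is_derive_cst (0 : R) t 1)).
  by near=> s; rewrite /flat ltNge ltW//; near: s; exact: lt_nbhsl.
- have tn0 : t != 0 by rewrite gt_eqF.
  have dV : is_derive t 1 (fun s : R => s^-1) (- t ^- 2).
    have := @is_deriveV _ id t 1 1 tn0 (is_derive_id t 1).
    by move/is_derive_eq; apply; rewrite /= [_ *: _]mulr1.
  have dP := @is_derive1_comp _ (horner P) _ t _ _ (is_derive_poly P _) dV.
  have dE := @is_derive1_comp _ expR _ t _ _ (is_derive_expR _) (is_deriveN dV).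
  have dPE := is_deriveM dP dE.
  apply: (near_eq_is_derive (f := (horner P \o (fun s : R => s^-1)) * (expR \o (- (fun s : R => s^-1))))).
  + by near=> s; rewrite /flat ifT//; near: s; exact: lt_nbhsr.
  apply: is_derive_eq; rewrite /flat t0 /flat_deriv /=.
  rewrite !(hornerE, hornerXn) /GRing.scale/= -exprVn; ring.
- have -> : flat (flat_deriv P) 0 = 0 by rewrite /flat ltxx.
  have [C PC] := flat_quadratic P.
  apply: (is_derive0_quadratic (C := C)); first by rewrite /flat ltxx.
  near=> h; exact: PC.
Unshelve. all: by end_near. Qed.

Lemma flat1_ge0 t : 0 <= flat 1 t.
Proof. by rewrite /flat; case: ifP => // _; rewrite hornerC mul1r expR_ge0. Qed.

Lemma flat1_le1 t : flat 1 t <= 1.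
Proof.
rewrite /flat; case: ifP => // t0; rewrite hornerC mul1r.
by rewrite -expR0 ler_expR oppr_le0 invr_ge0 ltW.
Qed.

Lemma flat1_lbound t : 1 <= t -> expR (-1) <= flat 1 t.
Proof.
move=> t1; have t0 : 0 < t by exact: lt_le_trans t1.
by rewrite /flat t0 hornerC mul1r ler_expR lerN2 invf_le1.
Qed.

Lemma flat1_eq0 t : t <= 0 -> flat 1 t = 0.
Proof. by move=> t0; rewrite /flat ltNge t0. Qed.

(** For t > 0 the derivative is y^2 e^(-y) with y = 1/t, and y^2 <= 2! e^y. *)
Lemma flat1_deriv_bound t : `|flat (flat_deriv 1) t| <= 2.
Proof.
rewrite /flat; case: ifP => t0; last by rewrite normr0.
have y0 : 0 <= t^-1 by rewrite invr_ge0 ltW.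
rewrite /flat_deriv derivC subr0 mulr1 hornerXn expRN normrM.
rewrite ger0_norm ?exprn_ge0// ger0_norm ?invr_ge0 ?expR_ge0//.
by rewrite ler_pdivrMr ?expR_gt0//; exact: (expr_le_expR 2).
Qed.

End flat.

(** * Elementary inequalities for powers, and the derivative of |t|^p *)

Section powR_lemmas.
Context {R : realType}.
Implicit Types a b p : R.

(** Young's inequality with coefficient 1/2 on a^p, so that this term can be absorbed on the left.
    If 2b <= a the product is at most a^p / 2; otherwise a < 2b and it is at most (2b)^p. *)
Lemma powR_absorb a b p : 2 <= p -> 0 <= a -> 0 <= b ->
  a `^ (p - 1) * b <= 2^-1 * a `^ p + 2 `^ p * b `^ p.
Proof.
move=> p2 a0 b0; have p0 : 0 < p by lra.
have ap : 0 <= a `^ p by exact: powR_ge0.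
have bp : 0 <= 2 `^ p * b `^ p by rewrite mulr_ge0 ?powR_ge0.
have [ba|ab] := leP (2 * b) a.
  have h : a `^ (p - 1) * b <= a `^ (p - 1) * (2^-1 * a).
    by rewrite ler_wpM2l ?powR_ge0//; lra.
  have := mulr_powRB1 a0 p0; nra.
have h : a `^ (p - 1) * b <= (2 * b) `^ (p - 1) * (2 * b).
  apply: ler_pM; rewrite ?powR_ge0//; last by lra.
  by apply: ge0_ler_powR; rewrite ?nnegrE; lra.
have : (2 * b) `^ (p - 1) * (2 * b) = 2 `^ p * b `^ p.
  by rewrite mulrC mulr_powRB1 ?powRM//; lra.
lra.
Qed.

(** Both factors may be replaced by the larger of a and b. *)
Lemma powR_mul_le_add a b p : 2 <= p -> 0 <= a -> 0 <= b ->
  a `^ (p - 1) * b <= a `^ p + b `^ p.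
Proof.
move=> p2 a0 b0; have p0 : 0 < p by lra.
have ap : 0 <= a `^ p by exact: powR_ge0.
have bp : 0 <= b `^ p by exact: powR_ge0.
have [ba|ab] := leP b a.
  have : a `^ (p - 1) * b <= a `^ (p - 1) * a by rewrite ler_wpM2l ?powR_ge0.
  have := mulr_powRB1 a0 p0; nra.
have : a `^ (p - 1) * b <= b `^ (p - 1) * b.
  by rewrite ler_wpM2r//; apply: ge0_ler_powR; rewrite ?nnegrE; lra.
have := mulr_powRB1 b0 p0; nra.
Qed.

Lemma powR_add_le a b p : 0 <= p -> 0 <= a -> 0 <= b ->
  (a + b) `^ p <= 2 `^ p * (a `^ p + b `^ p).
Proof.
move=> p0 a0 b0; have ap : 0 <= a `^ p by exact: powR_ge0.
have bp : 0 <= b `^ p by exact: powR_ge0.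
have t0 : 0 <= 2 `^ p :> R by exact: powR_ge0.
have [ba|/ltW ab] := leP b a.
  have : (a + b) `^ p <= (2 * a) `^ p by apply: ge0_ler_powR; rewrite ?nnegrE; lra.
  by rewrite powRM//; nra.
have : (a + b) `^ p <= (2 * b) `^ p by apply: ge0_ler_powR; rewrite ?nnegrE; lra.
by rewrite powRM//; nra.
Qed.

Lemma near0_norm_le1 : \forall h \near (0 : R), `|h| <= 1.
Proof. by apply: (@nbhs0_le _ R^o). Qed.

(* The derivative of [|t|^p]. *)
Definition dpow p (t : R) : R := p * (`|t| `^ (p - 2) * t).

Lemma norm_dpow p t : 2 <= p -> `|dpow p t| = p * `|t| `^ (p - 1).
Proof.
move=> p2; rewrite /dpow !normrM (ger0_norm (powR_ge0 _ _)) ger0_norm; last by lra.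
congr (_ * _); have [->|t0] := eqVneq t 0.
  by rewrite normr0 mulr0 powR0// gt_eqF//; lra.
have -> : p - 2 = (p - 1) - 1 by ring.
by rewrite mulrC mulr_powRB1//; lra.
Qed.

(** Away from 0 this is the derivative of a power of t or of -t; at 0 it rests on |h|^p <= h^2 for
    |h| <= 1, which is where p >= 2 enters. *)
Lemma is_derive_pow p (t : R) : 2 <= p ->
  is_derive t 1 (fun s => `|s| `^ p) (dpow p t).
Proof.
move=> p2; have [t0|t0|->] := ltgtP t 0.
- apply: (near_eq_is_derive (f := (@powR R ^~ p) \o (-%R))).
  + by near=> s; rewrite /= ltr0_norm//; near: s; exact: lt_nbhsl.
  have t0' : 0 < - t by lra.
  have := @is_derive1_comp _ _ (-%R : R -> R) t _ _ (is_derive1_powR p t0') (is_deriveN (is_derive_id t 1)).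
  move/is_derive_eq; apply; rewrite /dpow ltr0_norm// mulrN1.
  have -> : p - 1 = (p - 2) + 1 by ring.
  by rewrite powRD ?powRr1 ?ltW//; [ring|apply/implyP => _; rewrite gt_eqF].
- apply: (near_eq_is_derive (f := @powR R ^~ p)).
  + by near=> s; rewrite /= gtr0_norm//; near: s; exact: lt_nbhsr.
  have := is_derive1_powR p t0.
  move/is_derive_eq; apply; rewrite /dpow gtr0_norm//.
  have -> : p - 1 = (p - 2) + 1 by ring.
  by rewrite powRD ?powRr1 ?ltW//; apply/implyP => _; rewrite gt_eqF.
- have -> : dpow p 0 = 0 by rewrite /dpow mulr0 mulr0.
  have pq : \forall h \near (0 : R), `| (`|h| `^ p) | <= 1 * h ^+ 2.
    near=> h; rewrite mul1r ger0_norm ?powR_ge0//.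
    have h1 : `|h| <= 1 by near: h; exact: near0_norm_le1.
    rewrite -real_normK ?num_real// -powR_mulrn//.
    have [->|h0] := eqVneq h 0; first by rewrite normr0 !powR0// gt_eqF//; lra.
    by apply: ger_powR => //; rewrite normr_gt0 h0.
  apply: is_derive0_quadratic pq.
  by rewrite normr0 powR0// gt_eqF//; lra.
Unshelve. all: by end_near. Qed.

(** At 0 the function is squeezed: its absolute value p |s|^(p-1) is at most p |s| for |s| <= 1,
    since p >= 2. *)
Lemma continuous_dpow p : 2 <= p -> continuous (dpow p).
Proof.
move=> p2 t; have [->|t0] := eqVneq t 0.
  have d0 : dpow p 0 = 0 by rewrite /dpow !mulr0.
  have pn0 : (fun s : R => p * `|s|) @ (0 : R) --> (0 : R).
    rewrite -[X in _ --> X](mulr0 p); apply: cvgM; first exact: cvg_cst.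
    by rewrite -[X in _ --> X](@normr0 _ R); exact: norm_continuous.
  rewrite /continuous_at d0.
  apply: (@squeeze_cvgr _ _ _ _ (fun s => - (p * `|s|)) (fun s => p * `|s|)) => //.
    near=> s; rewrite -ler_norml norm_dpow// ler_wpM2l//; first by lra.
    have s1 : `|s| <= 1 by near: s; exact: near0_norm_le1.
    have [->|s0] := eqVneq s 0; first by rewrite normr0 powR0// gt_eqF//; lra.
    by apply: ge1r_powR; [rewrite normr_gt0 s0|lra].
  by rewrite -[X in _ --> X]oppr0; exact: cvgN.
apply: cvgM; first exact: cvg_cst.
apply: cvgM; last exact: cvg_id.
apply: (@continuous_comp _ _ _ (fun s : R => `|s|) (@powR R ^~ (p - 2))).
  exact: norm_continuous.
apply: differentiable_continuous; apply/derivable1_diffP.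
by apply: derivable_powR; rewrite in_itv/= andbT normr_gt0.
Unshelve. all: by end_near. Qed.

End powR_lemmas.

(** * The Euclidean norm and L^p *)

Section enorm_theory.
Context {R : realType} {n : nat}.
Implicit Types x y z : 'rV[R]_n.

Lemma dotC x y : dot x y = dot y x.
Proof. by apply: eq_bigr => i _; rewrite mulrC. Qed.

Lemma dotDl x y z : dot (x + y) z = dot x z + dot y z.
Proof. by rewrite -big_split; apply: eq_bigr => i _; rewrite mxE mulrDl. Qed.

Lemma dotZl a x z : dot (a *: x) z = a * dot x z.
Proof. by rewrite mulr_sumr; apply: eq_bigr => i _; rewrite mxE mulrA. Qed.

Lemma dotDr x y z : dot z (x + y) = dot z x + dot z y.
Proof. by rewrite dotC dotDl !(dotC z). Qed.

Lemma dotZr a x z : dot z (a *: x) = a * dot z x.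
Proof. by rewrite dotC dotZl dotC. Qed.

Lemma dotNl x z : dot (- x) z = - dot x z.
Proof. by rewrite -scaleN1r dotZl mulN1r. Qed.

Lemma dotBl x y z : dot (x - y) z = dot x z - dot y z.
Proof. by rewrite dotDl dotNl. Qed.

Lemma dotBr x y z : dot z (x - y) = dot z x - dot z y.
Proof. by rewrite dotC dotBl !(dotC z). Qed.

Lemma dot_ge0 x : 0 <= dot x x.
Proof. by apply: sumr_ge0 => i _; rewrite -expr2 sqr_ge0. Qed.

Lemma enorm_ge0 x : 0 <= enorm x.
Proof. exact: sqrtr_ge0. Qed.

Lemma norm_enorm x : `|enorm x| = enorm x.
Proof. by rewrite ger0_norm// enorm_ge0. Qed.

Lemma sqr_enorm x : enorm x ^+ 2 = dot x x.
Proof. by rewrite sqr_sqrtr// dot_ge0. Qed.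

Lemma enorm0 : enorm (0 : 'rV[R]_n) = 0.
Proof. by rewrite /enorm /dot big1 ?sqrtr0// => i _; rewrite mxE mul0r. Qed.

Lemma enormN x : enorm (- x) = enorm x.
Proof. by congr Num.sqrt; apply: eq_bigr => i _; rewrite mxE mulrNN. Qed.

Lemma enormZ a x : enorm (a *: x) = `|a| * enorm x.
Proof. by rewrite /enorm dotZl dotZr mulrA sqrtrM -expr2 ?sqr_ge0// sqrtr_sqr. Qed.

Lemma norm_coord_le_enorm x i : `|x ord0 i| <= enorm x.
Proof.
rewrite -sqrtr_sqr ler_sqrt ?dot_ge0// /dot (bigD1 i)//= expr2 lerDl.
by apply: sumr_ge0 => j _; rewrite -expr2 sqr_ge0.
Qed.

Lemma enorm_eq0 x : enorm x = 0 -> x = 0.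
Proof.
move=> x0; apply/rowP => i; rewrite mxE; apply/normr0_eq0/eqP.
by rewrite eq_le normr_ge0 andbT -x0 norm_coord_le_enorm.
Qed.

(** Sum the inequalities (|y| |x_i| - |x| |y_i|)^2 >= 0 over i and divide by 2 |x| |y|. *)
Lemma cauchy_schwarz x y : `|dot x y| <= enorm x * enorm y.
Proof.
have [/enorm_eq0->|x0] := eqVneq (enorm x) 0.
  by rewrite /dot big1 ?normr0 ?mulr_ge0 ?enorm_ge0// => i _; rewrite mxE mul0r.
have [/enorm_eq0->|y0] := eqVneq (enorm y) 0.
  by rewrite /dot big1 ?normr0 ?mulr_ge0 ?enorm_ge0// => i _; rewrite mxE mulr0.
have {}x0 : 0 < enorm x by rewrite lt0r x0 enorm_ge0.
have {}y0 : 0 < enorm y by rewrite lt0r y0 enorm_ge0.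
have xy0 := mulr_gt0 x0 y0.
suff : 2 * (enorm x * enorm y) * `|dot x y| <= 2 * (enorm x * enorm y) ^+ 2.
  by move=> h; rewrite -(ler_pM2l xy0); lra.
apply: (@le_trans _ _ (\sum_i 2 * (enorm x * enorm y) * `|x ord0 i * y ord0 i|)).
  rewrite -mulr_sumr ler_wpM2l//; first lra.
  exact: ler_norm_sum.
apply: (@le_trans _ _ (\sum_i (enorm y ^+ 2 * (x ord0 i * x ord0 i)
    + enorm x ^+ 2 * (y ord0 i * y ord0 i)))).
  apply: ler_sum => i _; rewrite normrM.
  have -> : x ord0 i * x ord0 i = `|x ord0 i| ^+ 2 by rewrite real_normK ?num_real.
  have -> : y ord0 i * y ord0 i = `|y ord0 i| ^+ 2 by rewrite real_normK ?num_real.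
  have := sqr_ge0 (enorm y * `|x ord0 i| - enorm x * `|y ord0 i|); nra.
by rewrite big_split/= -!mulr_sumr -/(dot x x) -/(dot y y) -!sqr_enorm; nra.
Qed.

Lemma ler_enormD x y : enorm (x + y) <= enorm x + enorm y.
Proof.
rewrite -(@ler_pXn2r _ 2) ?nnegrE ?addr_ge0 ?enorm_ge0//.
rewrite sqr_enorm sqrrD !sqr_enorm dotDl !dotDr (dotC y x).
have := cauchy_schwarz x y; have := ler_norm (dot x y); lra.
Qed.

Lemma ler_enormB x y : enorm (x - y) <= enorm x + enorm y.
Proof. by have := ler_enormD x (- y); rewrite enormN. Qed.

Lemma enormB_le x y z t : enorm (x - y - (z - t)) <= enorm (x - z) + enorm (y - t).
Proof.
have -> : x - y - (z - t) = (x - z) - (y - t) by apply/rowP => i; rewrite !mxE; ring.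
exact: ler_enormB.
Qed.

Lemma enorm_le_sum x : enorm x <= \sum_i `|x ord0 i|.
Proof.
rewrite -(@ler_pXn2r _ 2) ?nnegrE ?enorm_ge0 ?sumr_ge0// sqr_enorm expr2.
rewrite mulr_suml; apply: ler_sum => i _.
apply: (@le_trans _ _ (`|x ord0 i| * `|x ord0 i|)); first by rewrite -normrM ler_norm.
by rewrite ler_wpM2l// (bigD1 i)//= lerDl sumr_ge0.
Qed.

End enorm_theory.

Section enorm_row_mx.
Context {R : realType} {m k : nat}.
Implicit Types z : 'rV[R]_(m + k).

Lemma dot_row_mx (a c : 'rV[R]_m) (b d : 'rV[R]_k) :
  dot (row_mx a b) (row_mx c d) = dot a c + dot b d.
Proof.
rewrite /dot big_split_ord/=; congr (_ + _); apply: eq_bigr => i _.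
  by rewrite !row_mxEl.
by rewrite !row_mxEr.
Qed.

Lemma dot_split z w : dot z w = dot (lsubmx z) (lsubmx w) + dot (rsubmx z) (rsubmx w).
Proof. by rewrite -dot_row_mx !hsubmxK. Qed.

Lemma enorm_lsubmx_le z : enorm (lsubmx z) <= enorm z.
Proof. by rewrite ler_sqrt ?dot_ge0// (dot_split z) lerDl dot_ge0. Qed.

Lemma enorm_rsubmx_le z : enorm (rsubmx z) <= enorm z.
Proof. by rewrite ler_sqrt ?dot_ge0// (dot_split z) lerDr dot_ge0. Qed.

Lemma enorm_row0mx (b : 'rV[R]_k) : enorm (row_mx (0 : 'rV[R]_m) b) = enorm b.
Proof.
rewrite /enorm dot_row_mx; congr Num.sqrt.
by rewrite /dot big1 ?add0r// => i _; rewrite mxE mul0r.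
Qed.

Lemma enorm_split_le z : enorm z <= enorm (lsubmx z) + enorm (rsubmx z).
Proof.
rewrite -(@ler_pXn2r _ 2) ?nnegrE ?addr_ge0 ?enorm_ge0//.
rewrite sqrrD !sqr_enorm (dot_split z).
have := enorm_ge0 (lsubmx z); have := enorm_ge0 (rsubmx z); nra.
Qed.

End enorm_row_mx.

Section LpN_theory.
Context {R : realType} {n : nat}.
Local Notation mu := (@lebesgue_rV R n).
Variables (D : set 'rV[R]_n) (p : R).
Hypotheses (mD : measurable D) (p0 : 0 < p).
Implicit Types u v : 'rV[R]_n -> R.

Lemma LpN_ge0 u : (0 <= LpN D p u)%E.
Proof. exact: Lnorm_ge0. Qed.

Lemma LpNE u : LpN D p u = ((\int[mu]_(x in D) (`|u x| `^ p)%:E) `^ p^-1)%E.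
Proof.
rewrite /LpN unlock; apply: (f_equal (fun t => t `^ p^-1)%E).
rewrite [RHS]integral_mkcond; apply: eq_integral => x _.
rewrite /= !patchE; case: ifP => _ //.
by rewrite normr0 powR0// gt_eqF.
Qed.

Lemma LpN_powE u : (LpN D p u `^ p = \int[mu]_(x in D) (`|u x| `^ p)%:E)%E.
Proof.
rewrite LpNE -poweRrM mulVf ?gt_eqF// poweRe1//.
by apply: integral_ge0 => x _; rewrite lee_fin powR_ge0.
Qed.

Lemma measurable_normpow u : measurable_fun D u ->
  measurable_fun D (fun x => (`|u x| `^ p)%:E).
Proof.
move=> mu_; apply/measurable_EFinP.
apply: (@measurableT_comp _ _ _ _ _ _ (@powR R ^~ p)).
  exact: measurable_powR.
exact: measurableT_comp.
Qed.

Lemma LpN_ltyP u : measurable_fun D u ->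
  (LpN D p u < +oo)%E <-> mu.-integrable D (fun x => (`|u x| `^ p)%:E).
Proof.
move=> mu_; split=> [uoo|/integrableP[_ uoo]].
  apply/integrableP; split; first exact: measurable_normpow.
  under eq_integral do rewrite gee0_abs ?lee_fin ?powR_ge0//.
  by rewrite -LpN_powE poweR_lty.
rewrite LpNE poweR_lty//; move: uoo.
by under eq_integral do rewrite gee0_abs ?lee_fin ?powR_ge0//.
Qed.

Lemma le_LpN u v : measurable_fun D u -> measurable_fun D v ->
  (forall x, D x -> `|u x| <= `|v x|) -> (LpN D p u <= LpN D p v)%E.
Proof.
move=> mu_ mv uv; rewrite !LpNE; apply: gt0_ler_poweR.
- by rewrite invr_ge0 ltW.
- by rewrite in_itv/= leey andbT integral_ge0// => x _; rewrite lee_fin powR_ge0.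
- by rewrite in_itv/= leey andbT integral_ge0// => x _; rewrite lee_fin powR_ge0.
apply: ge0_le_integral => //.
- exact: measurable_normpow.
- exact: measurable_normpow.
by move=> x Dx; rewrite lee_fin ge0_ler_powR ?nnegrE// ?uv// ltW.
Qed.

Lemma LpN0 : LpN D p (fun=> 0) = 0%E.
Proof.
rewrite LpNE integral0_eq ?poweR0r// ?invr_neq0 ?gt_eqF// => x _.
by rewrite normr0 powR0// gt_eqF.
Qed.

Lemma LpNZ c u : measurable_fun D u ->
  LpN D p (fun x => c * u x) = (`|c|%:E * LpN D p u)%E.
Proof.
move=> mu_; rewrite !LpNE.
under eq_integral do rewrite normrM powRM// EFinM.
rewrite ge0_integralZl//; last exact: measurable_normpow.
rewrite poweRM ?lee_fin ?powR_ge0//; last first.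
  by apply: integral_ge0 => x _; rewrite lee_fin powR_ge0.
by rewrite poweR_EFin -powRrM mulfV ?gt_eqF// powRr1.
Qed.

Lemma LpND u v : 1 <= p -> measurable_fun D u -> measurable_fun D v ->
  (LpN D p (fun x => u x + v x)%R <= LpN D p u + LpN D p v)%E.
Proof.
move=> p1 mu_ mv.
have := @minkowski_EFin _ _ _ mu (u \_ D) (v \_ D) p
  ((measurable_restrictT _ mD).1 mu_) ((measurable_restrictT _ mD).1 mv) p1.
rewrite /LpN; congr (_ <= _)%E; congr (Lnorm _ _ _); apply/funext => x /=.
by rewrite !patchE; case: ifP => //; rewrite addr0.
Qed.

End LpN_theory.

Section hoelder_LpN.
Context {R : realType} {n : nat}.
Local Notation mu := (@lebesgue_rV R n).
Variables (D : set 'rV[R]_n) (p q : R).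
Hypotheses (mD : measurable D) (p0 : 0 < p) (q0 : 0 < q) (pq : p^-1 + q^-1 = 1).
Implicit Types u v : 'rV[R]_n -> R.

Lemma hoelder_LpN u v : measurable_fun D u -> measurable_fun D v ->
  (\int[mu]_(x in D) `|u x * v x|%:E <= LpN D p u * LpN D q v)%E.
Proof.
move=> mu_ mv.
have := @hoelder _ _ _ mu (u \_ D) (v \_ D) p q
  ((measurable_restrictT _ mD).1 mu_) ((measurable_restrictT _ mD).1 mv) p0 q0 pq.
move=> h; apply: le_trans h; rewrite Lnorm1 [X in (X <= _)%E]integral_mkcond.
rewrite le_eqVlt; apply/orP; left; apply/eqP; apply: eq_integral => x _.
by rewrite /= !patchE; case: ifP => //; rewrite mul0r normr0.
Qed.

Lemma integrable_hoelder u v : in_Lp D p u -> in_Lp D q v ->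
  mu.-integrable D (EFin \o (fun x => u x * v x)).
Proof.
move=> [mu_ uoo] [mv voo]; apply/integrableP; split.
  by apply/measurable_EFinP; exact: measurable_funM.
apply: le_lt_trans (hoelder_LpN mu_ mv) _.
by rewrite lte_mul_pinfty// ?LpN_ge0// ge0_fin_numE// LpN_ge0.
Qed.

End hoelder_LpN.

(** * The field H^(p-1) grad H *)

Section chain_rule.
Context {R : realType} {n : nat}.

(** Restricting [f] to the line s v + x reduces this to the one-variable chain rule, so that
    directional derivatives of [f] suffice. *)
Lemma is_derive_comp_real (f : 'rV[R]_n -> R) (g : R -> R) x v d d' :
  is_derive x v f d -> is_derive (f x) 1 g d' -> is_derive x v (g \o f) (d' * d).
Proof.
move=> [df dfE] dg; pose T (s : R) := s *: v + x.
have T0 : T 0 = x by rewrite /T scale0r add0r.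
have TE (h : R) : T (h *: 1 + 0) = h *: v + T 0.
  by rewrite T0 addr0 /T [h *: 1]mulr1.
have [f1 f2] := @derive_comp_affine R R _ _ T f 0 1 v TE.
have [gf1 gf2] := @derive_comp_affine R R _ _ T (g \o f) 0 1 v TE.
have dfT : is_derive (0 : R) 1 (f \o T) d.
  by split; [apply/f1; rewrite T0|rewrite f2 T0].
have dg' : is_derive ((f \o T) 0) 1 g d' by rewrite /= T0.
have [h1 h2] := is_derive1_comp dg' dfT.
split; first by move/gf1: h1; rewrite T0.
by rewrite -T0 -gf2; exact: h2.
Qed.

Lemma is_derive_partial (f : 'rV[R]_n -> R) x i :
  derivable f x (delta_mx ord0 i) -> is_derive x (delta_mx ord0 i) f (partial i f x).
Proof. by move=> df; split. Qed.

End chain_rule.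

Section integrand_theory.
Context {R : realType} {n : nat} {p c1 theta1 theta2 : R} {F : 'rV[R]_n -> R}.
Hypotheses (p2 : 2 <= p) (th2 : 0 < theta2).
Hypothesis hF : integrand p c1 theta1 theta2 F.

(** Convexity at the midpoint of 2x and 2y; homogeneity removes the factors 2. *)
Lemma integrandD x y : F (x + y) <= F x + F y.
Proof.
have h0 : 0 <= 2^-1 :> R by rewrite invr_ge0.
have h1 : 2^-1 <= 1 :> R by rewrite invf_le1 ?ler1n.
have h2 : unstable.onem (2^-1 : R) = 2^-1 by rewrite /unstable.onem; lra.
have := integrand_convex hF (Itv01 h0 h1) (x := 2 *: x) (y := 2 *: y).
rewrite !inE => /(_ I I); rewrite convRE /= h2.
rewrite !(integrand_homogeneous hF) ger0_norm// !mulrA mulVf// !mul1r.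
congr (F _ <= _).
change (2^-1 *: (2 *: x) + unstable.onem (2^-1 : R) *: (2 *: y) = x + y).
by rewrite h2 !scalerA mulVf// !scale1r.
Qed.

Lemma integrand_gt0 z : z != 0 -> 0 < F z.
Proof.
move=> z0; rewrite lt0r (integrand_ge0 hF) andbT; apply/eqP => /(integrand_eq0 hF).
by apply/eqP.
Qed.

Lemma integrand0 : F 0 = 0.
Proof. exact/(integrand_eq0 hF). Qed.

Lemma enorm_delta (i : 'I_n) : enorm (delta_mx ord0 i : 'rV[R]_n) = 1.
Proof.
rewrite /enorm /dot (bigD1 i)//= big1 => [|j ji]; last by rewrite mxE eqxx (negbTE ji) mul0r.
by rewrite mxE !eqxx mulr1 addr0 sqrtr1.
Qed.

Lemma derivable_integrand z i : z != 0 -> derivable F z (delta_mx ord0 i).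
Proof. by move=> z0; apply: diff_derivable; have [] := integrand_C1 hF z0. Qed.

(** By subadditivity and evenness, |F(z + h e_i) - F(z)| <= F(h e_i) <= theta2 |h|, so all
    difference quotients are bounded by theta2. *)
Lemma partial_integrand_le z i : z != 0 -> `|partial i F z| <= theta2.
Proof.
move=> z0; have := @derivable_integrand z i z0.
move=> /cvg_norm/cvgr_to_le; apply; near=> h.
have h0 : h != 0 by near: h; exact: nbhs_dnbhs_neq.
rewrite normrZ normfV ler_pdivrMl ?normr_gt0//=.
set e := delta_mx _ _.
have Fhe : F (h *: e) <= `|h| * theta2.
  rewrite (integrand_homogeneous hF) ler_wpM2l//.
  by have [_] := integrand_growth hF e; rewrite enorm_delta mulr1.
have Fhe' : F (- (h *: e)) = F (h *: e).
  by rewrite -scaleN1r (integrand_homogeneous hF) normrN1 mul1r.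
rewrite ler_norml; apply/andP; split.
  have := integrandD (h *: e + z) (- (h *: e)); rewrite addrAC subrr add0r Fhe'; lra.
have := integrandD (h *: e) z; lra.
Unshelve. all: by end_near. Qed.

Lemma flux0 : flux p F 0 = 0.
Proof.
have p1 : p - 1 != 0 by rewrite gt_eqF//; move: p2; lra.
by rewrite /flux integrand0 powR0// scale0r.
Qed.

Lemma norm_flux_coord_le z i :
  `|flux p F z ord0 i| <= theta2 `^ p * enorm z `^ (p - 1).
Proof.
have [->|z0] := eqVneq z 0.
  by rewrite flux0 mxE normr0 mulr_ge0// powR_ge0.
rewrite !mxE normrM ger0_norm ?powR_ge0//.
have p0 : 0 < p by move: p2; lra.
have -> : theta2 `^ p * enorm z `^ (p - 1) = (theta2 * enorm z) `^ (p - 1) * theta2.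
  by rewrite powRM ?enorm_ge0 ?ltW// -(mulr_powRB1 (ltW th2) p0); ring.
apply: ler_pM; rewrite ?powR_ge0//; last exact: partial_integrand_le.
apply: ge0_ler_powR; rewrite ?nnegrE ?mulr_ge0 ?enorm_ge0 ?(integrand_ge0 hF)//.
- move: p2; lra.
- exact: ltW.
by have [] := integrand_growth hF z.
Qed.

(** The factor n comes from bounding the Euclidean norm by the sum of the coordinates. The growth
    |z|^(p-1) is what places fluxes of L^p fields in the dual space L^q. *)
Lemma enorm_flux_le z :
  enorm (flux p F z) <= n%:R * theta2 `^ p * enorm z `^ (p - 1).
Proof.
apply: le_trans (enorm_le_sum _) _.
rewrite -mulrA -[n in n%:R]card_ord -sumr_const mulr_suml.
by apply: ler_sum => i _; rewrite mul1r norm_flux_coord_le.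
Qed.

Lemma continuous_enorm : continuous (@enorm R n).
Proof.
have cs (r : seq 'I_n) :
    continuous (fun z : 'rV[R]_n => \sum_(i <- r) z ord0 i * z ord0 i).
  elim: r => [|i r IHr].
    by under eq_fun do rewrite big_nil; exact: cst_continuous.
  under eq_fun do rewrite big_cons; apply: continuous_addf => //.
  by apply: continuous_mulf; exact: continuous_coord.
move=> z; apply: (@continuous_comp _ _ _ (fun z => dot z z) (@Num.sqrt R));
  last exact: sqrt_continuous.
exact: cs.
Qed.

(** At the origin, where [grad F] carries no information, the bound theta2^p |y|^(p-1) <= theta2^p
    |y| for |y| < 1 squeezes the flux to 0; elsewhere F is C^1 and positive. *)
Lemma continuous_flux_coord i : continuous (fun z => flux p F z ord0 i).
Proof.
move=> z; have [->|z0] := eqVneq z 0.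
  set K := theta2 `^ p.
  have cK : continuous (fun z : 'rV[R]_n => K * enorm z).
    by apply: continuous_mulf; [exact: cst_continuous|exact: continuous_enorm].
  have cNK : continuous (fun z : 'rV[R]_n => - 1 * (K * enorm z)).
    by apply: continuous_mulf => //; exact: cst_continuous.
  have := cK 0; have := cNK 0; rewrite /continuous_at enorm0 !mulr0 => c1' c2'.
  have e1 : \forall y \near (0 : 'rV[R]_n), enorm y < 1.
    by have := @continuous_enorm 0; rewrite /continuous_at enorm0 => /cvgr_lt; apply.
  have fK : \forall y \near (0 : 'rV[R]_n),
      - 1 * (K * enorm y) <= flux p F y ord0 i <= K * enorm y.
    near=> y; rewrite mulN1r -ler_norml; apply: le_trans (norm_flux_coord_le _ _) _.
    rewrite ler_wpM2l ?powR_ge0//.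
    have y1 : enorm y < 1 by near: y; exact: e1.
    have [->|y0] := eqVneq (enorm y) 0; first by rewrite powR0// gt_eqF//; move: p2; lra.
    by apply: ge1r_powR; [rewrite lt0r y0 enorm_ge0 ltW|move: p2; lra].
  rewrite /continuous_at (_ : flux p F 0 ord0 i = 0); last by rewrite flux0 mxE.
  have ff : Filter (nbhs (0 : 'rV[R]_n)) by exact: nbhs_filter.
  exact: (squeeze_cvgr fK c1' c2').
have [dF cgF] := integrand_C1 hF z0.
have h1 : {for z, continuous (fun y => F y `^ (p - 1))}.
  apply: (@continuous_comp _ _ _ F (@powR R ^~ (p - 1))).
    exact: differentiable_continuous.
  apply: differentiable_continuous; apply/derivable1_diffP.
  by apply: derivable_powR; rewrite in_itv/= andbT integrand_gt0.
have h2 : {for z, continuous (fun y => grad F y ord0 i)}.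
  apply: (@continuous_comp _ _ _ (grad F) (fun y : 'rV[R]_n => y ord0 i)) => //.
  exact: continuous_coord.
have -> : (fun z => flux p F z ord0 i) = (fun y => F y `^ (p - 1) * grad F y ord0 i).
  by apply/funext => y; rewrite mxE.
exact: (continuousM h1 h2).
Unshelve. all: by end_near. Qed.

Lemma measurable_flux : measurable_fun setT (flux p F).
Proof.
by apply: measurable_fun_rV_on => i; apply: continuous_measurable_rV; exact: continuous_flux_coord.
Qed.

(** The power p removes the singularity of F at the origin: there F(s e)^p = |s|^p F(e)^p, whose
    derivative at s = 0 vanishes for p >= 2, in agreement with [flux0]. Elsewhere the chain rule
    applies. *)
Lemma is_derive_integrand_pow z i : is_derive z (delta_mx ord0 i)
  (fun y => F y `^ p) (p * flux p F z ord0 i).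
Proof.
have [->|z0] := eqVneq z 0.
  rewrite flux0 mxE mulr0; set e := delta_mx _ _.
  pose T (s : R) := s *: e; have T0 : T 0 = 0 by rewrite /T scale0r.
  have TE (h : R) : T (h *: 1 + 0) = h *: e + T 0.
    by rewrite T0 !addr0 /T [h *: 1]mulr1.
  have [d1 d2] := @derive_comp_affine R R _ _ T (fun y => F y `^ p) 0 1 e TE.
  rewrite T0 in d1 d2.
  have : is_derive (0 : R) 1 ((fun y => F y `^ p) \o T) 0.
    have -> : (fun y => F y `^ p) \o T =
        F e `^ p \*o (fun s : R => `|s| `^ p).
      apply/funext => s; rewrite /comp /T (integrand_homogeneous hF) mulrC powRM//.
      exact: (integrand_ge0 hF).
    have := is_deriveZ (F e `^ p) (is_derive_pow 0 p2).
    by move/is_derive_eq; apply; rewrite /dpow !mulr0 scaler0.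
  by move=> [h1 h2]; split; [exact: (d1.1 h1)|exact: (etrans (esym d2) h2)].
have dF := is_derive_partial (@derivable_integrand z i z0).
have := is_derive_comp_real dF (is_derive1_powR p (integrand_gt0 z0)).
by move/is_derive_eq; apply; rewrite !mxE mulrA.
Qed.

End integrand_theory.

(** * Splitting and monotonicity of the field of [Htilde] *)

Section flux_Htilde.
Context {R : realType} {m k : nat} {p c1 theta1 theta2 : R}.
Context {F : 'rV[R]_m -> R} {G : 'rV[R]_k -> R}.
Hypotheses (p2 : 2 <= p).
Hypothesis hF : integrand p c1 theta1 theta2 F.
Hypothesis hG : integrand p c1 theta1 theta2 G.
Local Notation H := (Htilde p F G).

Lemma is_derive_Htilde_pow (z : 'rV[R]_(m + k)) i :
  is_derive z (delta_mx ord0 i) (fun y => F (lsubmx y) `^ p + G (rsubmx y) `^ p)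
   (p * row_mx (flux p F (lsubmx z)) (flux p G (rsubmx z)) ord0 i).
Proof.
case: (split_ordP i) => j ->.
  have Tl (h : R) : lsubmx (h *: delta_mx ord0 (lshift k j) + z) =
      h *: delta_mx ord0 j + lsubmx z.
    by apply/rowP => l; rewrite !mxE (inj_eq (@lshift_inj _ _)).
  have Tr (h : R) : rsubmx (h *: delta_mx ord0 (lshift k j) + z) = h *: 0 + rsubmx z.
    by apply/rowP => l; rewrite !mxE eq_rlshift andbF.
  have [l1 l2] := derive_comp_affine (fun y => F y `^ p) Tl.
  have [r1 r2] := derive_comp_affine (fun y => G y `^ p) Tr.
  have [f1 f2] := is_derive_integrand_pow p2 hF (lsubmx z) j.
  have df : is_derive z (delta_mx ord0 (lshift k j)) ((fun y => F y `^ p) \o lsubmx)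
    (p * flux p F (lsubmx z) ord0 j).
    by split; [exact/l1|rewrite l2].
  have dg : is_derive z (delta_mx ord0 (lshift k j)) ((fun y => G y `^ p) \o rsubmx) 0.
    by split; [apply/r1; exact: derivable0|rewrite r2 derive0].
  have := is_deriveD df dg.
  by move/is_derive_eq; apply; rewrite row_mxEl addr0.
have Tl (h : R) : lsubmx (h *: delta_mx ord0 (rshift m j) + z) = h *: 0 + lsubmx z.
  by apply/rowP => l; rewrite !mxE eq_lrshift andbF.
have Tr (h : R) : rsubmx (h *: delta_mx ord0 (rshift m j) + z) =
    h *: delta_mx ord0 j + rsubmx z.
  by apply/rowP => l; rewrite !mxE (inj_eq (@rshift_inj _ _)).
have [l1 l2] := derive_comp_affine (fun y => F y `^ p) Tl.
have [r1 r2] := derive_comp_affine (fun y => G y `^ p) Tr.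
have [f1 f2] := is_derive_integrand_pow p2 hG (rsubmx z) j.
have df : is_derive z (delta_mx ord0 (rshift m j)) ((fun y => F y `^ p) \o lsubmx) 0.
  by split; [apply/l1; exact: derivable0|rewrite l2 derive0].
have dg : is_derive z (delta_mx ord0 (rshift m j)) ((fun y => G y `^ p) \o rsubmx)
  (p * flux p G (rsubmx z) ord0 j).
  by split; [exact/r1|rewrite r2].
have := is_deriveD df dg.
by move/is_derive_eq; apply; rewrite row_mxEr add0r.
Qed.

(** Write X = F^p + G^p. In H^(p-1) grad H the powers X^((p-1)/p) and X^(1/p - 1) cancel, and so do
    p and 1/p. If X = 0, both blocks of z are 0 and every flux vanishes. *)
Lemma flux_Htilde (z : 'rV[R]_(m + k)) :
  flux p H z = row_mx (flux p F (lsubmx z)) (flux p G (rsubmx z)).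
Proof.
have p0 : 0 < p by move: p2; lra.
set X := F (lsubmx z) `^ p + G (rsubmx z) `^ p.
have [X0|X0] := eqVneq X 0.
  have /andP[/eqP Fz /eqP Gz] : (F (lsubmx z) `^ p == 0) && (G (rsubmx z) `^ p == 0).
    by rewrite -paddr_eq0 ?powR_ge0//; exact/eqP.
  have -> : lsubmx z = 0 by apply/(integrand_eq0 hF); exact: powR_eq0_eq0 Fz.
  have -> : rsubmx z = 0 by apply/(integrand_eq0 hG); exact: powR_eq0_eq0 Gz.
  rewrite (flux0 p2 hF) (flux0 p2 hG) row_mx0 /flux /Htilde -/X X0.
  by rewrite powR0 ?powR0 ?scale0r ?invr_eq0// gt_eqF//; move: p2; lra.
have {}X0 : 0 < X by rewrite lt0r X0 addr_ge0 ?powR_ge0.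
apply/rowP => i; rewrite mxE.
have dH := is_derive_comp_real (is_derive_Htilde_pow z i) (is_derive1_powR p^-1 X0).
have -> : grad H z ord0 i = p^-1 * X `^ (p^-1 - 1) *
    (p * row_mx (flux p F (lsubmx z)) (flux p G (rsubmx z)) ord0 i).
  by rewrite mxE; case: dH.
rewrite /Htilde -/X -powRrM.
have -> : X `^ (p^-1 * (p - 1)) = (X `^ (p^-1 - 1))^-1.
  rewrite -powRN; congr (_ `^ _); rewrite mulrBr mulVf ?gt_eqF// mulr1; ring.
have : X `^ (p^-1 - 1) != 0 by rewrite gt_eqF// powR_gt0.
by move: (X `^ _) (row_mx _ _ _ _) => a b a0; field; rewrite a0 gt_eqF.
Qed.

Lemma flux2_Htilde z : flux2 p H z = flux p G z.
Proof.
have := flux_Htilde (row_mx 0 z); rewrite row_mxKl row_mxKr => /(congr1 rsubmx).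
by rewrite row_mxKr /flux2 => <-; apply/rowP => i; rewrite !mxE.
Qed.

(** The monotonicity of the two fluxes is added block by block; the factor 2^p is lost in |z|^p <=
    2^p (|Z_1|^p + |Z_2|^p). *)
Lemma flux_Htilde_monotone (hc1 : 0 < c1) (z w : 'rV[R]_(m + k)) :
  c1 / 2 `^ p * enorm (z - w) `^ p <= dot (flux p H z - flux p H w) (z - w).
Proof.
rewrite !flux_Htilde opp_row_mx add_row_mx dot_split row_mxKl row_mxKr.
rewrite !linearB/=.
have h1 := integrand_monotone hF (lsubmx z) (lsubmx w).
have h2 := integrand_monotone hG (rsubmx z) (rsubmx w).
apply: le_trans (lerD h1 h2); rewrite -mulrDr -mulrA ler_pM2l//.
rewrite mulrC ler_pdivrMr ?powR_gt0// mulrC.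
apply: le_trans (powR_add_le _ (enorm_ge0 _) (enorm_ge0 _)); last by move: p2; lra.
apply: ge0_ler_powR; rewrite ?nnegrE ?addr_ge0 ?enorm_ge0//; first by move: p2; lra.
by have := enorm_split_le (z - w); rewrite !linearB.
Qed.

End flux_Htilde.

(** * Test functions and Sobolev spaces *)

Section in_Lp_theory.
Context {R : realType} {n : nat}.
Local Notation mu := (@lebesgue_rV R n).
Variables (D : set 'rV[R]_n) (p : R).
Hypotheses (mD : measurable D) (p1 : 1 <= p).
Implicit Types (u v : 'rV[R]_n -> R) (g h : 'rV[R]_n -> 'rV[R]_n).

Let p0 : 0 < p. Proof. exact: lt_le_trans p1. Qed.

Lemma in_Lp_le u v : measurable_fun D u -> (forall x, D x -> `|u x| <= `|v x|) ->
  in_Lp D p v -> in_Lp D p u.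
Proof.
move=> mu_ uv [mv voo]; split=> //; apply: le_lt_trans voo.
exact: le_LpN.
Qed.

Lemma in_LpD u v : in_Lp D p u -> in_Lp D p v -> in_Lp D p (fun x => u x + v x).
Proof.
move=> [mu_ uoo] [mv voo]; split; first exact: measurable_funD.
by apply: le_lt_trans (LpND mD p1 mu_ mv) _; exact: lte_add_pinfty.
Qed.

Lemma in_LpZ c u : in_Lp D p u -> in_Lp D p (fun x => c * u x).
Proof.
move=> [mu_ uoo]; split; first exact: measurable_funM.
by rewrite LpNZ// lte_mul_pinfty.
Qed.

Lemma in_Lp_norm u : in_Lp D p u -> in_Lp D p (fun x => `|u x|).
Proof.
move=> Lu; apply: in_Lp_le (Lu); last by move=> x _; rewrite normr_id.
by case: Lu => mu_ _; exact: measurableT_comp.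
Qed.

Lemma in_Lp_enorm g : in_Lp_vec D p g -> in_Lp D p (enorm \o g).
Proof. by move=> [mg goo]; split=> //; exact: measurable_fun_enorm. Qed.

Lemma in_Lp_vec_le g u : measurable_fun D g -> (forall x, D x -> enorm (g x) <= u x) ->
  in_Lp D p u -> in_Lp_vec D p g.
Proof.
move=> mg gu Lu; split=> //.
have [] // := in_Lp_le (measurable_fun_enorm mg) _ Lu.
move=> x Dx /=; rewrite ger0_norm ?enorm_ge0//.
by apply: le_trans (gu _ Dx) _; exact: ler_norm.
Qed.

Lemma measurable_rVD g h : measurable_fun D g -> measurable_fun D h ->
  measurable_fun D (fun x => g x + h x).
Proof.
move=> mg mh; apply: measurable_fun_rV_on => i; under eq_fun do rewrite mxE.
by apply: measurable_funD; exact: measurable_fun_coord.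
Qed.

Lemma measurable_rVZ u g : measurable_fun D u -> measurable_fun D g ->
  measurable_fun D (fun x => u x *: g x).
Proof.
move=> mu_ mg; apply: measurable_fun_rV_on => i; under eq_fun do rewrite mxE.
by apply: measurable_funM => //; exact: measurable_fun_coord.
Qed.

Lemma measurable_rVB g h : measurable_fun D g -> measurable_fun D h ->
  measurable_fun D (fun x => g x - h x).
Proof.
move=> mg mh; apply: measurable_fun_rV_on => i.
rewrite (_ : (fun x => _) = fun x => g x ord0 i - h x ord0 i); last first.
  by apply/funext => x; rewrite !mxE.
by apply: measurable_funB; exact: measurable_fun_coord.
Qed.

Lemma in_Lp_vecD g h : in_Lp_vec D p g -> in_Lp_vec D p h ->
  in_Lp_vec D p (fun x => g x + h x).
Proof.
move=> Lg Lh; have := in_LpD (in_Lp_enorm Lg) (in_Lp_enorm Lh).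
apply: in_Lp_vec_le; last by move=> x _; exact: ler_enormD.
by case: Lg Lh => mg _ [mh _]; exact: measurable_rVD.
Qed.

Lemma in_Lp_vecB g h : in_Lp_vec D p g -> in_Lp_vec D p h ->
  in_Lp_vec D p (fun x => g x - h x).
Proof.
move=> Lg Lh; have := in_LpD (in_Lp_enorm Lg) (in_Lp_enorm Lh).
apply: in_Lp_vec_le; last by move=> x _; exact: ler_enormB.
by case: Lg Lh => mg _ [mh _]; exact: measurable_rVB.
Qed.

Lemma in_Lp_coord g i : in_Lp_vec D p g -> in_Lp D p (fun x => g x ord0 i).
Proof.
move=> Lg; apply: in_Lp_le (in_Lp_enorm Lg).
  by case: Lg => mg _; exact: measurable_fun_coord.
move=> x _; rewrite /= norm_enorm; exact: norm_coord_le_enorm.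
Qed.

Lemma in_Lp_bounded u B : (mu D < +oo)%E -> measurable_fun D u ->
  (forall x, D x -> `|u x| <= B) -> in_Lp D p u.
Proof.
move=> Doo mu_ uB; split=> //.
apply/(LpN_ltyP p0 mu_).
apply: (@measurable_bounded_integrable _ _ _ mu (fun x => `|u x| `^ p)) => //.
  by apply/measurable_EFinP; exact: measurable_normpow.
exists (B `^ p); split=> [|y By x Dx /=]; first exact: num_real.
rewrite ger0_norm ?powR_ge0// ltW//; apply: le_lt_trans By.
by apply: ge0_ler_powR; rewrite ?nnegrE ?uB ?(le_trans _ (uB _ Dx))// ltW.
Qed.

Lemma in_Lp_mul_bounded u v B : measurable_fun D u -> (forall x, D x -> `|u x| <= B) ->
  in_Lp D p v -> in_Lp D p (fun x => u x * v x).
Proof.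
move=> mu_ uB Lv; apply: in_Lp_le (in_LpZ B Lv).
  by case: Lv => mv _; exact: measurable_funM.
move=> x Dx; rewrite !normrM ler_wpM2r//.
by apply: le_trans (uB _ Dx) _; exact: ler_norm.
Qed.

End in_Lp_theory.

Section test_functions.
Context {R : realType} {n : nat}.
Local Notation mu := (@lebesgue_rV R n).
Implicit Types (D K : set 'rV[R]_n) (phi rho eta : 'rV[R]_n -> R).

Lemma norm_coord_le (x : 'rV[R]_n) i : `|x ord0 i| <= `|x|.
Proof.
by rewrite [leRHS]/Num.Def.normr /= mx_normrE; apply/bigmax_geP; right => /=; exists (ord0, i).
Qed.

Lemma bounded_set_box D : bounded_set D -> exists2 M, 0 < M & D `<=` box M.
Proof.
move=> [M [_ DM]]; exists (`|M| + 1); first by rewrite ltr_wpDl.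
move=> x Dx i; apply: le_trans (norm_coord_le x i) _.
by apply: DM => //; rewrite (le_lt_trans (ler_norm _))// ltrDl.
Qed.

Lemma compact_box K : compact K -> exists2 M, 0 < M & K `<=` box M.
Proof. by move=> /compact_bounded/bounded_set_box. Qed.

(** The support need not be computed: it is contained in any closed set outside which phi
    vanishes. *)
Lemma mk_test_function D phi K : smooth phi -> compact K -> K `<=` D ->
  (forall x, ~ K x -> phi x = 0) -> test_function D phi.
Proof.
move=> sphi cK KD phi0.
have clK : closed K by apply: compact_closed => //; exact: norm_hausdorff.
have sK : closure [set x | phi x != 0] `<=` K.
  rewrite ((closure_id K).1 clK); apply: closure_subset => x /= phix.
  by apply: contrapT => /phi0/eqP; rewrite (negbTE phix).
split=> //; last exact: subset_trans KD.
apply: subclosed_compact cK sK; exact: closed_closure.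
Qed.

Lemma test_functionP D phi : test_function D phi -> exists K,
  [/\ compact K, closed K, K `<=` D & forall x, ~ K x -> phi x = 0].
Proof.
move=> [_ cK KD]; exists (closure [set x | phi x != 0]); split=> //.
  exact: closed_closure.
move=> x Kx; apply/eqP; apply: contrapT => /negP phix; apply: Kx.
exact: subset_closure.
Qed.

Lemma test_function_smooth D phi : test_function D phi -> smooth phi.
Proof. by case. Qed.

Lemma test_function_eq0 D phi x : test_function D phi -> ~ D x -> phi x = 0.
Proof.
by move=> /test_functionP[K [_ _ KD K0]] Dx; apply: K0; apply: contra_not Dx => /KD.
Qed.

Lemma partial_test_eq0 D phi i x : test_function D phi -> ~ D x -> partial i phi x = 0.
Proof.
move=> /test_functionP[K [_ clK KD K0]] Dx.
by apply: (partial_eq0 i clK K0); apply: contra_not Dx => /KD.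
Qed.

Lemma test_function_box D phi : test_function D phi -> exists2 M, 0 < M &
  forall x, ~ box M x -> phi x = 0 /\ forall i, partial i phi x = 0.
Proof.
move=> /test_functionP[K [cK clK KD K0]]; have [M M0 KM] := compact_box cK.
exists M => // x Mx; have Kx : ~ K x by apply: contra_not Mx => /KM.
by split; [exact: K0|move=> i; exact: (partial_eq0 i clK K0)].
Qed.

Lemma bounded_continuous_csupp (g : 'rV[R]_n -> R) M : continuous g ->
  (forall x, ~ box M x -> g x = 0) -> exists2 B, 0 <= B & forall x, `|g x| <= B.
Proof.
move=> cg gM.
have /compact_bounded [B [_ gB]] : compact (g @` box M).
  by apply: (continuous_compact (continuous_subspaceT cg)); exact: box_compact.
exists (`|B| + 1) => [|x]; first by rewrite addr_ge0.
have [xM|xM] := pselect (box M x); last by rewrite gM// normr0 addr_ge0.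
by apply: gB; [rewrite (le_lt_trans (ler_norm _))// ltrDl|exists x].
Qed.

Lemma test_function_bounded D phi : test_function D phi -> exists2 B, 0 <= B &
  forall x, `|phi x| <= B /\ enorm (grad phi x) <= B.
Proof.
move=> tphi; have [M M0 phiM] := test_function_box tphi.
have sphi := test_function_smooth tphi.
have [B0 B00 phiB] := bounded_continuous_csupp (smooth_continuous sphi)
  (fun x Mx => (phiM x Mx).1).
have Bi i : {B | 0 <= B /\ forall x, `|partial i phi x| <= B}.
  apply: cid; have [B ? ?] := bounded_continuous_csupp
    (smooth_continuous (smooth_partial i sphi)) (fun x Mx => (phiM x Mx).2 i).
  by exists B.
have S0 : 0 <= \sum_i projT1 (Bi i).
  by apply: sumr_ge0 => i _; case: (projT2 (Bi i)).
exists (B0 + \sum_i projT1 (Bi i)) => [|x]; first exact: addr_ge0.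
split; first by apply: le_trans (phiB x) _; rewrite lerDl.
apply: le_trans (enorm_le_sum _) _; apply: ler_wpDl => //.
by apply: ler_sum => i _; rewrite mxE; have [_] := projT2 (Bi i); apply.
Qed.

Lemma measurable_grad phi E : smooth phi -> measurable_fun E (grad phi).
Proof.
move=> sphi; apply: measurable_funTS; apply: measurable_fun_rV_on => i.
under eq_fun do rewrite mxE; apply: continuous_measurable_rV.
exact/smooth_continuous/smooth_partial.
Qed.

Lemma measurable_smooth phi E : smooth phi -> measurable_fun E phi.
Proof.
move=> sphi; apply: measurable_funTS; apply: continuous_measurable_rV.
exact: smooth_continuous.
Qed.

Lemma Rintegral_restrict D (g : 'rV[R]_n -> R) : (forall x, ~ D x -> g x = 0) ->
  \int[mu]_(x in D) g x = \int[mu]_x g x.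
Proof.
move=> g0; rewrite [LHS]Rintegral_mkcond; apply: eq_Rintegral => x _.
by rewrite patchE; case: ifPn => // /negP; rewrite inE => /g0.
Qed.

(** The derivative of phi eta has integral 0 over the whole space, and eta vanishes outside [D];
    hence phi may be arbitrary at the boundary. *)
Lemma integration_by_parts_test D phi eta i : measurable D -> smooth phi -> test_function D eta ->
  \int[mu]_(x in D) (phi x * partial i eta x) =
  - \int[mu]_(x in D) (partial i phi x * eta x).
Proof.
move=> mD sphi teta; have seta := test_function_smooth teta.
have [M M0 etaM] := test_function_box teta.
rewrite (Rintegral_restrict (D := D) (g := fun x => phi x * partial i eta x)); last first.
  by move=> x Dx; rewrite (partial_test_eq0 i teta Dx) mulr0.
rewrite (Rintegral_restrict (D := D) (g := fun x => partial i phi x * eta x)); last first.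
  by move=> x Dx; rewrite (test_function_eq0 teta Dx) mulr0.
have i1 : mu.-integrable setT (EFin \o (fun x => phi x * partial i eta x)).
  apply: (@integrable_csupp _ _ _ M).
    by apply: continuous_mulf; [exact: smooth_continuous|exact/smooth_continuous/smooth_partial].
  by move=> x /etaM[_ ->]; rewrite mulr0.
have i2 : mu.-integrable setT (EFin \o (fun x => partial i phi x * eta x)).
  apply: (@integrable_csupp _ _ _ M).
    by apply: continuous_mulf; [exact/smooth_continuous/smooth_partial|exact: smooth_continuous].
  by move=> x /etaM[-> _]; rewrite mulr0.
apply/eqP; rewrite -addr_eq0 -RintegralD//; apply/eqP.
have /(congr1 fine) := @integral_partial R n (fun x => phi x * eta x) i M
  (smoothM sphi seta 1) (fun x Mx => etrans (congr1 _ (etaM x Mx).1) (mulr0 _)).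
move=> h; apply: (etrans _ h); apply: eq_Rintegral => x _; apply: esym.
by apply: partialM; exact: smooth_derivable.
Qed.

End test_functions.

Section ereal_limits.
Context {R : realType}.
Implicit Types e f : nat -> \bar R.

Lemma cvg0_le e f : (forall k, 0 <= e k)%E -> (forall k, e k <= f k)%E ->
  f @ \oo --> 0%E -> e @ \oo --> 0%E.
Proof.
move=> e0 ef cf; apply: (@squeeze_cvge _ _ _ _ (cst 0%E) _ f) => //; last exact: cvg_cst.
by near=> k; rewrite e0 ef.
Unshelve. all: by end_near. Qed.

Lemma cvg0_addZ (c d : R) e f : e @ \oo --> 0%E -> f @ \oo --> 0%E ->
  (fun k => c%:E * e k + d%:E * f k)%E @ \oo --> 0%E.
Proof.
move=> ce cf; rewrite -[X in _ --> X]adde0.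
apply: cvgeD => //; first by rewrite -[X in _ --> X](mule0 c%:E); exact: cvgeZl.
by rewrite -[X in _ --> X](mule0 d%:E); exact: cvgeZl.
Qed.

Lemma le_cvg0 (x : \bar R) e : (forall k, x <= e k)%E -> e @ \oo --> 0%E -> (x <= 0)%E.
Proof. by move=> xe /cvge_to_ge; apply; apply: nearW. Qed.

End ereal_limits.

(** * Limits of smooth functions in W^{1,p} *)

Section smooth_approx_section.
Context {R : realType} {n : nat}.
Local Notation mu := (@lebesgue_rV R n).
Variables (D : set 'rV[R]_n) (p q : R).
Hypotheses (mD : measurable D) (p1 : 1 < p) (q1 : 1 <= q) (pq : p^-1 + q^-1 = 1).
Implicit Types (v : 'rV[R]_n -> R) (g h a : 'rV[R]_n -> 'rV[R]_n).

Let p0 : 0 < p. Proof. exact: lt_trans p1. Qed.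
Let q0 : 0 < q. Proof. exact: lt_le_trans q1. Qed.

(* The [v_ i] are smooth on the whole space, without condition on their supports:
   the limits need not vanish on the boundary of [D]. *)
Record smooth_approx v g (v_ : nat -> 'rV[R]_n -> R) : Prop := {
  approx_Lp : in_Lp D p v ;
  approx_Lp_vec : in_Lp_vec D p g ;
  approx_smooth : forall k, smooth (v_ k) ;
  approx_seq_Lp : forall k, in_Lp D p (v_ k) ;
  approx_seq_Lp_vec : forall k, in_Lp_vec D p (grad (v_ k)) ;
  approx_cvg : LpN D p (fun x => v x - v_ k x) @[k --> \oo] --> 0%E ;
  approx_cvg_grad : LpN D p (fun x => enorm (g x - grad (v_ k) x)) @[k --> \oo] --> 0%E }.

Lemma measurable_enorm_dist g h : measurable_fun D g -> measurable_fun D h ->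
  measurable_fun D (fun x => enorm (g x - h x)).
Proof. by move=> mg mh; apply: measurable_fun_enorm; exact: measurable_rVB. Qed.

Lemma integrable_dot a g : in_Lp_vec D q a -> in_Lp_vec D p g ->
  mu.-integrable D (EFin \o (fun x => dot (a x) (g x))).
Proof.
move=> La Lg.
apply: le_integrable (integrable_hoelder mD p0 q0 pq (in_Lp_enorm Lg) (in_Lp_enorm La)) => //.
  by apply/measurable_EFinP; apply: measurable_fun_dot; [case: La|case: Lg].
move=> x _; rewrite /= lee_fin normrM.
rewrite !norm_enorm mulrC.
exact: cauchy_schwarz.
Qed.

(** Two applications of Hoelder. This continuity of the pairing of (a, f) with (g, v) is the
    estimate behind [approx_pairing_eq0]. *)
Lemma norm_Rintegral_pairing a f g v : in_Lp_vec D q a -> in_Lp D q f ->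
  in_Lp_vec D p g -> in_Lp D p v ->
  (`|\int[mu]_(x in D) (dot (a x) (g x) + f x * v x)|%:E <=
   LpN D q (enorm \o a) * LpN D p (enorm \o g) + LpN D q f * LpN D p v)%E.
Proof.
move=> La Lf Lg Lv.
have i1 := integrable_dot La Lg.
have i2 : mu.-integrable D (EFin \o (fun x => f x * v x)).
  have := integrable_hoelder mD p0 q0 pq Lv Lf.
  by congr (_.-integrable _ _); apply/funext => x /=; rewrite mulrC.
have i12 : mu.-integrable D (EFin \o (fun x => dot (a x) (g x) + f x * v x)).
  have := integrableD mD i1 i2; exact: eq_integrable.
have mdf : measurable_fun D (fun x => dot (a x) (g x) + f x * v x).
  by have /integrableP[/measurable_EFinP] := i12.
have ma : measurable_fun D (enorm \o a) by case: (in_Lp_enorm La).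
have mg : measurable_fun D (enorm \o g) by case: (in_Lp_enorm Lg).
have mf : measurable_fun D f by case: Lf.
have mv : measurable_fun D v by case: Lv.
have qp : q^-1 + p^-1 = 1 by rewrite addrC.
apply: le_trans (leeD (hoelder_LpN mD q0 p0 qp ma mg) (hoelder_LpN mD q0 p0 qp mf mv)).
rewrite EFin_normr_Rintegral//; apply: le_trans (le_abse_integral _ _ _) _ => //.
  exact/measurable_EFinP.
rewrite -ge0_integralD//; last 2 first.
- by apply/measurable_EFinP; apply: measurableT_comp => //; exact: measurable_funM.
- by apply/measurable_EFinP; apply: measurableT_comp => //; exact: measurable_funM.
apply: ge0_le_integral => //.
- by apply: measurableT_comp => //; exact/measurable_EFinP.
- by apply: emeasurable_funD; apply/measurable_EFinP; apply: measurableT_comp => //;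
    exact: measurable_funM.
move=> x _; rewrite /= -EFinD lee_fin; apply: le_trans (ler_normD _ _) _.
rewrite lerD2r normrM !norm_enorm.
exact: cauchy_schwarz.
Qed.

(** Linear identities pass from the smooth approximants to their limit by continuity of the pairing.
    This serves both for weak gradients and for the equation of w on the cylinder. *)
Lemma approx_pairing_eq0 v g (v_ : nat -> 'rV[R]_n -> R) a f : smooth_approx v g v_ ->
  in_Lp_vec D q a -> in_Lp D q f ->
  (forall k, \int[mu]_(x in D) (dot (a x) (grad (v_ k) x) + f x * v_ k x) = 0) ->
  \int[mu]_(x in D) (dot (a x) (g x) + f x * v x) = 0.
Proof.
move=> Av La Lf I0.
have iP h w : in_Lp_vec D p h -> in_Lp D p w ->
    mu.-integrable D (EFin \o (fun x => dot (a x) (h x) + f x * w x)).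
  move=> Lh Lw.
  have i2 : mu.-integrable D (EFin \o (fun x => f x * w x)).
    have := integrable_hoelder mD p0 q0 pq Lw Lf.
    by congr (_.-integrable _ _); apply/funext => x /=; rewrite mulrC.
  have := integrableD mD (integrable_dot La Lh) i2; exact: eq_integrable.
apply/normr0_eq0/eqP; rewrite eq_le normr_ge0 andbT -lee_fin.
have [ce cg] := (approx_cvg Av, approx_cvg_grad Av).
have [Aoo foo] : (LpN D q (enorm \o a) < +oo /\ LpN D q f < +oo)%E.
  by case: La Lf => _ ? [].
apply: (le_cvg0 _ (cvg0_addZ (fine (LpN D q (enorm \o a))) (fine (LpN D q f)) cg ce)) => k.
rewrite !fineK ?ge0_fin_numE ?LpN_ge0//.
have Lgk := in_Lp_vecB mD (ltW p1) (approx_Lp_vec Av) (approx_seq_Lp_vec Av k).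
have Lvk : in_Lp D p (fun x => v x - v_ k x).
  have := in_LpD mD (ltW p1) (approx_Lp Av) (in_LpZ mD (ltW p1) (-1) (approx_seq_Lp Av k)).
  by congr (in_Lp _ _ _); apply/funext => x; rewrite mulN1r.
apply: le_trans (norm_Rintegral_pairing La Lf Lgk Lvk).
rewrite lee_fin -[X in `|X|]subr0 -(I0 k) -RintegralB//; last 2 first.
- exact: iP (approx_Lp_vec Av) (approx_Lp Av).
- exact: iP (approx_seq_Lp_vec Av k) (approx_seq_Lp Av k).
rewrite le_eqVlt; apply/orP; left; apply/eqP; congr (`|_|).
by apply: eq_Rintegral => x _; rewrite dotBr mulrBr; ring.
Qed.

End smooth_approx_section.

Section approx_closure.
Context {R : realType} {n : nat}.
Local Notation mu := (@lebesgue_rV R n).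
Variables (D : set 'rV[R]_n) (p q : R).
Hypotheses (mD : measurable D) (Doo : (mu D < +oo)%E).
Hypotheses (p1 : 1 < p) (q1 : 1 <= q) (pq : p^-1 + q^-1 = 1).
Implicit Types (u v : 'rV[R]_n -> R) (g h a : 'rV[R]_n -> 'rV[R]_n).

Let p0 : 0 < p. Proof. exact: lt_trans p1. Qed.
Let q0 : 0 < q. Proof. exact: lt_le_trans q1. Qed.
Let p1' : 1 <= p. Proof. exact: ltW. Qed.

Lemma test_in_Lp (E : set 'rV[R]_n) r phi : 1 <= r -> test_function E phi ->
  in_Lp D r phi /\ in_Lp_vec D r (grad phi).
Proof.
move=> r1 tphi; have [B B0 phiB] := test_function_bounded tphi.
have sphi := test_function_smooth tphi.
split.
  apply: (in_Lp_bounded mD r1 Doo (B := B)); first exact: measurable_smooth.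
  by move=> x _; have [] := phiB x.
split; first exact: measurable_grad.
apply: (in_Lp_bounded mD r1 Doo (B := B) _ _).2.
  by apply: measurable_fun_enorm; exact: measurable_grad.
by move=> x _; rewrite /= norm_enorm; have [] := phiB x.
Qed.

Lemma LpN_le_lin (w s t : 'rV[R]_n -> R) c d : 0 <= c -> 0 <= d ->
  measurable_fun D w -> measurable_fun D s -> measurable_fun D t ->
  (forall x, D x -> `|w x| <= c * `|s x| + d * `|t x|) ->
  (LpN D p w <= c%:E * LpN D p s + d%:E * LpN D p t)%E.
Proof.
move=> c0 d0 mw ms mt wst.
have mcs : measurable_fun D (fun x => c * `|s x|).
  by apply: measurable_funM => //; exact: measurableT_comp.
have mdt : measurable_fun D (fun x => d * `|t x|).
  by apply: measurable_funM => //; exact: measurableT_comp.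
have E (e : R) (y : 'rV[R]_n -> R) : 0 <= e -> measurable_fun D y ->
    LpN D p (fun x => e * `|y x|) = (e%:E * LpN D p y)%E.
  move=> e0 my; rewrite LpNZ ?ger0_norm//; last exact: measurableT_comp.
  congr (_ * _)%E; apply/eqP; rewrite eq_le !le_LpN//; do ?exact: measurableT_comp.
    by move=> x _; rewrite normr_id.
  by move=> x _; rewrite normr_id.
rewrite -(E _ _ c0 ms) -(E _ _ d0 mt).
apply: le_trans (LpND mD p1' mcs mdt); apply: le_LpN => //.
  exact: measurable_funD.
by move=> x Dx; apply: le_trans (wst x Dx) _; exact: ler_norm.
Qed.

Lemma LpN_enorm_le_add (w s t : 'rV[R]_n -> 'rV[R]_n) :
  measurable_fun D w -> measurable_fun D s -> measurable_fun D t ->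
  (forall x, enorm (w x) <= enorm (s x) + enorm (t x)) ->
  (LpN D p (fun x => enorm (w x)) <=
   1%:E * LpN D p (fun x => enorm (s x)) + 1%:E * LpN D p (fun x => enorm (t x)))%E.
Proof.
move=> mw ms mt wst; apply: LpN_le_lin => //; do ?exact: measurable_fun_enorm.
by move=> x _; rewrite !norm_enorm !mul1r.
Qed.

Lemma dot_delta (c : R) (y : 'rV[R]_n) i : dot (c *: delta_mx ord0 i) y = c * y ord0 i.
Proof.
rewrite dotZl; congr (_ * _); rewrite /dot (bigD1 i)//= big1 => [|j ji].
  by rewrite mxE !eqxx mul1r addr0.
by rewrite mxE eqxx (negbTE ji) mul0r.
Qed.

Lemma approx_weak_gradient v g (v_ : nat -> 'rV[R]_n -> R) :
  smooth_approx D p v g v_ -> weak_gradient D v g.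
Proof.
move=> Av phi tphi i; have [Lphi Lgphi] := test_in_Lp q1 tphi.
have sphi := test_function_smooth tphi.
(* For this [a] and this [f], the pairing with (g, v) is the difference of the two sides of the
   weak-gradient identity. *)
pose a x := phi x *: (delta_mx ord0 i : 'rV[R]_n); pose f := partial i phi.
have La : in_Lp_vec D q a.
  apply: (in_Lp_vec_le mD q1 _ _ (in_Lp_norm mD q1 Lphi)).
    apply: measurable_rVZ; first exact: measurable_smooth.
    exact: measurable_cst.
  by move=> x _; rewrite enormZ enorm_delta mulr1.
have Lf : in_Lp D q f.
  have := in_Lp_coord mD q1 i Lgphi.
  by congr (in_Lp _ _ _); apply/funext => x; rewrite mxE.
have P w h : in_Lp D p w -> in_Lp_vec D p h ->
    \int[mu]_(x in D) (dot (a x) (h x) + f x * w x) =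
    \int[mu]_(x in D) (h x ord0 i * phi x) + \int[mu]_(x in D) (w x * partial i phi x).
  move=> Lw Lh; rewrite RintegralD//.
  - congr (_ + _); apply: eq_Rintegral => x _; first by rewrite dot_delta mulrC.
    by rewrite mulrC.
  - exact: (integrable_dot mD p1 q1 pq).
  have := integrable_hoelder mD p0 q0 pq Lw Lf.
  by congr (_.-integrable _ _); apply/funext => x /=; rewrite mulrC.
have : \int[mu]_(x in D) (dot (a x) (g x) + f x * v x) = 0.
  apply: (approx_pairing_eq0 mD p1 q1 pq Av La Lf) => k.
  rewrite (P _ _ (approx_seq_Lp Av k) (approx_seq_Lp_vec Av k)).
  rewrite (integration_by_parts_test i mD (approx_smooth Av k) tphi).
  under eq_Rintegral do rewrite mxE.
  by rewrite subrr.
rewrite (P _ _ (approx_Lp Av) (approx_Lp_vec Av)) addrC => /eqP.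
by rewrite addr_eq0 => /eqP.
Qed.

Lemma approx_W1p v g (v_ : nat -> 'rV[R]_n -> R) :
  smooth_approx D p v g v_ -> W1p D p v g.
Proof.
move=> Av; split; [exact: approx_Lp Av|exact: approx_Lp_vec Av|].
exact: approx_weak_gradient Av.
Qed.

Lemma approx_W1p0 v g (v_ : nat -> 'rV[R]_n -> R) : smooth_approx D p v g v_ ->
  (forall k, test_function D (v_ k)) -> W1p0 D p v g.
Proof.
move=> Av tv; split; first exact: approx_W1p Av.
by exists v_; split=> //; [exact: approx_cvg Av|exact: approx_cvg_grad Av].
Qed.

Lemma W1p0_approx v g : W1p0 D p v g ->
  exists2 v_ : nat -> 'rV[R]_n -> R, smooth_approx D p v g v_ & forall k, test_function D (v_ k).
Proof.
move=> [[Lv Lg _] [v_ [tv cv cg]]]; exists v_ => //; split=> // k.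
- exact: test_function_smooth (tv k).
- by have [] := test_in_Lp p1' (tv k).
- by have [] := test_in_Lp p1' (tv k).
Qed.

Lemma W1p0_test phi : test_function D phi -> W1p0 D p phi (grad phi).
Proof.
move=> tphi; have [L1 L2] := test_in_Lp p1' tphi.
apply: (@approx_W1p0 _ _ (fun=> phi)) => //; split=> //.
- by move=> _; exact: test_function_smooth tphi.
- under eq_fun do under eq_fun do rewrite subrr.
  by under eq_fun do rewrite LpN0//; exact: cvg_cst.
under eq_fun do under eq_fun do rewrite subrr enorm0.
by under eq_fun do rewrite LpN0//; exact: cvg_cst.
Qed.

Lemma gradM (f g : 'rV[R]_n -> R) x : smooth f -> smooth g ->
  grad (fun y => f y * g y) x = f x *: grad g x + g x *: grad f x.
Proof.
move=> sf sg; apply/rowP => i; rewrite !mxE partialM; do ?exact: smooth_derivable.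
by rewrite [partial _ _ _ * _]mulrC.
Qed.

Lemma gradB (f g : 'rV[R]_n -> R) x : smooth f -> smooth g ->
  grad (fun y => f y - g y) x = grad f x - grad g x.
Proof.
by move=> sf sg; apply/rowP => i; rewrite !mxE partialB//; exact: smooth_derivable.
Qed.

Lemma approxB v g (v_ : nat -> 'rV[R]_n -> R) u h (u_ : nat -> 'rV[R]_n -> R) :
  smooth_approx D p v g v_ -> smooth_approx D p u h u_ ->
  smooth_approx D p (fun x => v x - u x) (fun x => g x - h x) (fun k x => v_ k x - u_ k x).
Proof.
move=> Av Au.
have LB w z : in_Lp D p w -> in_Lp D p z -> in_Lp D p (fun x => w x - z x).
  move=> Lw Lz; have := in_LpD mD p1' Lw (in_LpZ mD p1' (-1) Lz).
  by congr (in_Lp _ _ _); apply/funext => x; rewrite mulN1r.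
have EB k : grad (fun x => v_ k x - u_ k x) = fun x => grad (v_ k) x - grad (u_ k) x.
  by apply/funext => x; apply: gradB; [exact: approx_smooth Av k|exact: approx_smooth Au k].
have Lvk k := LB _ _ (approx_Lp Av) (approx_seq_Lp Av k).
have Luk k := LB _ _ (approx_Lp Au) (approx_seq_Lp Au k).
have Lgk k := in_Lp_vecB mD p1' (approx_Lp_vec Av) (approx_seq_Lp_vec Av k).
have Lhk k := in_Lp_vecB mD p1' (approx_Lp_vec Au) (approx_seq_Lp_vec Au k).
split.
- exact: LB (approx_Lp Av) (approx_Lp Au).
- exact (in_Lp_vecB mD p1' (approx_Lp_vec Av) (approx_Lp_vec Au)).
- by move=> k; apply: smoothB; [exact: approx_smooth Av k|exact: approx_smooth Au k].
- by move=> k; exact: LB (approx_seq_Lp Av k) (approx_seq_Lp Au k).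
- move=> k; rewrite EB.
  exact (in_Lp_vecB mD p1' (approx_seq_Lp_vec Av k) (approx_seq_Lp_vec Au k)).
- apply: cvg0_le (cvg0_addZ 1 1 (approx_cvg Av) (approx_cvg Au)) => k; first exact: LpN_ge0.
  apply: LpN_le_lin => //; do ?[by case: (Lvk k)|by case: (Luk k)].
    by case: (LB _ _ (LB _ _ (approx_Lp Av) (approx_Lp Au))
       (LB _ _ (approx_seq_Lp Av k) (approx_seq_Lp Au k))).
  move=> x _; rewrite !mul1r; have -> : v x - u x - (v_ k x - u_ k x) =
    (v x - v_ k x) - (u x - u_ k x) by ring.
  exact: ler_normB.
apply: cvg0_le (cvg0_addZ 1 1 (approx_cvg_grad Av) (approx_cvg_grad Au)) => k.
  exact: LpN_ge0.
apply: LpN_enorm_le_add; [|exact: (Lgk k).1|exact: (Lhk k).1|].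
- rewrite EB; apply: measurable_rVB; apply: measurable_rVB.
  + by case: (approx_Lp_vec Av).
  + by case: (approx_Lp_vec Au).
  + by case: (approx_seq_Lp_vec Av k).
  + by case: (approx_seq_Lp_vec Au k).
by move=> x; rewrite (EB k); exact: enormB_le.
Qed.

(** The product rule is classical for the smooth [v_ k]; the bound [B] on rho and its gradient
    carries it to the limit in L^p. *)
Lemma approxM v g (v_ : nat -> 'rV[R]_n -> R) rho B : 0 <= B -> smooth rho ->
  (forall x, `|rho x| <= B /\ enorm (grad rho x) <= B) -> smooth_approx D p v g v_ ->
  smooth_approx D p (fun x => rho x * v x) (fun x => rho x *: g x + v x *: grad rho x)
    (fun k x => rho x * v_ k x).
Proof.
move=> B0 srho rhoB Av.
have mrho := @measurable_smooth _ _ rho D srho.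
have mgrho := @measurable_grad _ _ rho D srho.
have LB w z : in_Lp D p w -> in_Lp D p z -> in_Lp D p (fun x => w x - z x).
  move=> Lw Lz; have := in_LpD mD p1' Lw (in_LpZ mD p1' (-1) Lz).
  by congr (in_Lp _ _ _); apply/funext => x; rewrite mulN1r.
have LM w : in_Lp D p w -> in_Lp D p (fun x => rho x * w x).
  exact: (in_Lp_mul_bounded mD p1' mrho (fun x _ => (rhoB x).1)).
have LG w h : in_Lp D p w -> in_Lp_vec D p h ->
    in_Lp_vec D p (fun x => rho x *: h x + w x *: grad rho x).
  move=> Lw Lh; apply: in_Lp_vecD => //.
    apply: (in_Lp_vec_le mD p1' _ _ (in_LpZ mD p1' B (in_Lp_enorm Lh))).
      by apply: measurable_rVZ => //; case: Lh.
    by move=> x _; rewrite enormZ /= ler_wpM2r ?enorm_ge0//; have [] := rhoB x.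
  apply: (in_Lp_vec_le mD p1' _ _ (in_LpZ mD p1' B (in_Lp_norm mD p1' Lw))).
    by apply: measurable_rVZ => //; case: Lw.
  by move=> x _; rewrite enormZ /= mulrC ler_wpM2r//; have [] := rhoB x.
have EM k : grad (fun x => rho x * v_ k x) =
    fun x => rho x *: grad (v_ k) x + v_ k x *: grad rho x.
  by apply/funext => x; apply: gradM => //; exact: approx_smooth Av k.
have Lvk k := LB _ _ (approx_Lp Av) (approx_seq_Lp Av k).
have Lgk k := in_Lp_vecB mD p1' (approx_Lp_vec Av) (approx_seq_Lp_vec Av k).
split.
- exact/LM/(approx_Lp Av).
- exact: LG (approx_Lp Av) (approx_Lp_vec Av).
- by move=> k; apply: smoothM => //; exact: approx_smooth Av k.
- by move=> k; exact: LM (approx_seq_Lp Av k).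
- by move=> k; rewrite EM; exact: LG (approx_seq_Lp Av k) (approx_seq_Lp_vec Av k).
- apply: cvg0_le (cvg0_addZ B B (approx_cvg Av) (approx_cvg_grad Av)) => k.
    exact: LpN_ge0.
  apply: LpN_le_lin => //.
  + by case: (LB _ _ (LM _ (approx_Lp Av)) (LM _ (approx_seq_Lp Av k))).
  + by case: (Lvk k).
  + by case: (in_Lp_enorm (Lgk k)).
  move=> x _; rewrite -mulrBr normrM; apply: ler_wpDr; first by rewrite mulr_ge0.
  by rewrite ler_wpM2r//; have [] := rhoB x.
apply: cvg0_le (cvg0_addZ B B (approx_cvg Av) (approx_cvg_grad Av)) => k.
  exact: LpN_ge0.
apply: LpN_le_lin => //.
- rewrite EM; have [m1 _] := LG _ _ (approx_Lp Av) (approx_Lp_vec Av).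
  have [m2 _] := LG _ _ (approx_seq_Lp Av k) (approx_seq_Lp_vec Av k).
  exact: measurable_enorm_dist m1 m2.
- by case: (Lvk k).
- by case: (in_Lp_enorm (Lgk k)).
move=> x _; rewrite EM !norm_enorm.
have -> : rho x *: g x + v x *: grad rho x - (rho x *: grad (v_ k) x + v_ k x *: grad rho x) =
  (v x - v_ k x) *: grad rho x + rho x *: (g x - grad (v_ k) x).
  by apply/rowP => i; rewrite !mxE; ring.
apply: le_trans (ler_enormD _ _) _; rewrite !enormZ; have [r1 r2] := rhoB x.
by apply: lerD; [rewrite mulrC ler_wpM2r|rewrite ler_wpM2r// enorm_ge0].
Qed.

End approx_closure.

(** * Functions of X_2 extended to the cylinder *)

Section approx_tail.
Context {R : realType} {m k : nat}.
Variables (D : set 'rV[R]_(m + k)) (omega2 : set 'rV[R]_k) (M p : R).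
Hypotheses (mD : measurable D) (m2 : measurable omega2) (p1 : 1 <= p).
Hypothesis DM : forall x, D x -> box M (lsubmx x) /\ omega2 (rsubmx x).

Let p0 : 0 < p. Proof. exact: lt_le_trans p1. Qed.

Lemma measurable_tail d (T : measurableType d) (g : 'rV[R]_k -> T) :
  measurable_fun omega2 g -> measurable_fun D (fun x => g (rsubmx x)).
Proof.
move=> mg; apply: (measurable_comp m2 _ mg).
  by move=> _ [x Dx <-]; have [] := DM Dx.
by apply: measurable_funTS; exact: measurable_rsubmx.
Qed.

(** The constant is the r-th root of the volume of the X_1-box that contains the base of [D], by
    [ge0_integral_box_tail]. *)
Lemma LpN_tail (r : R) (g : 'rV[R]_k -> R) : 0 < r -> measurable_fun omega2 g ->
  (LpN D r (fun x => g (rsubmx x)) <=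
   (((2 * Num.max M 0) ^+ m) `^ r^-1)%:E * LpN omega2 r g)%E.
Proof.
move=> r0 mg; rewrite !LpNE// -poweR_EFin -poweRM; last 2 first.
- by rewrite lee_fin exprn_ge0// mulr_ge0// le_max lexx orbT.
- by apply: integral_ge0 => x _; rewrite lee_fin powR_ge0.
have c0 : 0 <= (2 * Num.max M 0) ^+ m.
  by rewrite exprn_ge0// mulr_ge0// le_max lexx orbT.
apply: gt0_ler_poweR.
- by rewrite invr_ge0 ltW.
- by rewrite in_itv/= leey andbT integral_ge0// => x _; rewrite lee_fin powR_ge0.
- rewrite in_itv/= leey andbT; apply: mule_ge0; first by rewrite lee_fin.
  by apply: integral_ge0 => x _; rewrite lee_fin powR_ge0.
have mg2 : measurable_fun setT ((fun y => (`|g y| `^ r)%:E) \_ omega2).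
  by apply/(measurable_restrictT _ m2); exact: measurable_normpow.
rewrite [in leRHS]integral_mkcond -ge0_integral_box_tail//; last first.
  by move=> x; rewrite patchE; case: ifP => // _; rewrite lee_fin powR_ge0.
have mB : measurable [set x : 'rV[R]_(m + k) | box M (lsubmx x)].
  have := @measurable_lsubmx R m k measurableT _ (@box_measurable R m M).
  by rewrite setTI.
apply: (@le_trans _ _ (\int[lebesgue_rV (m + k)]_(x in D)
    ((fun y => (`|g y| `^ r)%:E) \_ omega2) (rsubmx x))%E).
  rewrite le_eqVlt; apply/orP; left; apply/eqP; apply: eq_integral => x.
  by rewrite inE => /DM[_ x2]; rewrite patchE mem_set.
apply: ge0_subset_integral => //.
- by apply: measurable_funTS; exact: (measurableT_comp mg2 (@measurable_rsubmx R k m)).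
- by move=> x _; rewrite patchE; case: ifP => // _; rewrite lee_fin powR_ge0.
- by move=> x /DM[].
Qed.

Lemma in_Lp_tail (r : R) (g : 'rV[R]_k -> R) : 0 < r ->
  in_Lp omega2 r g -> in_Lp D r (fun x => g (rsubmx x)).
Proof.
move=> r0 [mg goo]; split; first exact: measurable_tail.
by apply: le_lt_trans (LpN_tail r0 mg) _; rewrite lte_mul_pinfty// ?lee_fin ?powR_ge0.
Qed.

(** The field nabla_2 of the theorem: a gradient in X_2 preceded by zeros, constant in X_1. *)
Definition tail_vec (g : 'rV[R]_k -> 'rV[R]_k) (x : 'rV[R]_(m + k)) : 'rV[R]_(m + k) :=
  row_mx 0 (g (rsubmx x)).

Lemma measurable_tail_vec g : measurable_fun omega2 g -> measurable_fun D (tail_vec g).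
Proof.
move=> mg; apply: measurable_fun_rV_on => i; case: (split_ordP i) => j ->.
  by under eq_fun do rewrite row_mxEl mxE; exact: measurable_cst.
under eq_fun do rewrite row_mxEr.
by apply: measurable_fun_coord; exact: measurable_tail.
Qed.

Lemma in_Lp_vec_tail (r : R) g : 0 < r ->
  in_Lp_vec omega2 r g -> in_Lp_vec D r (tail_vec g).
Proof.
move=> r0 Lg; split; first by apply: measurable_tail_vec; case: Lg.
have [_] := in_Lp_tail r0 (in_Lp_enorm Lg); congr (LpN _ _ _ < _)%E.
by apply/funext => x; rewrite /= enorm_row0mx.
Qed.

Lemma smooth_tail (psi : 'rV[R]_k -> R) : smooth psi ->
  smooth (fun x : 'rV[R]_(m + k) => psi (rsubmx x)).
Proof.
move=> spsi j; change (Ck j (psi \o @rsubmx R 1 m k)).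
pose s (i : 'I_(m + k)) : option 'I_k := if fintype.split i is inr l then Some l else None.
have Ts x i (h : R) : @rsubmx R 1 m k (h *: delta_mx ord0 i + x) =
    h *: (if s i is Some l then delta_mx ord0 l else 0) + rsubmx x.
  rewrite /s; apply/rowP => l; rewrite !mxE; case: (split_ordP i) => i' ->.
    by rewrite !mxE eq_rlshift andbF.
  by rewrite !mxE (inj_eq (@rshift_inj _ _)).
exact: (@Ck_comp_affine R (m + k) k (@rsubmx R 1 m k) s (@continuous_rsubmx R 1 m k)
  Ts j psi (spsi j)).
Qed.

Lemma grad_tail (psi : 'rV[R]_k -> R) :
  grad (fun x : 'rV[R]_(m + k) => psi (rsubmx x)) = tail_vec (grad psi).
Proof.
apply/funext => x; apply/rowP => i; rewrite mxE /tail_vec.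
case: (split_ordP i) => j ->.
  have Tr (h : R) : rsubmx (h *: delta_mx ord0 (lshift k j) + x) = h *: 0 + rsubmx x.
    by apply/rowP => l; rewrite !mxE eq_rlshift andbF.
  by rewrite /partial (derive_comp_affine psi Tr).2 derive0 row_mxEl mxE.
have Tr (h : R) : rsubmx (h *: delta_mx ord0 (rshift m j) + x) =
    h *: delta_mx ord0 j + rsubmx x.
  by apply/rowP => l; rewrite !mxE (inj_eq (@rshift_inj _ _)).
by rewrite /partial (derive_comp_affine psi Tr).2 row_mxEr mxE.
Qed.

(** Extending constantly in X_1 multiplies L^p distances by at most the constant of [LpN_tail], so
    convergence is kept. *)
Lemma approx_tail v g v_ : smooth_approx omega2 p v g v_ ->
  smooth_approx D p (fun x => v (rsubmx x)) (tail_vec g) (fun j x => v_ j (rsubmx x)).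
Proof.
move=> Av; set C := ((2 * Num.max M 0) ^+ m) `^ p^-1.
have CC : (fun j => C%:E * LpN omega2 p (fun y => (v y - v_ j y)%R))%E @ \oo --> 0%E.
  by rewrite -[X in _ --> X](mule0 C%:E); apply: cvgeZl => //; exact: approx_cvg Av.
have CG : (fun j => C%:E * LpN omega2 p (fun y => enorm (g y - grad (v_ j) y)))%E @ \oo --> 0%E.
  by rewrite -[X in _ --> X](mule0 C%:E); apply: cvgeZl => //; exact: approx_cvg_grad Av.
split.
- exact: in_Lp_tail (approx_Lp Av).
- exact: in_Lp_vec_tail (approx_Lp_vec Av).
- by move=> j; apply: smooth_tail; exact: approx_smooth Av j.
- by move=> j; exact: in_Lp_tail (approx_seq_Lp Av j).
- by move=> j; rewrite grad_tail; exact: in_Lp_vec_tail (approx_seq_Lp_vec Av j).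
- apply: cvg0_le CC => j; first exact: LpN_ge0.
  apply: (LpN_tail (g := fun y => v y - v_ j y)) => //.
  apply: measurable_funB; first by case: (approx_Lp Av).
  by case: (approx_seq_Lp Av j).
apply: cvg0_le CG => j; first exact: LpN_ge0.
rewrite grad_tail.
have -> : (fun x => enorm (tail_vec g x - tail_vec (grad (v_ j)) x)) =
    (fun x => enorm (g (rsubmx x) - grad (v_ j) (rsubmx x))).
  by apply/funext => x; rewrite /tail_vec opp_row_mx add_row_mx subr0 enorm_row0mx.
apply: (LpN_tail (g := fun y => enorm (g y - grad (v_ j) y))) => //.
apply: measurable_enorm_dist; first by case: (approx_Lp_vec Av).
by case: (approx_seq_Lp_vec Av j).
Qed.

End approx_tail.

(** * Cutoff functions *)

Section cutoff.
Context {R : realType} {m k : nat}.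
Variables (z : 'rV[R]_m) (s L : R).
Hypothesis L0 : 0 < L.
Implicit Types x : 'rV[R]_(m + k).

Let h1 (i : 'I_m) x : R := flat 1 (L^-1 * x ord0 (lshift k i) + (s + L - z ord0 i) / L).
Let h2 (i : 'I_m) x : R := flat 1 (- L^-1 * x ord0 (lshift k i) + (s + L + z ord0 i) / L).

(** The factor [h1] vanishes when x_i - z_i <= -(s + L), the factor [h2] when x_i - z_i >= s + L,
    and both have argument at least 1 when |x_i - z_i| <= s. The arguments are kept in the form a
    x_i + b that [Ck_comp_coord] expects. *)
Definition cutoff x : R := \prod_(i < m) (h1 i x * h2 i x).

Let flatS : set (R -> R) := [set h | exists P : {poly R}, h = flat P].

Let flatSd h : flatS h -> exists2 h', flatS h' & forall t : R, is_derive t 1 h (h' t).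
Proof.
by move=> [P ->]; exists (flat (flat_deriv P)); [exists (flat_deriv P)|exact: is_derive_flat].
Qed.

Lemma smooth_cutoff : smooth cutoff.
Proof.
move=> j; apply: Ck_prod => i; apply: CkM.
  by apply: (Ck_comp_coord (S := flatS)) => //; exists 1.
by apply: (Ck_comp_coord (S := flatS)) => //; exists 1.
Qed.

Lemma cutoff_ge0 x : 0 <= cutoff x.
Proof. by apply: prodr_ge0 => i _; rewrite mulr_ge0// flat1_ge0. Qed.

Lemma cutoff_le1 x : cutoff x <= 1.
Proof.
apply: prodr_ile1 => i _; rewrite mulr_ge0 ?flat1_ge0//=.
by rewrite mulr_ile1 ?flat1_ge0 ?flat1_le1.
Qed.

Let arg1 i x : L^-1 * x ord0 (lshift k i) + (s + L - z ord0 i) / L =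
  (s + L + (x ord0 (lshift k i) - z ord0 i)) / L.
Proof. by ring. Qed.

Let arg2 i x : - L^-1 * x ord0 (lshift k i) + (s + L + z ord0 i) / L =
  (s + L - (x ord0 (lshift k i) - z ord0 i)) / L.
Proof. by ring. Qed.

(** There are 2m factors, each at least e^(-1) because its argument is at least 1. *)
Lemma cutoff_lbound x : (forall i, `|x ord0 (lshift k i) - z ord0 i| <= s) ->
  expR (-1) ^+ (2 * m) <= cutoff x.
Proof.
move=> xs; rewrite exprM -[m in X in X <= _]card_ord -prodr_const.
apply: ler_prod => i _; rewrite exprn_ge0 ?expR_ge0//= expr2.
have := xs i; rewrite ler_norml => /andP[x1 x2].
apply: ler_pM; rewrite ?expR_ge0//; apply: flat1_lbound.
  by rewrite arg1 ler_pdivlMr// mul1r; lra.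
by rewrite arg2 ler_pdivlMr// mul1r; lra.
Qed.

Lemma cutoff_eq0 x : ~ (forall i, `|x ord0 (lshift k i) - z ord0 i| <= s + L) ->
  cutoff x = 0.
Proof.
move=> /existsNP[i /negP]; rewrite -ltNge => xi.
rewrite /cutoff (bigD1 i)//=; apply/eqP; rewrite mulf_eq0; apply/orP; left.
rewrite mulf_eq0; have [x0|x0] := lerP 0 (x ord0 (lshift k i) - z ord0 i).
  apply/orP; right; apply/eqP; rewrite /h2 arg2 flat1_eq0//.
  rewrite ger0_norm// in xi.
  by rewrite pmulr_lle0 ?invr_gt0//; lra.
apply/orP; left; apply/eqP; rewrite /h1 arg1 flat1_eq0//.
rewrite ltr0_norm// in xi.
by rewrite pmulr_lle0 ?invr_gt0//; lra.
Qed.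

(** Each of the two profiles has slope at most 2/L and values in [0, 1], so their product has slope
    at most 4/L. *)
Let partial_factor i j x :
  `|partial j (fun x => h1 i x * h2 i x) x| <= (j == lshift k i)%:R * (4 / L).
Proof.
have D1 := is_derive_comp_coord (lshift k i) j L^-1 ((s + L - z ord0 i) / L) x
  (@is_derive_flat R 1).
have D2 := is_derive_comp_coord (lshift k i) j (- L^-1) ((s + L + z ord0 i) / L) x
  (@is_derive_flat R 1).
have E1 : partial j (h1 i) x = (j == lshift k i)%:R * L^-1 *
  flat (flat_deriv 1) (L^-1 * x ord0 (lshift k i) + (s + L - z ord0 i) / L) by case: D1.
have E2 : partial j (h2 i) x = (j == lshift k i)%:R * - L^-1 *
  flat (flat_deriv 1) (- L^-1 * x ord0 (lshift k i) + (s + L + z ord0 i) / L) by case: D2.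
rewrite partialM; [|by case: D1|by case: D2].
rewrite E1 E2 {E1 E2}.
have Li : 0 < L^-1 by rewrite invr_gt0.
have f1 := flat1_deriv_bound (L^-1 * x ord0 (lshift k i) + (s + L - z ord0 i) / L).
have f2 := flat1_deriv_bound (- L^-1 * x ord0 (lshift k i) + (s + L + z ord0 i) / L).
have g1 : 0 <= h1 i x <= 1 by rewrite flat1_ge0 flat1_le1.
have g2 : 0 <= h2 i x <= 1 by rewrite flat1_ge0 flat1_le1.
move: f1 f2 g1 g2; rewrite -/(h1 i x) -/(h2 i x).
set a := flat _ _; set b := flat _ _; case: (j == _); last first.
  by rewrite !mul0r mulr0 addr0 normr0.
move=> f1 f2 /andP[g10 g11] /andP[g20 g21]; rewrite !mul1r.
apply: le_trans (ler_normD _ _) _; rewrite !normrM normrN.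
rewrite (ger0_norm g10) (ger0_norm g20) (gtr0_norm Li).
have -> : 4 / L = 1 * (L^-1 * 2) + (L^-1 * 2) * 1 by ring.
have q1 : L^-1 * `|b| <= L^-1 * 2 by rewrite ler_wpM2l// ltW.
have q2 : L^-1 * `|a| <= L^-1 * 2 by rewrite ler_wpM2l// ltW.
have q3 : 0 <= L^-1 * `|b| by rewrite mulr_ge0// ltW.
have q4 : 0 <= L^-1 * `|a| by rewrite mulr_ge0// ltW.
by apply: lerD; apply: ler_pM.
Qed.

Let smooth_factor i : smooth (fun x => h1 i x * h2 i x).
Proof.
move=> j; apply: CkM.
  by apply: (Ck_comp_coord (S := flatS)) => //; exists 1.
by apply: (Ck_comp_coord (S := flatS)) => //; exists 1.
Qed.

(** Induction over the list of factors, the product rule being applied to two functions at a time;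
    undifferentiated factors are at most 1. *)
Let partial_cutoff_seq (r : seq 'I_m) j x :
  `|partial j (fun x => \prod_(i <- r) (h1 i x * h2 i x)) x| <=
  \sum_(i <- r) (j == lshift k i)%:R * (4 / L).
Proof.
elim: r => [|i r IHr].
  rewrite big_nil (_ : (fun _ => _) = cst 1).
    by rewrite /partial derive_cst normr0.
  by apply/funext => y; rewrite big_nil.
rewrite big_cons (_ : (fun _ => _) = (fun x => (h1 i x * h2 i x) *
    \prod_(i <- r) (h1 i x * h2 i x))); last by apply/funext => y; rewrite big_cons.
rewrite partialM; last 2 first.
- exact: smooth_derivable (smooth_factor i).
- by apply: smooth_derivable => l; apply: Ck_prod => i'; exact: smooth_factor.
apply: le_trans (ler_normD _ _) _; rewrite addrC; apply: lerD.
  rewrite normrM; apply: le_trans (partial_factor i j x).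
  rewrite ler_piMr// ger0_norm; last by apply: prodr_ge0 => i' _; rewrite mulr_ge0 ?flat1_ge0.
  apply: prodr_ile1 => i' _; rewrite mulr_ge0 ?flat1_ge0//=.
  by rewrite mulr_ile1 ?flat1_ge0 ?flat1_le1.
rewrite normrM; apply: le_trans _ IHr; rewrite ler_piMl//.
rewrite ger0_norm ?mulr_ge0 ?flat1_ge0//.
by rewrite mulr_ile1 ?flat1_ge0 ?flat1_le1.
Qed.

(** Constancy in X_2 leaves only the F-block in the error term and keeps the derivative of the
    cutoff out of the Poincare inequality. *)
Lemma partial_cutoff_rshift j x : partial (rshift m j) cutoff x = 0.
Proof.
apply/normr0_eq0/eqP; rewrite eq_le normr_ge0 andbT.
apply: le_trans (partial_cutoff_seq _ _ _) _; rewrite big1// => i _.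
by rewrite eq_rlshift mul0r.
Qed.

Lemma partial_cutoff_lshift i x : `|partial (lshift k i) cutoff x| <= 4 / L.
Proof.
apply: le_trans (partial_cutoff_seq _ _ _) _; rewrite (bigD1 i)//= eqxx mul1r.
rewrite big1 ?addr0// => j ji.
by rewrite (inj_eq (@lshift_inj _ _)) eq_sym (negbTE ji) mul0r.
Qed.

Lemma enorm_grad_cutoff x : enorm (grad cutoff x) <= m%:R * (4 / L).
Proof.
apply: le_trans (enorm_le_sum _) _; rewrite big_split_ord/=.
rewrite [X in _ + X]big1 ?addr0 => [|j _]; last by rewrite mxE partial_cutoff_rshift normr0.
rewrite -[m in X in _ <= X%:R * _]card_ord -sumr_const mulr_suml.
by apply: ler_sum => i _; rewrite mul1r mxE partial_cutoff_lshift.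
Qed.

End cutoff.

(** * Poincare inequality *)

Section poincare.
Context {R : realType} {n : nat}.
Local Notation mu := (@lebesgue_rV R n).
Variables (D : set 'rV[R]_n) (p M : R) (j : 'I_n).
Hypotheses (mD : measurable D) (p2 : 2 <= p) (M0 : 0 <= M).
Hypothesis DM : forall x, D x -> `|x ord0 j| <= M.

Let p0 : 0 < p. Proof. by move: p2; lra. Qed.

(** The p-th root of 2 c with c = 2^p (p M)^p: c is the coefficient given by [powR_absorb] once p M
    is moved into b, and 2 comes from absorbing half of the left side. Only the width M in one
    direction enters, hence not l. *)
Definition poincare_const : R := (2 * (2 `^ p * (p * M) `^ p)) `^ p^-1.

Lemma smooth_coord (i : 'I_n) : smooth (fun x : 'rV[R]_n => x ord0 i).
Proof.
move=> l.
have -> : (fun x : 'rV[R]_n => x ord0 i) = (fun x => id (1 * x ord0 i + 0)).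
  by apply/funext => x; rewrite mul1r addr0.
pose S := [set h : R -> R | h = id \/ exists c : R, h = cst c].
have Sd h : S h -> exists2 h', S h' & forall t : R, is_derive t 1 h (h' t).
  move=> [->|[c ->]].
    by exists (cst 1); [right; exists 1|move=> t; exact: is_derive_id].
  by exists (cst 0); [right; exists 0|move=> t; exact: is_derive_cst].
exact: (@Ck_comp_coord R n S i 1 0 Sd l id (or_introl erefl)).
Qed.

Lemma partial_coord (i : 'I_n) (x : 'rV[R]_n) : partial i (fun x : 'rV[R]_n => x ord0 i) x = 1.
Proof.
have := is_derive_comp_coord i i 1 0 x (fun t => is_derive_id t (1 : R)).
have -> : (fun x : 'rV[R]_n => id (1 * x ord0 i + 0)) = (fun x => x ord0 i).
  by apply/funext => y; rewrite mul1r addr0.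
by case=> _ h; rewrite /partial h eqxx !mul1r.
Qed.

Lemma continuous_normpow (g : 'rV[R]_n -> R) : continuous g ->
  continuous (fun x => `|g x| `^ p).
Proof.
move=> cg x; apply: (@continuous_comp _ _ _ g (fun t : R => `|t| `^ p)); first exact: cg.
apply: differentiable_continuous; apply/derivable1_diffP.
by case: (is_derive_pow (g x) p2).
Qed.

Lemma partial_normpow (g : 'rV[R]_n -> R) i x : smooth g ->
  is_derive x (delta_mx ord0 i) (fun y => `|g y| `^ p) (dpow p (g x) * partial i g x).
Proof.
move=> sg; exact (is_derive_comp_real (is_derive_partial (@smooth_derivable R n g i x sg))
  (is_derive_pow (g x) p2)).
Qed.

Lemma integral_normpow_Rintegral (g : 'rV[R]_n -> R) :
  mu.-integrable setT (EFin \o (fun x => `|g x| `^ p)) -> (forall x, ~ D x -> g x = 0) ->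
  (\int[mu]_(x in D) (`|g x| `^ p)%:E = (\int[mu]_x (`|g x| `^ p))%:E)%E.
Proof.
move=> ig gD; rewrite fineK; last exact: integrable_fin_num.
rewrite [LHS]integral_mkcond; apply: eq_integral => x _; rewrite patchE.
case: ifPn => // /negP; rewrite inE => /gD ->.
by rewrite normr0 powR0// gt_eqF.
Qed.

(* Integrate the derivative of [x_j |phi|^p], then absorb by Young's inequality. *)
Lemma poincare_test phi : test_function D phi ->
  (LpN D p phi <= poincare_const%:E * LpN D p (partial j phi))%E.
Proof.
move=> tphi; have sphi := test_function_smooth tphi.
have [B B0 phiB] := test_function_box tphi.
pose A := \int[mu]_x (`|phi x| `^ p); pose A' := \int[mu]_x (`|partial j phi x| `^ p).
have c1 := continuous_normpow (smooth_continuous sphi).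
have c2 := continuous_normpow (smooth_continuous (smooth_partial j sphi)).
have z0 : `|0 : R| `^ p = 0 by rewrite normr0 powR0// gt_eqF.
have i1 : mu.-integrable setT (EFin \o (fun x => `|phi x| `^ p)).
  by apply: (integrable_csupp c1 (M := B)) => x /phiB[-> _]; exact: z0.
have i2 : mu.-integrable setT (EFin \o (fun x => `|partial j phi x| `^ p)).
  by apply: (integrable_csupp c2 (M := B)) => x /phiB[_ ->]; exact: z0.
(* One of the two terms in the j-th derivative of x_j |phi|^p; the other is |phi|^p. *)
pose w (x : 'rV[R]_n) : R := x ord0 j * (dpow p (phi x) * partial j phi x).
have cw : continuous w.
  apply: continuous_mulf; first exact: continuous_coord.
  apply: continuous_mulf; last exact: smooth_continuous (smooth_partial j sphi).
  move=> x; apply: (@continuous_comp _ _ _ phi (dpow p)).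
    exact: (smooth_continuous sphi).
  exact: continuous_dpow.
have i3 : mu.-integrable setT (EFin \o w).
  by apply: (integrable_csupp cw (M := B)) => x /phiB[_ wx]; rewrite /w wx !mulr0.
have ibp : A + \int[mu]_x w x = 0.
  pose g (x : 'rV[R]_n) : R := x ord0 j * `|phi x| `^ p.
  have dg x i : derivable (fun y => `|phi y| `^ p) x (delta_mx ord0 i).
    by case: (partial_normpow i x sphi).
  have Cg : Ck 1 g.
    apply: CkM; first exact: smooth_coord.
    apply/Ck1P; split=> // i; split=> [x|]; first exact: dg.
    have -> : partial i (fun x => `|phi x| `^ p) = fun x => dpow p (phi x) * partial i phi x.
      by apply/funext => x; rewrite /partial; case: (partial_normpow i x sphi).
    apply: continuous_mulf; last exact: smooth_continuous (smooth_partial i sphi).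
    move=> x; apply: (@continuous_comp _ _ _ phi (dpow p)).
      exact: (smooth_continuous sphi).
    exact: continuous_dpow.
  have gB x : ~ box B x -> g x = 0 by move=> /phiB[gx _]; rewrite /g gx z0 mulr0.
  have /(congr1 fine) h := integral_partial j Cg gB.
  rewrite -RintegralD//; apply: (etrans _ h); apply: eq_Rintegral => x _.
  apply: esym; rewrite /g partialM; [|exact: smooth_derivable (smooth_coord j)|exact: dg].
  rewrite partial_coord mul1r addrC; congr (_ + x ord0 j * _).
  by rewrite /partial; case: (partial_normpow j x sphi).
have pM0 : 0 <= p * M by rewrite mulr_ge0// ltW.
pose c := 2 `^ p * (p * M) `^ p.
have c0 : 0 <= c by rewrite mulr_ge0 ?powR_ge0.
have est x : - w x <= 2^-1 * `|phi x| `^ p + c * `|partial j phi x| `^ p.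
  apply: le_trans (ler_norm _) _; rewrite normrN /w normrM [`|dpow _ _ * _|]normrM norm_dpow//.
  (* The bound |x_j| <= M is available only in [D]; outside it phi vanishes and so does the left
     side. *)
  have [Dx|Dx] := pselect (D x); last first.
    rewrite (test_function_eq0 tphi Dx) normr0 [_ `^ (p - 1)]powR0; last first.
      by rewrite gt_eqF//; move: p2; lra.
    by rewrite mulr0 mul0r mulr0 addr_ge0// mulr_ge0// ?powR_ge0// invr_ge0.
  have := powR_absorb p2 (normr_ge0 (phi x)) (mulr_ge0 pM0 (normr_ge0 (partial j phi x))).
  rewrite (powRM _ pM0)// mulrA; apply: le_trans.
  have -> : `|phi x| `^ (p - 1) * (p * M * `|partial j phi x|) =
    M * (p * `|phi x| `^ (p - 1) * `|partial j phi x|) by ring.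
  by apply: ler_wpM2r; rewrite ?DM// !mulr_ge0 ?powR_ge0// ltW.
have AA' : A <= 2 * c * A'.
  have iN : mu.-integrable setT (EFin \o (fun x => - w x)).
    by have := integrableN i3; exact: eq_integrable.
  have iR1 : mu.-integrable setT (EFin \o (fun x => 2^-1 * `|phi x| `^ p)).
    by have := integrableZl measurableT 2^-1 i1; exact: eq_integrable.
  have iR2 : mu.-integrable setT (EFin \o (fun x => c * `|partial j phi x| `^ p)).
    by have := integrableZl measurableT c i2; exact: eq_integrable.
  have iR : mu.-integrable setT (EFin \o (fun x => 2^-1 * `|phi x| `^ p +
      c * `|partial j phi x| `^ p)).
    by have := integrableD measurableT iR1 iR2; exact: eq_integrable.
  have := le_Rintegral measurableT iN iR (fun x _ => est x).
  rewrite RintegralD// RintegralZl// RintegralZl// -/A -/A'.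
  have -> : \int[mu]_x (- w x) = - \int[mu]_x w x.
    rewrite -mulN1r -RintegralZl//; apply: eq_Rintegral => x _.
    by rewrite mulN1r.
  move: ibp; lra.
have A'0 : 0 <= A' by apply: Rintegral_ge0 => x _; exact: powR_ge0.
rewrite !LpNE// !integral_normpow_Rintegral//; last 2 first.
- by move=> x; exact: partial_test_eq0 tphi.
- by move=> x; exact: test_function_eq0 tphi.
rewrite !poweR_EFin -EFinM lee_fin /poincare_const -/A -/A' -/c.
have c20 : 0 <= 2 * c by rewrite mulr_ge0.
rewrite -(powRM _ c20 A'0).
have A0 : 0 <= A by apply: Rintegral_ge0 => x _; exact: powR_ge0.
have A20 : 0 <= 2 * c * A' by exact: le_trans AA'.
by apply: ge0_ler_powR => //; rewrite invr_ge0 ltW.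
Qed.

End poincare.

Section poincare_W1p0.
Context {R : realType} {n : nat}.
Local Notation mu := (@lebesgue_rV R n).
Variables (D : set 'rV[R]_n) (p M : R) (j : 'I_n).
Hypotheses (mD : measurable D) (Doo : (mu D < +oo)%E) (p2 : 2 <= p) (M0 : 0 <= M).
Hypothesis DM : forall x, D x -> `|x ord0 j| <= M.

Let p1 : 1 < p. Proof. by move: p2; lra. Qed.
Let p0 : 0 < p. Proof. by move: p2; lra. Qed.
Let C := poincare_const p M.

(** Replacing v by a test function costs the L^p norm of v - v_i plus C times that of g - grad v_i,
    and both tend to 0. *)
Lemma poincare_W1p0 v g : W1p0 D p v g ->
  (LpN D p v <= C%:E * LpN D p (fun x => g x ord0 j))%E.
Proof.
move=> /(W1p0_approx mD Doo p1)[v_ Av tv].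
have C0 : 0 <= C by exact: powR_ge0.
have Lgj := in_Lp_coord mD (ltW p1) j (approx_Lp_vec Av).
(* The right-hand side has to be finite before it can be subtracted in the extended reals. *)
have fin : (C%:E * LpN D p (fun x => g x ord0 j))%E \is a fin_num.
  by rewrite fin_numM// ge0_fin_numE ?LpN_ge0//; case: Lgj.
rewrite -sube_le0; apply: (le_cvg0 _ (cvg0_addZ 1 C (approx_cvg Av) (approx_cvg_grad Av))) => i.
rewrite leeBlDr// mul1e.
have Lvi := approx_seq_Lp Av i; have Lgi := approx_seq_Lp_vec Av i.
have mv : measurable_fun D v by case: (approx_Lp Av).
have mvi : measurable_fun D (v_ i) by case: Lvi.
have mg : measurable_fun D g by case: (approx_Lp_vec Av).
have mgi : measurable_fun D (grad (v_ i)) by case: Lgi.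
have h1 : (LpN D p v <= LpN D p (fun x => (v x - v_ i x)%R) + LpN D p (v_ i))%E.
  have := LpND mD (ltW p1) (measurable_funB mv mvi) mvi.
  by congr (LpN D p _ <= _)%E; apply/funext => x; rewrite /= subrK.
apply: le_trans h1 _; rewrite -addeA; apply: leeD => //.
apply: le_trans (poincare_test p2 M0 DM (tv i)) _.
rewrite -ge0_muleDr ?LpN_ge0//; apply: lee_wpmul2l; first by rewrite lee_fin.
have mgj := measurable_fun_coord j mg; have mgij := measurable_fun_coord j mgi.
have h2 : (LpN D p (partial j (v_ i)) <= 1%:E * LpN D p (fun x => enorm (g x - grad (v_ i) x)) +
    1%:E * LpN D p (fun x => g x ord0 j))%E.
  apply: (LpN_le_lin mD p1) => //.
  - by move: mgij; under eq_fun do rewrite mxE.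
  - exact: measurable_enorm_dist.
  move=> x _; rewrite !mul1r norm_enorm.
  have -> : partial j (v_ i) x = - ((g x - grad (v_ i) x) ord0 j) + g x ord0 j.
    by rewrite !mxE; ring.
  apply: le_trans (ler_normD _ _) _; rewrite normrN lerD2r.
  exact: norm_coord_le_enorm.
by move: h2; rewrite !mul1e.
Qed.

End poincare_W1p0.

(** * Geometry of the cylinders *)

Section cylinder_geometry.
Context {R : realType} {m k : nat}.

Definition cube (z : 'rV[R]_m) (s : R) : set 'rV[R]_(m + k) :=
  [set x | forall i, `|x ord0 (lshift k i) - z ord0 i| <= s].

Lemma cube_closed z s : closed (cube z s).
Proof.
have -> : cube z s = \bigcap_(i in [set: 'I_m])
    ((fun x : 'rV[R]_(m + k) => `|x ord0 (lshift k i) - z ord0 i|) @^-1` [set t | t <= s]).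
  by apply/seteqP; split=> [x xs i _|x xs i]; [exact: xs|exact: xs i I].
apply: closed_bigI => i _; apply: closed_comp; last exact: closed_le.
move=> x _; apply: (@continuous_comp _ _ _
  (fun x : 'rV[R]_(m + k) => x ord0 (lshift k i) + - z ord0 i) (fun t : R => `|t|));
  last exact: norm_continuous.
apply: (@continuous_addf R _ (fun x : 'rV[R]_(m + k) => x ord0 (lshift k i)) (fun=> - z ord0 i)).
  exact: continuous_coord.
exact: cst_continuous.
Qed.

Lemma closed_measurable_rV n (A : set 'rV[R]_n) : closed A -> measurable A.
Proof.
move=> cA; rewrite -(setCK A); apply: measurableC; apply: open_measurable_rV.
exact: closed_openC.
Qed.

Lemma cube_measurable z s : measurable (cube z s).
Proof. by apply: closed_measurable_rV; exact: cube_closed. Qed.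

Lemma cubeS z s t : s <= t -> cube z s `<=` cube z t.
Proof. by move=> st x xs i; exact: le_trans st. Qed.

Lemma cylinderP l (omega1 : set 'rV[R]_m) (omega2 : set 'rV[R]_k) (x : 'rV[R]_(m + k)) : l != 0 ->
  cylinder l omega1 omega2 x <-> omega1 (l^-1 *: lsubmx x) /\ omega2 (rsubmx x).
Proof.
move=> l0; split=> [[[y y1 <-] x2]|[x1 x2]]; split=> //.
  by rewrite scalerA mulVf// scale1r.
by exists (l^-1 *: lsubmx x) => //; rewrite scalerA mulfV// scale1r.
Qed.

Lemma cylinder_open l (omega1 : set 'rV[R]_m) (omega2 : set 'rV[R]_k) : l != 0 ->
  open omega1 -> open omega2 -> open (cylinder l omega1 omega2).
Proof.
move=> l0 o1 o2.
have -> : cylinder l omega1 omega2 =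
    ((fun x : 'rV[R]_(m + k) => l^-1 *: lsubmx x) @^-1` omega1) `&` (rsubmx @^-1` omega2).
  by apply/seteqP; split=> x /=; [move/(cylinderP _ _ _ l0)|move=> ?; exact/(cylinderP _ _ _ l0)].
apply: openI; apply: open_comp => // x _; last exact: continuous_rsubmx.
apply: continuous_rV => i.
under eq_fun do rewrite !mxE; apply: continuous_mulf; first exact: cst_continuous.
exact: continuous_coord.
Qed.

Lemma cylinder_box l (omega1 : set 'rV[R]_m) (omega2 : set 'rV[R]_k) M1 M2 : 0 < l ->
  omega1 `<=` box M1 -> omega2 `<=` box M2 ->
  forall x, cylinder l omega1 omega2 x -> box (l * M1) (lsubmx x) /\ box M2 (rsubmx x).
Proof.
move=> l0 h1 h2 x [[y /h1 y1 <-] /h2 x2]; split=> // i.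
by rewrite mxE normrM gtr0_norm// ler_pM2l.
Qed.

Lemma box_row_mx M M' (x : 'rV[R]_(m + k)) : box M (lsubmx x) -> box M' (rsubmx x) ->
  box (Num.max M M') x.
Proof.
move=> x1 x2 i; rewrite le_max; apply/orP; case: (split_ordP i) => j ->.
  by left; have := x1 j; rewrite mxE.
by right; have := x2 j; rewrite mxE.
Qed.

Lemma cylinder_fin l (omega1 : set 'rV[R]_m) (omega2 : set 'rV[R]_k) M1 M2 : 0 < l ->
  open omega1 -> open omega2 ->
  omega1 `<=` box M1 -> omega2 `<=` box M2 ->
  (lebesgue_rV (m + k) (cylinder l omega1 omega2) < +oo)%E.
Proof.
move=> l0 o1 o2 h1 h2; apply: le_lt_trans (box_fin (Num.max (l * M1) M2)).
apply: le_measure.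
- by rewrite inE; apply: open_measurable_rV; apply: cylinder_open => //; rewrite gt_eqF.
- by rewrite inE; exact: box_measurable.
by move=> x /(cylinder_box l0 h1 h2)[]; exact: box_row_mx.
Qed.

(** This is the shape of the set that carries a cutoff times an approximant of [err]. *)
Lemma compact_cube_tail z s (K : set 'rV[R]_k) : compact K ->
  compact (cube z s `&` [set x | K (rsubmx x)]).
Proof.
move=> cK; have clK : closed K by apply: compact_closed => //; exact: norm_hausdorff.
have [M M0 KM] := compact_box cK.
have [N N0 zN] : exists2 N, 0 <= N & forall i, `|z ord0 i| <= N.
  by exists `|z| => // i; exact: norm_coord_le.
apply: (@subclosed_compact _ _ (box (Num.max (N + s) M))).
- apply: closedI; first exact: cube_closed.
  by apply: closed_comp => // x _; exact: continuous_rsubmx.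
- exact: box_compact.
move=> x [xz xK]; apply: box_row_mx; last exact: KM.
move=> i; rewrite mxE; have := xz i; have := zN i.
have := ler_normD (z ord0 i) (x ord0 (lshift k i) - z ord0 i).
by rewrite addrC subrK; lra.
Qed.

(** The point X_1 / l is the midpoint of y and b = 2 X_1 / l - y. The half-width l r / 2 is what
    makes the coordinates of b at most r in absolute value, so b is in omega1 and convexity
    concludes. *)
Lemma cube_sub_cylinder l (omega1 : set 'rV[R]_m) (omega2 : set 'rV[R]_k) r (y : 'rV[R]_m) :
  0 < l ->
  convex_set (omega1 : set (convex_lmodType 'rV[R]_m)) -> box r `<=` omega1 ->
  omega1 y ->
  forall x : 'rV[R]_(m + k), cube ((l / 2) *: y) (l * r / 2) x -> omega2 (rsubmx x) ->
  cylinder l omega1 omega2 x.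
Proof.
move=> l0 cvx romega y1 x xz x2; apply/cylinderP; first by rewrite gt_eqF.
split=> //; pose b : 'rV[R]_m := 2 *: (l^-1 *: lsubmx x) - y.
have b1 : omega1 b.
  apply: romega => i; rewrite !mxE.
  have := xz i; rewrite !mxE => h.
  have -> : 2 * (l^-1 * x ord0 (lshift k i)) - y ord0 i =
      2 / l * (x ord0 (lshift k i) - l / 2 * y ord0 i).
    by field; rewrite gt_eqF.
  rewrite normrM gtr0_norm ?divr_gt0//.
  apply: le_trans (ler_wpM2l _ h) _; first by rewrite divr_ge0// ltW.
  by rewrite le_eqVlt; apply/orP; left; apply/eqP; field; rewrite gt_eqF.
have h0 : 0 <= 2^-1 :> R by rewrite invr_ge0.
have h1 : 2^-1 <= 1 :> R by rewrite invf_le1 ?ler1n.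
have := cvx b y (Itv01 h0 h1); rewrite !inE => /(_ b1 y1).
congr (omega1 _).
change (2^-1 *: b + unstable.onem (2^-1 : R) *: y = l^-1 *: lsubmx x).
have -> : unstable.onem (2^-1 : R) = 2^-1 by rewrite /unstable.onem; lra.
apply/rowP => i; rewrite /b !mxE.
by set X := l^-1 * _; lra.
Qed.

(** Balls of radius r/4 centred in omega1 cover its compact closure. The finite list is chosen
    before l: scaling by l/2 turns the radius into the half-width l r / 8, with the same number of
    cubes for all l. *)
Lemma half_cylinder_cover (omega1 : set 'rV[R]_m) r : bounded_set omega1 -> 0 < r ->
  exists s : seq 'rV[R]_m, (forall y, y \in s -> omega1 y) /\
    forall l (omega2 : set 'rV[R]_k) (x : 'rV[R]_(m + k)), 0 < l ->
      cylinder (l / 2) omega1 omega2 x ->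
      exists2 y, y \in s & cube ((l / 2) *: y) (l * r / 8) x.
Proof.
move=> bo r0; have [M M0 oM] := bounded_set_box bo.
have cK : compact (closure omega1).
  apply: (@subclosed_compact _ _ (box M)); [exact: closed_closure|exact: box_compact|].
  by rewrite ((closure_id _).1 (@box_closed _ _ M)); exact: closure_subset.
move: cK; rewrite compact_cover.
have r4 : 0 < r / 4 by rewrite divr_gt0.
move=> /(_ _ omega1 (fun y => ball y (r / 4))) [].
- by move=> y _; exact: ball_open.
- move=> x ox; have /= [y [oy xy]] := ox _ (nbhsx_ballx x _ r4).
  by exists y => //=; exact: ball_sym.
move=> D' D'o cov; exists (finmap.enum_fset D'); split=> [y|l omega2 x l0].
  by move=> yD'; have := D'o y yD'; rewrite inE.
move=> [[y oy yx] x2]; have [y' y'D yy'] := cov y (subset_closure oy).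
exists y' => // i; rewrite mxE.
have <- : (l / 2 *: y) ord0 i = x ord0 (lshift k i) by rewrite yx mxE.
rewrite mxE -mulrBr normrM gtr0_norm ?divr_gt0//.
have /(rV_ballP _ _ r4)/(_ i) := yy'; rewrite distrC => h.
apply: le_trans (ler_wpM2l _ (ltW h)) _; first by rewrite divr_ge0// ltW.
by rewrite le_eqVlt; apply/orP; left; apply/eqP; field.
Qed.

End cylinder_geometry.

(** * The equations *)

Section flux_Lq.
Context {R : realType}.

Lemma conjugate_exponent (p : R) : 2 <= p ->
  1 <= p / (p - 1) /\ p^-1 + (p / (p - 1))^-1 = 1.
Proof.
move=> p2; have p1 : 0 < p - 1 by lra.
split; first by rewrite ler_pdivlMr// mul1r; lra.
by field; rewrite gt_eqF//= gt_eqF//; lra.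
Qed.

(** The flux grows like |z|^(p-1), and (p - 1) q = p for the conjugate exponent q. *)
Lemma in_Lq_flux n (D : set 'rV[R]_n) n' (p c1 theta1 theta2 : R) (F : 'rV[R]_n' -> R)
    (g : 'rV[R]_n -> 'rV[R]_n') : measurable D -> 2 <= p -> 0 < theta2 ->
  integrand p c1 theta1 theta2 F ->
  measurable_fun D g -> in_Lp D p (enorm \o g) ->
  measurable_fun D (fun x => flux p F (g x)) /\
  in_Lp D (p / (p - 1)) (fun x => enorm (flux p F (g x))).
Proof.
move=> mD p2 th2 hF mg Lg; have p0 : 0 < p by lra.
have p1 : 0 < p - 1 by lra.
have q0 : 0 < p / (p - 1) by rewrite divr_gt0.
have mf : measurable_fun D (fun x => flux p F (g x)).
  exact: (measurableT_comp (measurable_flux p2 th2 hF) mg).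
split=> //; have mef := measurable_fun_enorm mf; split=> //.
apply/(LpN_ltyP q0 mef); case: Lg => meg /(LpN_ltyP p0 meg) ig.
set C := n'%:R * theta2 `^ p.
have C0 : 0 <= C by rewrite mulr_ge0 ?powR_ge0.
have := integrableZl mD (C `^ (p / (p - 1))) ig.
apply: le_integrable => //; first exact: measurable_normpow.
move=> x _; rewrite -EFinM lee_fin.
rewrite [leLHS]ger0_norm ?powR_ge0// [leRHS]ger0_norm ?mulr_ge0 ?powR_ge0//.
rewrite !norm_enorm.
have -> : enorm (g x) `^ p = (enorm (g x) `^ (p - 1)) `^ (p / (p - 1)).
  by rewrite -powRrM; congr (_ `^ _); field; rewrite gt_eqF.
rewrite -powRM ?powR_ge0//; apply: ge0_ler_powR; rewrite ?nnegrE ?enorm_ge0 ?(ltW q0)//.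
  by rewrite mulr_ge0 ?powR_ge0.
exact: enorm_flux_le p2 th2 hF _.
Qed.

End flux_Lq.

(** * The equation in omega2, extended to the cylinder *)

Section tail_equation.
Context {R : realType} {m k : nat}.
Variables (D : set 'rV[R]_(m + k)) (omega2 : set 'rV[R]_k) (M p q : R).
Hypotheses (mD : measurable D) (m2 : measurable omega2).
Hypothesis Doo : (lebesgue_rV (m + k) D < +oo)%E.
Hypothesis oo2 : (lebesgue_rV k omega2 < +oo)%E.
Hypotheses (p1 : 1 < p) (q1 : 1 <= q) (pq : p^-1 + q^-1 = 1).
Hypothesis DM : forall x, D x -> box M (lsubmx x) /\ omega2 (rsubmx x).

Let p0 : 0 < p. Proof. exact: lt_trans p1. Qed.
Let q0 : 0 < q. Proof. exact: lt_le_trans q1. Qed.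

Lemma slice_affine (x1 : 'rV[R]_m) (y : 'rV[R]_k) j (h : R) :
  row_mx x1 (h *: delta_mx ord0 j + y) =
  h *: delta_mx ord0 (rshift m j) + row_mx x1 y.
Proof.
apply/rowP => i; case: (split_ordP i) => i' ->.
  rewrite [RHS]mxE !row_mxEl [X in X + _]mxE [X in _ * X]mxE.
  by rewrite eq_lrshift andbF mulr0 add0r.
rewrite [RHS]mxE !row_mxEr ![in RHS]mxE [LHS]mxE [X in X + _]mxE [X in _ * X]mxE.
by rewrite (inj_eq (@rshift_inj _ _)).
Qed.

Lemma grad_slice (phi : 'rV[R]_(m + k) -> R) x1 y :
  grad (fun y => phi (row_mx x1 y)) y = rsubmx (grad phi (row_mx x1 y)).
Proof.
apply/rowP => j; rewrite !mxE.
exact: (derive_comp_affine phi (slice_affine x1 y j)).2.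
Qed.

(** A slice of a compact subset of [D] is compact and lies in omega2. *)
Lemma test_function_slice phi x1 : test_function D phi ->
  test_function omega2 (fun y => phi (row_mx x1 y)).
Proof.
move=> tphi; have [K [cK clK KD K0]] := test_functionP tphi.
have cr : continuous (fun y : 'rV[R]_k => row_mx x1 y).
  by apply: continuous_row_mx; [exact: cst_continuous|move=> y; exact: cvg_id].
have [B B0 KB] := compact_box cK.
apply: (@mk_test_function _ _ _ _ [set y | K (row_mx x1 y)]).
- move=> j; have aff x i h := slice_affine x1 x i h.
  exact: (@Ck_comp_affine R k (m + k) (fun y => row_mx x1 y)
    (fun i => Some (rshift m i)) cr aff j phi (test_function_smooth tphi j)).
- apply: (@subclosed_compact _ _ (box B)); last 2 first.
  + exact: box_compact.
  + by move=> y /KB yB j; have := yB (rshift m j); rewrite row_mxEr.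
  by apply: closed_comp => // y _; exact: cr.
- by move=> y /KD/DM[_]; rewrite row_mxKr.
by move=> y Ky; exact: K0.
Qed.

(** The first block of [tail_vec a] is 0, so on each slice X_1 = const the integrand is that of
    omega2 tested with the slice of phi; [integral_slices_eq0] then integrates over X_1. *)
Lemma tail_equation (a : 'rV[R]_k -> 'rV[R]_k) (f : 'rV[R]_k -> R) :
  in_Lp_vec omega2 q a -> in_Lp omega2 q f ->
  (forall psi, test_function omega2 psi ->
    \int[lebesgue_rV k]_(y in omega2) (dot (a y) (grad psi y) + f y * psi y) = 0) ->
  forall phi, test_function D phi ->
    \int[lebesgue_rV (m + k)]_(x in D)
      (dot (tail_vec a x) (grad phi x) + f (rsubmx x) * phi x) = 0.
Proof.
move=> La Lf eqf phi tphi.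
pose K (x : 'rV[R]_(m + k)) := dot (tail_vec a x) (grad phi x) + f (rsubmx x) * phi x.
have K0 x : ~ D x -> K x = 0.
  move=> Dx; rewrite /K (test_function_eq0 tphi Dx) mulr0 addr0.
  rewrite (_ : grad phi x = 0); last first.
    by apply/rowP => i; rewrite !mxE (partial_test_eq0 i tphi Dx).
  by rewrite /dot big1// => i _; rewrite [X in _ * X]mxE mulr0.
have iP n' (E : set 'rV[R]_n') (b h : 'rV[R]_n' -> 'rV[R]_n') (e w : 'rV[R]_n' -> R) :
    measurable E -> in_Lp_vec E q b -> in_Lp E q e -> in_Lp_vec E p h -> in_Lp E p w ->
    (lebesgue_rV n').-integrable E (EFin \o (fun x => dot (b x) (h x) + e x * w x)).
  move=> mE Lb Le Lh Lw.
  have i2 : (lebesgue_rV n').-integrable E (EFin \o (fun x => e x * w x)).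
    have := integrable_hoelder mE p0 q0 pq Lw Le.
    by congr (_.-integrable _ _); apply/funext => x /=; rewrite mulrC.
  by have := integrableD mE (integrable_dot mE p1 q1 pq Lb Lh) i2; exact: eq_integrable.
have iext n' (E : set 'rV[R]_n') (g : 'rV[R]_n' -> R) : measurable E ->
    (forall x, ~ E x -> g x = 0) ->
    (lebesgue_rV n').-integrable E (EFin \o g) ->
    (lebesgue_rV n').-integrable setT (EFin \o g).
  move=> mE gE /(integrable_mkcond _ mE); apply: eq_integrable => // x _.
  by rewrite patchE; case: ifPn => // /negP; rewrite inE => /gE /= ->.
rewrite -/K Rintegral_restrict//.
have [Lphi Lgphi] := test_in_Lp mD Doo (ltW p1) tphi.
have iK : (lebesgue_rV (m + k)).-integrable setT (EFin \o K).
  apply: (iext _ _ _ mD K0); apply: iP => //.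
    exact: (in_Lp_vec_tail mD m2 DM q0 La).
  exact: (in_Lp_tail mD m2 DM q0 Lf).
rewrite /Rintegral (integral_slices_eq0 iK)// => x1.
pose psi (y : 'rV[R]_k) := phi (row_mx x1 y).
have tpsi : test_function omega2 psi by exact: test_function_slice.
pose K2 (y : 'rV[R]_k) := dot (a y) (grad psi y) + f y * psi y.
have KE y : K (row_mx x1 y) = K2 y.
  rewrite /K /K2 /tail_vec row_mxKr dot_split row_mxKl row_mxKr grad_slice.
  by rewrite [X in X + _ + _]big1 ?add0r// => i _; rewrite mxE mul0r.
under eq_integral do rewrite KE.
have K20 y : ~ omega2 y -> K2 y = 0.
  move=> Dy; rewrite /K2 (test_function_eq0 tpsi Dy) mulr0 addr0.
  rewrite (_ : grad psi y = 0); last first.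
    by apply/rowP => i; rewrite !mxE (partial_test_eq0 i tpsi Dy).
  by rewrite /dot big1// => i _; rewrite [X in _ * X]mxE mulr0.
have [Lpsi Lgpsi] := test_in_Lp m2 oo2 (ltW p1) tpsi.
have iK2 : (lebesgue_rV k).-integrable setT (EFin \o K2).
  by apply: (iext _ _ _ m2 K20); exact: iP.
have := eqf psi tpsi; rewrite -/K2 Rintegral_restrict// /Rintegral => h.
(* [Rintegral] is a [fine] part, which is 0 also at infinity; integrability turns its vanishing into
   that of the extended integral. *)
by rewrite -[LHS]fineK ?h//; exact: integrable_fin_num.
Qed.

End tail_equation.

(** * Energy decay *)

Section energy.
Context {R : realType} {m k : nat} {p c1 theta1 theta2 : R}.
Context {F : 'rV[R]_m -> R} {G : 'rV[R]_k -> R}.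
Hypotheses (p2 : 2 <= p) (hc1 : 0 < c1) (th2 : 0 < theta2).
Hypotheses (hF : integrand p c1 theta1 theta2 F) (hG : integrand p c1 theta1 theta2 G).
Local Notation H := (Htilde p F G).
Local Notation q := (p / (p - 1)).
Local Notation mu := (lebesgue_rV (m + k)).
Variables (D : set 'rV[R]_(m + k)) (omega2 : set 'rV[R]_k) (M M2 : R).
Hypotheses (mD : measurable D) (m2 : measurable omega2).
Hypotheses (Doo : (mu D < +oo)%E) (oo2 : (lebesgue_rV k omega2 < +oo)%E).
Hypothesis DM : forall x, D x -> box M (lsubmx x) /\ omega2 (rsubmx x).
Hypotheses (M20 : 0 <= M2) (omega2M : omega2 `<=` box M2).
Variable (j0 : 'I_k).
Variables (f w : 'rV[R]_k -> R) (Dw : 'rV[R]_k -> 'rV[R]_k).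
Hypotheses (Lf : in_Lp omega2 q f) (hw : W1p0 omega2 p w Dw).
Hypothesis eqw : forall psi Dpsi, W1p0 omega2 p psi Dpsi ->
  \int[lebesgue_rV k]_(y in omega2) dot (flux2 p H (Dw y)) (Dpsi y) =
  \int[lebesgue_rV k]_(y in omega2) (f y * psi y).
Variables (u : 'rV[R]_(m + k) -> R) (Du : 'rV[R]_(m + k) -> 'rV[R]_(m + k)).
Hypothesis hu : W1p0 D p u Du.
Hypothesis equ : forall phi Dphi, W1p0 D p phi Dphi ->
  \int[mu]_(x in D) dot (flux p H (Du x)) (Dphi x) =
  \int[mu]_(x in D) (f (rsubmx x) * phi x).

Let p1 : 1 < p. Proof. by move: p2; lra. Qed.
Let p0 : 0 < p. Proof. by move: p2; lra. Qed.
Let q1 : 1 <= q. Proof. by have [] := conjugate_exponent p2. Qed.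
Let q0 : 0 < q. Proof. exact: lt_le_trans q1. Qed.
Let pq : p^-1 + q^-1 = 1. Proof. by have [] := conjugate_exponent p2. Qed.

Let LDu : in_Lp_vec D p Du. Proof. by case: hu => -[]. Qed.
Let LDw : in_Lp_vec omega2 p Dw. Proof. by case: hw => -[]. Qed.

Definition err x := u x - w (rsubmx x).
Definition Derr x := Du x - tail_vec Dw x.
Definition flux_diff x := flux p H (Du x) - flux p H (tail_vec Dw x).

Lemma flux_tail_vec x :
  flux p H (tail_vec Dw x) = tail_vec (fun y => flux p G (Dw y)) x :> 'rV[R]_(m + k).
Proof.
by rewrite (flux_Htilde p2 hF hG) /tail_vec row_mxKl row_mxKr (flux0 p2 hF).
Qed.

Lemma Lq_flux_Dw : in_Lp_vec omega2 q (fun y => flux p G (Dw y)).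
Proof.
have [mDw _] := LDw; have [mf [mef Lff]] := in_Lq_flux m2 p2 th2 hG mDw (in_Lp_enorm LDw).
by split.
Qed.

Lemma Lq_flux_Du : in_Lp_vec D q (fun x => flux p H (Du x)).
Proof.
have [mDu _] := LDu; have LeDu := in_Lp_enorm LDu.
have ml : measurable_fun D (fun x => lsubmx (Du x)).
  exact: (measurableT_comp (@measurable_lsubmx R m k) mDu).
have mr : measurable_fun D (fun x => rsubmx (Du x)).
  exact: (measurableT_comp (@measurable_rsubmx R k m) mDu).
have Ll : in_Lp D p (enorm \o (fun x => lsubmx (Du x))).
  apply: (in_Lp_le mD (ltW p1) _ _ LeDu); first exact: measurable_fun_enorm.
  by move=> x _; rewrite /= !norm_enorm enorm_lsubmx_le.
have Lr : in_Lp D p (enorm \o (fun x => rsubmx (Du x))).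
  apply: (in_Lp_le mD (ltW p1) _ _ LeDu); first exact: measurable_fun_enorm.
  by move=> x _; rewrite /= !norm_enorm enorm_rsubmx_le.
have [mfl Lfl] := in_Lq_flux mD p2 th2 hF ml Ll.
have [mfr Lfr] := in_Lq_flux mD p2 th2 hG mr Lr.
apply: (in_Lp_vec_le mD q1 _ _ (in_LpD mD q1 Lfl Lfr)).
  apply: measurable_fun_rV_on => i; case: (split_ordP i) => j ->.
    under eq_fun do rewrite (flux_Htilde p2 hF hG) row_mxEl.
    exact: measurable_fun_coord.
  under eq_fun do rewrite (flux_Htilde p2 hF hG) row_mxEr.
  exact: measurable_fun_coord.
move=> x _; have := enorm_split_le (flux p H (Du x)).
by rewrite (flux_Htilde p2 hF hG) row_mxKl row_mxKr.
Qed.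

Let LfN : in_Lp omega2 q (fun y => -1 * f y).
Proof. exact: in_LpZ. Qed.

(** For a test function this is [tail_equation] fed with the equation of w; elements of W^{1,p}_0
    follow by passage to the limit. The source enters as -f so that the right side is 0. *)
Lemma tail_weak_equation phi Dphi : W1p0 D p phi Dphi ->
  \int[mu]_(x in D) (dot (flux p H (tail_vec Dw x)) (Dphi x) +
    (-1 * f (rsubmx x)) * phi x) = 0.
Proof.
move=> /(W1p0_approx mD Doo p1)[phi_ Aphi tphi].
under eq_Rintegral do rewrite flux_tail_vec.
apply: (approx_pairing_eq0 mD p1 q1 pq Aphi).
- exact: (in_Lp_vec_tail mD m2 DM q0 Lq_flux_Dw).
- exact: (in_Lp_tail mD m2 DM q0 LfN).
move=> i; apply: (tail_equation mD m2 Doo oo2 p1 q1 pq DM Lq_flux_Dw LfN _ (tphi i)).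
move=> psi tpsi; have Wpsi := W1p0_test m2 oo2 p1 q1 pq tpsi.
have [[Lpsi Lgpsi _] _] := Wpsi.
have i1 := integrable_dot m2 p1 q1 pq Lq_flux_Dw Lgpsi.
have i2 : (lebesgue_rV k).-integrable omega2 (EFin \o (fun y => f y * psi y)).
  have := integrable_hoelder m2 p0 q0 pq Lpsi Lf.
  by congr (_.-integrable _ _); apply/funext => x /=; rewrite mulrC.
have i3 : (lebesgue_rV k).-integrable omega2 (EFin \o (fun y => -1 * f y * psi y)).
  have := integrableZl m2 (-1) i2; apply: eq_integrable => // y _ /=.
  by rewrite -EFinM mulrA.
rewrite RintegralD//.
have -> : \int[lebesgue_rV k]_(y in omega2) (-1 * f y * psi y) =
    - \int[lebesgue_rV k]_(y in omega2) (f y * psi y).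
  rewrite -[RHS]mulN1r -RintegralZl//; apply: eq_Rintegral => y _.
  by rewrite mulrA.
have := eqw Wpsi; under eq_Rintegral do rewrite (flux2_Htilde p2 hF hG).
by move=> ->; rewrite subrr.
Qed.

Lemma Lq_flux_tail : in_Lp_vec D q (fun x => flux p H (tail_vec Dw x)).
Proof.
have := in_Lp_vec_tail mD m2 DM q0 Lq_flux_Dw.
by congr (in_Lp_vec _ _ _); apply/funext => x; rewrite flux_tail_vec.
Qed.

Lemma difference_equation phi Dphi : W1p0 D p phi Dphi ->
  \int[mu]_(x in D) dot (flux_diff x) (Dphi x) = 0.
Proof.
move=> Wphi; have := tail_weak_equation Wphi; have := equ Wphi.
have [[Lphi LDphi _] _] := Wphi.
have Lt := Lq_flux_tail.
have i1 := integrable_dot mD p1 q1 pq Lq_flux_Du LDphi.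
have i2 := integrable_dot mD p1 q1 pq Lt LDphi.
have i3 : mu.-integrable D (EFin \o (fun x => f (rsubmx x) * phi x)).
  have := integrable_hoelder mD p0 q0 pq Lphi (in_Lp_tail mD m2 DM q0 Lf).
  by congr (_.-integrable _ _); apply/funext => x /=; rewrite mulrC.
have i4 : mu.-integrable D (EFin \o (fun x => -1 * f (rsubmx x) * phi x)).
  have := integrableZl mD (-1) i3; apply: eq_integrable => // y _ /=.
  by rewrite -EFinM mulrA.
rewrite RintegralD//.
have -> : \int[mu]_(x in D) (-1 * f (rsubmx x) * phi x) =
    - \int[mu]_(x in D) (f (rsubmx x) * phi x).
  rewrite -[RHS]mulN1r -RintegralZl//; apply: eq_Rintegral => y _.
  by rewrite mulrA.
have eqd : \int[mu]_(x in D) dot (flux_diff x) (Dphi x) =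
    \int[mu]_(x in D) dot (flux p H (Du x)) (Dphi x) -
    \int[mu]_(x in D) dot (flux p H (tail_vec Dw x)) (Dphi x).
  rewrite -(RintegralB mD i1 i2); apply: eq_Rintegral => x _.
  by rewrite /flux_diff dotBl.
move=> e1 /eqP; rewrite subr_eq0 => /eqP e2.
by apply: (etrans eqd); apply/eqP; rewrite subr_eq0; apply/eqP; exact: (etrans e1 (esym e2)).
Qed.

(* [phi_ i - psi_ i \o rsubmx] no longer vanishes near the lateral faces of the
   cylinder, but its support still projects onto a compact subset of [omega2]: a
   cutoff in the first variables makes it a test function. *)
Lemma err_approx : exists v_ : nat -> 'rV[R]_(m + k) -> R, exists K_ : nat -> set 'rV[R]_k,
  smooth_approx D p err Derr v_ /\
  forall i, [/\ compact (K_ i), K_ i `<=` omega2 &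
    forall x, ~ K_ i (rsubmx x) -> v_ i x = 0].
Proof.
have [phi_ Aphi tphi] := W1p0_approx mD Doo p1 hu.
have [psi_ Apsi tpsi] := W1p0_approx m2 oo2 p1 hw.
have Atl := approx_tail mD m2 (ltW p1) DM Apsi.
have KP i : {K | [/\ compact K, K `<=` omega2 &
    forall x, ~ K (rsubmx x) -> phi_ i x - psi_ i (rsubmx x) = 0]}.
  apply: cid; have [K [cK _ KD K0]] := test_functionP (tphi i).
  have [K' [cK' _ K'o K'0]] := test_functionP (tpsi i).
  exists ((rsubmx @` K) `|` K'); split.
  - apply: compactU => //; apply: continuous_compact cK.
    by apply: continuous_subspaceT; exact: continuous_rsubmx.
  - by move=> y [[x /KD/DM[_ x2] <-]|/K'o].
  move=> x /not_orP[xK xK']; rewrite K0 ?K'0 ?subrr// => Kx.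
  by apply: xK; exists x.
exists (fun i x => phi_ i x - psi_ i (rsubmx x)), (fun i => projT1 (KP i)).
split; last by move=> i; exact: projT2 (KP i).
exact: (approxB mD p1 Aphi Atl).
Qed.

Lemma LDerr : in_Lp_vec D p Derr /\ in_Lp D p err.
Proof.
have [v_ [K_ [Av _]]] := err_approx.
by split; [exact: approx_Lp_vec Av|exact: approx_Lp Av].
Qed.

Lemma W1p_err : W1p D p err Derr.
Proof. by have [v_ [K_ [Av _]]] := err_approx; exact: (approx_W1p mD Doo p1 q1 pq Av). Qed.

Section cutoffs.
Variables (z : 'rV[R]_m) (s L : R).
Hypothesis L0 : 0 < L.
Hypothesis zD : forall x, cube z (s + L) x -> omega2 (rsubmx x) -> D x.
Local Notation rho := (@cutoff R m k z s L).

(** The approximants rho v_i vanish outside the cube of half-width s + L times a compact subset of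
    omega2. By [zD] this compact set lies in [D], so they are test functions. *)
Lemma W1p0_cutoff_err : W1p0 D p (fun x => rho x * err x)
  (fun x => rho x *: Derr x + err x *: grad rho x).
Proof.
have [v_ [K_ [Av vK]]] := err_approx.
have B0 : 0 <= 1 + m%:R * (4 / L) by rewrite addr_ge0// mulr_ge0// divr_ge0// ltW.
have rhoB x : `|rho x| <= 1 + m%:R * (4 / L) /\ enorm (grad rho x) <= 1 + m%:R * (4 / L).
  split; last by apply: ler_wpDl => //; exact: enorm_grad_cutoff.
  rewrite ger0_norm ?cutoff_ge0//; apply: ler_wpDr; last exact: cutoff_le1.
  by rewrite mulr_ge0// divr_ge0// ltW.
have srho := @smooth_cutoff R m k z s L.
apply: (approx_W1p0 mD Doo p1 q1 pq (approxM mD p1 B0 srho rhoB Av)) => i.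
have [cK Ko K0] := vK i.
apply: (mk_test_function (smoothM srho (approx_smooth Av i))
  (compact_cube_tail (z := z) (s := s + L) cK)).
  by move=> x [xz /Ko x2]; exact: zD.
move=> x xK; have [xz|xz] := pselect (cube z (s + L) x); last first.
  by rewrite cutoff_eq0// mul0r.
by rewrite K0 ?mulr0// => xK'; exact: xK.
Qed.

End cutoffs.

(** The cube is an indicator in the integrand, not the domain of integration, so that all energies
    are integrals over [D] and can be compared pointwise. *)
Definition local_energy (z : 'rV[R]_m) (s : R) : R :=
  \int[mu]_(x in D) (\1_(cube z s) x * enorm (Derr x) `^ p).

Lemma integrable_energy : mu.-integrable D (EFin \o (fun x => enorm (Derr x) `^ p)).
Proof.
have [Lg _] := LDerr; have [mg goo] := in_Lp_enorm Lg.
have /(LpN_ltyP p0 mg) := goo.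
by congr (_.-integrable _ _); apply/funext => x /=; rewrite norm_enorm.
Qed.

Lemma integrable_local_energy z s : mu.-integrable D
  (EFin \o (fun x => \1_(cube z s) x * enorm (Derr x) `^ p)).
Proof.
apply: le_integrable integrable_energy => //.
  have /integrableP[/measurable_EFinP me _] := integrable_energy.
  apply/measurable_EFinP; apply: measurable_funM => //.
  by apply: measurable_funTS; apply: measurable_indic; exact: cube_measurable.
move=> x _ /=; rewrite lee_fin normrM ler_piMl// indicE.
by case: (_ \in _); rewrite ?normr1 ?normr0.
Qed.

Lemma local_energy_ge0 z s : 0 <= local_energy z s.
Proof. by apply: Rintegral_ge0 => x _; rewrite mulr_ge0 ?powR_ge0. Qed.

Lemma le_local_energy z s t : s <= t -> local_energy z s <= local_energy z t.
Proof.
move=> st; apply: le_Rintegral => //; do ?exact: integrable_local_energy.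
move=> x _; apply: ler_wpM2r; first exact: powR_ge0.
rewrite !indicE ler_nat; case: (boolP (x \in cube z s)) => // /set_mem xs.
by rewrite mem_set//; exact: cubeS xs.
Qed.

Lemma local_energy_le z s : local_energy z s <= \int[mu]_(x in D) enorm (Derr x) `^ p.
Proof.
apply: le_Rintegral => //; [exact: integrable_local_energy|exact: integrable_energy|].
by move=> x _; rewrite ler_piMl ?powR_ge0// indicE; case: (_ \in _).
Qed.

(** The extension of w has no gradient in X_1 and F has zero flux at 0, so no trace of w is left in
    this block. Hence the error term is controlled by a power of |Derr| alone. *)
Lemma lsubmx_flux_diff x : lsubmx (flux_diff x) = flux p F (lsubmx (Derr x)).
Proof.
rewrite /flux_diff !(flux_Htilde p2 hF hG) opp_row_mx add_row_mx row_mxKl.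
rewrite /Derr /tail_vec row_mxKl (flux0 p2 hF) subr0; congr (flux p F _).
by rewrite linearB/= row_mxKl subr0.
Qed.

Lemma flux_diff_monotone x :
  c1 / 2 `^ p * enorm (Derr x) `^ p <= dot (flux_diff x) (Derr x).
Proof. exact: (flux_Htilde_monotone p2 hF hG hc1). Qed.

Section decay.
Variables (z : 'rV[R]_m) (s L : R).
Hypothesis L0 : 0 < L.
Hypothesis zD : forall x, cube z (s + L + L) x -> omega2 (rsubmx x) -> D x.
Local Notation rho := (@cutoff R m k z s L).
Local Notation rho' := (@cutoff R m k z (s + L) L).
Local Notation kappa := (expR (- 1) ^+ (2 * m) : R).
Local Notation C4 := (m%:R * theta2 `^ p * (m%:R * 4)).

(** Only the X_1 block of grad rho is nonzero. In [C4 / L], the part m theta2^p comes from the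
    growth of the flux of F and 4 m / L from the slope of the cutoff. *)
Lemma dot_flux_diff_grad x :
  `|dot (flux_diff x) (grad rho x)| <= C4 / L * enorm (Derr x) `^ (p - 1).
Proof.
rewrite dot_split [X in _ + X](_ : _ = 0); last first.
  rewrite /dot big1// => j _.
  by rewrite [X in _ * X]mxE [X in _ * X]mxE partial_cutoff_rshift// mulr0.
rewrite addr0 lsubmx_flux_diff; apply: le_trans (cauchy_schwarz _ _) _.
have -> : C4 / L * enorm (Derr x) `^ (p - 1) =
  (m%:R * theta2 `^ p * enorm (Derr x) `^ (p - 1)) * (m%:R * (4 / L)) by ring.
apply: ler_pM; rewrite ?enorm_ge0//.
  apply: le_trans (enorm_flux_le p2 th2 hF _) _.
  apply: ler_wpM2l; first by rewrite mulr_ge0 ?powR_ge0.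
  apply: ge0_ler_powR; rewrite ?nnegrE ?enorm_ge0 ?enorm_lsubmx_le//.
  by move: p2; lra.
apply: le_trans (enorm_lsubmx_le _) _.
exact: enorm_grad_cutoff.
Qed.

(** The main term uses rho >= kappa on the inner cube. The error term lives in the cube of
    half-width s + L, where rho' >= kappa gives |err| <= kappa^(-1) |rho' err|; Poincare applies to
    rho' err, not to err. *)
Lemma energy_pointwise x :
  c1 / 2 `^ p * kappa * (\1_(cube z s) x * enorm (Derr x) `^ p) -
  C4 / L * (\1_(cube z (s + L)) x * enorm (Derr x) `^ p +
    kappa^-1 `^ p * `|rho' x * err x| `^ p) <=
  dot (flux_diff x) (rho x *: Derr x + err x *: grad rho x).
Proof.
rewrite dotDr !dotZr.
set e := enorm (Derr x) `^ p; set c := c1 / 2 `^ p.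
have e0 : 0 <= e by exact: powR_ge0.
have c0 : 0 < c by rewrite divr_gt0// powR_gt0.
have k0 : 0 < kappa by rewrite exprn_gt0// expR_gt0.
have C40 : 0 <= C4 / L.
  by rewrite divr_ge0 ?(ltW L0)//; rewrite !mulr_ge0// powR_ge0.
apply: lerD.
  (* Outside the inner cube it is enough that the main term is nonnegative, by monotonicity. *)
  rewrite indicE; case: (boolP (x \in cube z s)) => [/set_mem xs|_]; last first.
    rewrite mul0r mulr0 mulr_ge0 ?cutoff_ge0//.
    by apply: le_trans (flux_diff_monotone x); rewrite mulr_ge0// ltW.
  rewrite mul1r mulrAC mulrC; apply: ler_pM.
  - exact: ltW.
  - by rewrite mulr_ge0// ltW.
  - exact: (cutoff_lbound L0 xs).
  - exact: flux_diff_monotone.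
have [xs|xs] := pselect (cube z (s + L) x); last first.
  have -> : grad rho x = 0.
    have rho0 y : ~ cube z (s + L) y -> rho y = 0 by exact: (cutoff_eq0 L0).
    apply/rowP => i; rewrite !mxE.
    exact: (partial_eq0 i (@cube_closed R m k z (s + L)) rho0 xs).
  rewrite [X in err x * X](_ : _ = 0); last first.
    by rewrite /dot big1// => i _; rewrite [X in _ * X]mxE mulr0.
  rewrite mulr0 oppr_le0 mulr_ge0// addr_ge0// ?mulr_ge0 ?powR_ge0//.
rewrite indicE mem_set// mul1r lerNl -mulrN.
apply: le_trans (ler_norm _) _; rewrite normrM normrN.
apply: le_trans (ler_wpM2l (normr_ge0 _) (dot_flux_diff_grad x)) _.
rewrite mulrCA; apply: ler_wpM2l => //; rewrite mulrC.
have b0 : 0 <= kappa^-1 * `|rho' x * err x| by rewrite mulr_ge0// invr_ge0 ltW.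
rewrite -powRM ?invr_ge0 ?(ltW k0)//.
(* Here a = |Derr| and b = kappa^(-1) |rho' err|. No small coefficient is sought: smallness will
   come from 1/L. *)
apply: le_trans (powR_mul_le_add p2 (enorm_ge0 _) b0).
apply: ler_wpM2l; first exact: powR_ge0.
rewrite normrM mulrA ler_peMl//.
rewrite -ler_pdivrMl ?invr_gt0// invrK mulr1.
apply: le_trans (ler_norm _).
exact: (cutoff_lbound L0 xs).
Qed.

Lemma integrable_cutoff_err :
  mu.-integrable D (EFin \o (fun x => `|rho' x * err x| `^ p)).
Proof.
by have [[[mr roo] _ _] _] := W1p0_cutoff_err L0 zD; exact/(LpN_ltyP p0 mr).
Qed.

(** In an X_2 direction rho' has zero derivative, so that of rho' err is rho' times a component of
    [Derr], hence at most |Derr| and supported in the cube of half-width s + 2 L. *)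
Lemma integral_cutoff_err_le :
  \int[mu]_(x in D) (`|rho' x * err x| `^ p) <=
  poincare_const p M2 `^ p * local_energy z (s + L + L).
Proof.
have W := W1p0_cutoff_err L0 zD.
have DM2 x : D x -> `|x ord0 (rshift m j0)| <= M2.
  by move=> /DM[_ /omega2M/(_ j0)]; rewrite mxE.
have P0 : 0 <= poincare_const p M2 by exact: powR_ge0.
have := poincare_W1p0 mD Doo p2 M20 DM2 W.
have -> : (fun x => (rho' x *: Derr x + err x *: grad rho' x) ord0 (rshift m j0)) =
    (fun x => rho' x * Derr x ord0 (rshift m j0)).
  apply/funext => x; rewrite mxE [X in X + _]mxE [X in _ + X]mxE.
  by rewrite [grad _ _ _ _]mxE partial_cutoff_rshift// mulr0 addr0.
set X := LpN D p _; set Y := LpN D p _ => XY.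
have X0 : (0 <= X)%E by exact: LpN_ge0.
have Y0 : (0 <= Y)%E by exact: LpN_ge0.
have : (X `^ p <= ((poincare_const p M2)%:E * Y) `^ p)%E.
  apply: gt0_ler_poweR => //; first exact: ltW.
    by rewrite in_itv/= leey andbT.
  by rewrite in_itv/= leey andbT mule_ge0.
rewrite poweRM// {XY X0 Y0}/X {}/Y !LpN_powE// poweR_EFin => h.
have i1 := integrable_cutoff_err.
have i2 := integrable_local_energy z (s + L + L).
have : (\int[mu]_(x in D) (`|rho' x * err x| `^ p)%:E <=
   (poincare_const p M2 `^ p)%:E *
   \int[mu]_(x in D) (\1_(cube z (s + L + L)) x * enorm (Derr x) `^ p)%:E)%E.
  apply: le_trans h _; apply: lee_wpmul2l; first by rewrite lee_fin powR_ge0.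
  have [mD' _] := LDerr.1.
  apply: ge0_le_integral => //.
  - apply: measurable_normpow.
    apply: measurable_funM; last exact: measurable_fun_coord.
    apply: measurable_funTS; apply: continuous_measurable_rV.
    exact: (smooth_continuous (smooth_cutoff z (s + L) L)).
  - by case/integrableP: i2.
  move=> x _; rewrite lee_fin; have [xs|xs] := pselect (cube z (s + L + L) x); last first.
    by rewrite cutoff_eq0// mul0r normr0 powR0 ?gt_eqF// mulr_ge0 ?powR_ge0.
  rewrite indicE mem_set// mul1r; apply: ge0_ler_powR; rewrite ?nnegrE ?enorm_ge0 ?(ltW p0)//.
  apply: le_trans (norm_coord_le_enorm _ (rshift m j0)).
  by rewrite normrM ler_piMl// ger0_norm ?cutoff_ge0// cutoff_le1.
rewrite -[leLHS]fineK; last exact: (integrable_fin_num mD i1).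
rewrite -[X in (_ <= _ * X)%E]fineK; last exact: (integrable_fin_num mD i2).
by rewrite -EFinM lee_fin.
Qed.

(* Absorbing the errors [err] through the Poincare inequality forces the widths
   to grow by [2 * L]: once for [grad rho], once for [rho']. *)
Lemma energy_decay :
  c1 / 2 `^ p * kappa * local_energy z s <=
  C4 / L * (1 + kappa^-1 `^ p * poincare_const p M2 `^ p) * local_energy z (s + L + L).
Proof.
have zD' x : cube z (s + L) x -> omega2 (rsubmx x) -> D x.
  by move=> xs; apply: zD; apply: cubeS xs; rewrite lerDl ltW.
have W := W1p0_cutoff_err L0 zD'.
have Lq : in_Lp_vec D q flux_diff.
  exact: (in_Lp_vecB mD q1 Lq_flux_Du Lq_flux_tail).
have [[_ LW _] _] := W.
have iR := integrable_dot mD p1 q1 pq Lq LW.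
have ia := integrable_local_energy z s.
have ib := integrable_local_energy z (s + L).
have ic := integrable_cutoff_err.
have ia' := integrableZl mD (c1 / 2 `^ p * kappa) ia.
have ic' := integrableZl mD (kappa^-1 `^ p) ic.
have ibc := integrableD mD ib ic'.
have ibc' := integrableZl mD (C4 / L) ibc.
have iL := integrableB mD ia' ibc'.
have := le_Rintegral mD iL iR (fun x _ => energy_pointwise x).
rewrite (difference_equation W).
rewrite (RintegralB mD ia' ibc') (RintegralZl _ mD ia) (RintegralZl _ mD ibc).
rewrite (RintegralD mD ib ic') (RintegralZl _ mD ic).
rewrite -/(local_energy z s) -/(local_energy z (s + L)) subr_le0 => h.
apply: le_trans h _; rewrite -[leRHS]mulrA; apply: ler_wpM2l.
  by rewrite divr_ge0 ?(ltW L0)//; rewrite !mulr_ge0// powR_ge0.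
rewrite mulrDl mul1r; apply: lerD; first by apply: le_local_energy; rewrite lerDl ltW.
rewrite -[leRHS]mulrA; apply: ler_wpM2l; first exact: powR_ge0.
exact: integral_cutoff_err_le.
Qed.

End decay.

Local Notation kappa := (expR (- 1) ^+ (2 * m) : R).

(* Chosen so that the constant of [energy_decay] is at most [expR (- 1)]. *)
Definition decay_length : R :=
  expR 1 * (m%:R * theta2 `^ p * (m%:R * 4) *
    (1 + kappa^-1 `^ p * poincare_const p M2 `^ p)) / (c1 / 2 `^ p * kappa) + 1.

Lemma decay_length_gt0 : 0 < decay_length.
Proof.
rewrite ltr_wpDl// divr_ge0//.
  apply: mulr_ge0; first exact: expR_ge0.
  rewrite !mulr_ge0 ?powR_ge0// addr_ge0// mulr_ge0 ?powR_ge0//.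
by rewrite mulr_ge0// ?exprn_ge0 ?expR_ge0// divr_ge0 ?powR_ge0// ltW.
Qed.

(** Each step widens the cube by 2 [decay_length] and gains e^(-1). The half-width s is general in
    the induction, and the inclusion in [D] is stated for the largest cube. *)
Lemma energy_decay_iter (z : 'rV[R]_m) (j : nat) (s : R) :
  (forall x, cube z (s + 2 * decay_length * j%:R) x -> omega2 (rsubmx x) -> D x) ->
  local_energy z s <= expR (- j%:R) * local_energy z (s + 2 * decay_length * j%:R).
Proof.
have L0 := decay_length_gt0.
elim: j s => [|j IHj] s zD; first by rewrite oppr0 expR0 mul1r mulr0 addr0.
have eqs : s + decay_length + decay_length + 2 * decay_length * j%:R =
    s + 2 * decay_length * j.+1%:R by rewrite -[j.+1]addn1 natrD; ring.
have zD' x : cube z (s + decay_length + decay_length) x -> omega2 (rsubmx x) -> D x.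
  move=> xs; apply: zD; apply: cubeS xs.
  by rewrite -eqs lerDl !mulr_ge0// ltW.
have h1 : local_energy z s <=
    expR (- 1) * local_energy z (s + decay_length + decay_length).
  have := energy_decay L0 zD'; set a := c1 / _ * _; set b := m%:R * _ * _.
  set d := 1 + _; set E := local_energy z _; set E' := local_energy z _ => h.
  have a0 : 0 < a.
    by rewrite mulr_gt0 ?exprn_gt0 ?expR_gt0// divr_gt0 ?powR_gt0.
  have E'0 : 0 <= E' by exact: local_energy_ge0.
  (* Equivalent to e b d <= a [decay_length], the inequality that dictates the formula for
     [decay_length]. *)
  have bd : b * d <= expR (- 1) * (a * decay_length).
    rewrite expRN ler_pdivlMl ?expR_gt0// /decay_length -/a -/b -/d.
    have -> : a * (expR 1 * (b * d) / a + 1) = expR 1 * (b * d) + a.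
      by field; rewrite gt_eqF.
    by rewrite lerDl ltW.
  have bd' : b / decay_length * d <= expR (- 1) * a.
    by rewrite mulrAC ler_pdivrMr// -[leRHS]mulrA.
  rewrite -(ler_pM2l a0); apply: le_trans h _; rewrite [leRHS]mulrA [a * _]mulrC.
  exact (ler_wpM2r E'0 bd').
have -> : expR (- j.+1%:R) = expR (- 1) * expR (- j%:R) :> R.
  by rewrite -natr1 opprD expRD mulrC.
apply: le_trans h1 _; rewrite -[leRHS]mulrA; apply: ler_wpM2l; first exact: expR_ge0.
rewrite -eqs; apply: IHj => x; rewrite eqs; exact: zD.
Qed.

(** On [D'] the indicators of the cubes add up to at least 1. *)
Lemma energy_cover (D' : set 'rV[R]_(m + k)) (h : 'rV[R]_m -> 'rV[R]_m) (s : R)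
    (ys : seq 'rV[R]_m) : measurable D' -> D' `<=` D ->
  (forall x, D' x -> exists2 y, y \in ys & cube (h y) s x) ->
  \int[mu]_(x in D') (enorm (Derr x) `^ p) <= \sum_(y <- ys) local_energy (h y) s.
Proof.
move=> mD' D'D cov.
pose S (r : seq 'rV[R]_m) x := \sum_(y <- r) \1_(cube (h y) s) x * enorm (Derr x) `^ p.
have intS r : mu.-integrable D (EFin \o S r) /\
    \int[mu]_(x in D) S r x = \sum_(y <- r) local_energy (h y) s.
  elim: r => [|y r [IH1 IH2]].
    have S0 : S [::] = cst 0 by apply/funext => x; rewrite /S big_nil.
    rewrite S0 big_nil; split; first by have := integrable0 mu D; exact: eq_integrable.
    by rewrite /Rintegral integral0_eq.
  have SE : S (y :: r) = fun x => \1_(cube (h y) s) x * enorm (Derr x) `^ p + S r x.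
    by apply/funext => x; rewrite /S big_cons.
  have iy := integrable_local_energy (h y) s.
  rewrite SE big_cons (RintegralD mD iy IH1) IH2; split=> //.
  by have := integrableD mD iy IH1; exact: eq_integrable.
have [iS <-] := intS ys.
have S_ge0 x : 0 <= S ys x by apply: sumr_ge0 => y _; rewrite mulr_ge0 ?powR_ge0.
have ie := integrableS mD mD' D'D integrable_energy.
rewrite (Rintegral_mkcond _ D') (Rintegral_mkcond _ D); apply: le_Rintegral => //.
- by have := (integrable_mkcond _ mD').1 ie; rewrite -restrict_EFin.
- by have := (integrable_mkcond _ mD).1 iS; rewrite -restrict_EFin.
move=> x _; rewrite !patchE.
case: ifPn => [/set_mem D'x|_]; last by case: ifP.
rewrite (mem_set (D'D x D'x)); have [y yys xy] := cov x D'x.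
rewrite /S (big_rem y)//= indicE mem_set// mul1r lerDl.
by apply: sumr_ge0 => y' _; rewrite mulr_ge0 ?powR_ge0.
Qed.

Local Notation Nf := (fine (LpN omega2 q f)).
Local Notation Nw := (fine (LpN omega2 p (enorm \o Dw))).
Local Notation V := ((2 * Num.max M 0) ^+ m).

(** The equation is tested with u itself: monotonicity against 0 bounds the left side below by c
    X^p, while Hoelder and Poincare bound the right side by a multiple of X. The dependence on l
    sits entirely in the volume factor V. *)
Lemma enorm_Du_le : (LpN D p (enorm \o Du) <=
  (V `^ p^-1 * (poincare_const p M2 * Nf / (c1 / 2 `^ p)) `^ (p - 1)^-1)%:E)%E.
Proof.
have LeDu := in_Lp_enorm LDu; have [[Lu _ _] _] := hu.
set c := c1 / 2 `^ p; have c0 : 0 < c by rewrite divr_gt0// powR_gt0.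
set P := poincare_const p M2; have P0 : 0 <= P by exact: powR_ge0.
have V0 : 0 <= V by rewrite exprn_ge0// mulr_ge0// le_max lexx orbT.
have Nf0 : 0 <= Nf by apply: fine_ge0; exact: LpN_ge0.
have [mEDu Eoo] := LeDu.
have xE : LpN D p (enorm \o Du) = (fine (LpN D p (enorm \o Du)))%:E.
  by rewrite fineK// ge0_fin_numE ?LpN_ge0.
set X := fine (LpN D p (enorm \o Du)) in xE *.
have X0 : 0 <= X by apply: fine_ge0; exact: LpN_ge0.
have iDu : mu.-integrable D (EFin \o (fun x => enorm (Du x) `^ p)).
  have /(LpN_ltyP p0 mEDu) := Eoo.
  by congr (_.-integrable _ _); apply/funext => x /=; rewrite norm_enorm.
have XE : \int[mu]_(x in D) (enorm (Du x) `^ p) = X `^ p.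
  rewrite /Rintegral; have := LpN_powE D p0 (enorm \o Du); rewrite xE poweR_EFin.
  move=> /(congr1 fine) /= ->; congr fine; apply: eq_integral => x _.
  by rewrite /= norm_enorm.
have coer : c * X `^ p <= \int[mu]_(x in D) (f (rsubmx x) * u x).
  rewrite -(equ hu) -XE -(RintegralZl _ mD iDu); apply: le_Rintegral => //.
  - by have := integrableZl mD c iDu; exact: eq_integrable.
  - exact: (integrable_dot mD p1 q1 pq Lq_flux_Du LDu).
  move=> x _; have := flux_Htilde_monotone p2 hF hG hc1 (Du x) 0.
  rewrite (_ : flux p H 0 = 0) ?subr0//.
  by rewrite (flux_Htilde p2 hF hG) !linear0 (flux0 p2 hF) (flux0 p2 hG) row_mx0.
have Lfr := in_Lp_tail mD m2 DM q0 Lf.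
have fu : \int[mu]_(x in D) (f (rsubmx x) * u x) <= (P * X) * (V `^ q^-1 * Nf).
  have i3 : mu.-integrable D (EFin \o (fun x => f (rsubmx x) * u x)).
    have := integrable_hoelder mD p0 q0 pq Lu Lfr.
    by congr (_.-integrable _ _); apply/funext => x /=; rewrite mulrC.
  rewrite -lee_fin fineK; last exact: (integrable_fin_num mD i3).
  apply: (@le_trans _ _ (\int[mu]_(x in D) `|u x * f (rsubmx x)|%:E)%E).
    apply: le_trans (lee_abs _) _; apply: le_trans (le_abse_integral _ mD _) _.
      by case/integrableP: i3.
    by under eq_integral do rewrite mulrC.
  have [mu_ _] := Lu; have [mfr _] := Lfr.
  apply: le_trans (hoelder_LpN mD p0 q0 pq mu_ mfr) _.
  rewrite EFinM; apply: lee_pmul; rewrite ?LpN_ge0//.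
    have DM2 x : D x -> `|x ord0 (rshift m j0)| <= M2.
      by move=> /DM[_ /omega2M/(_ j0)]; rewrite mxE.
    apply: le_trans (poincare_W1p0 mD Doo p2 M20 DM2 hu) _.
    rewrite EFinM -xE; apply: lee_wpmul2l => //.
    have [mDu _] := LDu.
    apply: (le_LpN mD p0) => //; first exact: measurable_fun_coord.
    by move=> x _; rewrite /= norm_enorm norm_coord_le_enorm.
  rewrite EFinM fineK; first by have [mf _] := Lf; exact (LpN_tail mD m2 DM q0 mf).
  by have [_ ?] := Lf; rewrite ge0_fin_numE ?LpN_ge0.
rewrite xE lee_fin; have [->|Xn0] := eqVneq X 0; first by rewrite mulr_ge0 ?powR_ge0.
have Xp : 0 < X by rewrite lt_neqAle eq_sym Xn0.
have pm1 : 0 < p - 1 by move: p2; lra.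
have XX : X `^ (p - 1) <= V `^ q^-1 * (P * Nf / c).
  have -> : V `^ q^-1 * (P * Nf / c) = (V `^ q^-1 * (P * Nf)) / c by rewrite mulrA.
  rewrite ler_pdivlMr// -(ler_pM2r Xp).
  have -> : X `^ (p - 1) * c * X = c * X `^ p.
    rewrite mulrAC mulrC -{2}[X](powRr1 X0) -powRD; last by rewrite Xn0 implybT.
    by rewrite subrK.
  apply: le_trans coer _; apply: le_trans fu _.
  by rewrite le_eqVlt; apply/orP; left; apply/eqP; ring.
have -> : X = (X `^ (p - 1)) `^ (p - 1)^-1 by rewrite -powRrM mulfV ?gt_eqF// powRr1.
(* Since q (p - 1) = p, the power 1/q of V brought by the norm of f becomes 1/p after taking the
   root. *)
have -> : V `^ p^-1 = (V `^ q^-1) `^ (p - 1)^-1.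
  by rewrite -powRrM; congr (_ `^ _); field; rewrite !gt_eqF.
rewrite -powRM ?powR_ge0//; last by rewrite divr_ge0 ?mulr_ge0// ltW.
apply: ge0_ler_powR; rewrite ?nnegrE ?powR_ge0 ?invr_ge0 ?(ltW pm1)//.
by rewrite mulr_ge0 ?powR_ge0// divr_ge0 ?mulr_ge0// ltW.
Qed.

(** What remains of the bounds on Du and Dw once V^(1/p) is taken out; the length of the cylinder
    does not occur in it. *)
Definition energy_const : R :=
  (poincare_const p M2 * Nf / (c1 / 2 `^ p)) `^ (p - 1)^-1 + Nw.

Lemma energy_const_ge0 : 0 <= energy_const.
Proof. by rewrite addr_ge0 ?powR_ge0// fine_ge0// LpN_ge0. Qed.

Lemma energy_bound :
  \int[mu]_(x in D) (enorm (Derr x) `^ p) <= V * energy_const `^ p.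
Proof.
have V0 : 0 <= V by rewrite exprn_ge0// mulr_ge0// le_max lexx orbT.
have [[mDe Eoo] _] := LDerr; have mEDe := measurable_fun_enorm mDe.
have K0 := energy_const_ge0.
have LDwoo : (LpN omega2 p (enorm \o Dw) < +oo)%E by case: LDw.
have [mDw _] := LDw; have mEDw := measurable_fun_enorm mDw.
have bound : (LpN D p (enorm \o Derr) <= (V `^ p^-1 * energy_const)%:E)%E.
  have Lt := in_Lp_vec_tail mD m2 DM p0 LDw.
  have mt : measurable_fun D (enorm \o tail_vec Dw : 'rV[R]_(m + k) -> R).
    by case: (in_Lp_enorm Lt).
  have mu_ : measurable_fun D (enorm \o Du) by case: (in_Lp_enorm LDu).
  have := LpND mD (ltW p1) mu_ mt => h.
  apply: (@le_trans _ _ (LpN D p (fun x => (enorm (Du x) + enorm (tail_vec Dw x))%R))).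
    apply: (le_LpN mD p0) => //; first exact: measurable_funD.
    move=> x _; rewrite /= norm_enorm ger0_norm ?addr_ge0 ?enorm_ge0//.
    exact: ler_enormB.
  apply: le_trans h _; rewrite mulrDr EFinD; apply: leeD; first exact: enorm_Du_le.
  have -> : enorm \o tail_vec Dw = (fun x : 'rV[R]_(m + k) => (enorm \o Dw) (rsubmx x)).
    by apply/funext => x; rewrite /= enorm_row0mx.
  rewrite EFinM fineK ?ge0_fin_numE ?LpN_ge0//.
  exact (LpN_tail mD m2 DM p0 mEDw).
rewrite -lee_fin fineK; last exact: (integrable_fin_num mD integrable_energy).
have -> : (V * energy_const `^ p)%:E = ((V `^ p^-1 * energy_const)%:E `^ p)%E.
  by rewrite poweR_EFin powRM ?powR_ge0// -powRrM mulVf ?gt_eqF// powRr1.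
have -> : (\int[mu]_(x in D) (enorm (Derr x) `^ p)%:E = LpN D p (enorm \o Derr) `^ p)%E.
  by rewrite LpN_powE//; apply: eq_integral => x _; rewrite /= norm_enorm.
apply: gt0_ler_poweR => //; first exact: ltW.
  by rewrite in_itv/= leey andbT LpN_ge0.
by rewrite in_itv/= leey andbT lee_fin mulr_ge0 ?powR_ge0.
Qed.

End energy.

(** Half of the exponent pays for the power: with y = g l / 2, one has l^n = (2/g)^n y^n and y^n <=
    n! e^y. *)
Lemma expr_expR_le (R : realType) n (g l : R) : 0 < g -> 0 <= l ->
  l ^+ n * expR (- (g * l)) <= (2 / g) ^+ n * n`!%:R * expR (- (g / 2 * l)).
Proof.
move=> g0 l0; have gl0 : 0 <= g / 2 * l by rewrite mulr_ge0// divr_ge0// ltW.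
set y := g / 2 * l in gl0 *.
have -> : l ^+ n = (2 / g) ^+ n * y ^+ n.
  by rewrite -exprMn; congr (_ ^+ _); rewrite /y; field; rewrite gt_eqF.
have -> : expR (- (g * l)) = expR (- y) * expR (- y).
  by rewrite -expRD; congr expR; rewrite /y; field.
rewrite mulrA; apply: ler_wpM2r; first exact: expR_ge0.
rewrite -mulrA; apply: ler_wpM2l; first by rewrite exprn_ge0// divr_ge0// ltW.
by rewrite expRN ler_pdivrMr ?expR_gt0//; exact: expr_le_expR.
Qed.

Lemma open_sub_box (R : realType) n (A : set 'rV[R]_n) : open A -> A 0 ->
  exists2 r, 0 < r & box r `<=` A.
Proof.
move=> oA A0; have /nbhs_ballP[e /= e0 eA] := open_nbhs_nbhs (conj oA A0).
exists (e / 2); first by rewrite divr_gt0.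
move=> x xe; apply: eA; apply/(rV_ballP _ _ e0) => i.
rewrite mxE sub0r normrN; have := xe i; move: e0; lra.
Qed.

Theorem theorem3p4 (R : realType) (m k : nat) (hm : (0 < m)%N) (hk : (0 < k)%N)
  (omega1 : set 'rV[R]_m) (omega2 : set 'rV[R]_k)
  (open1 : open omega1) (bounded1 : bounded_set omega1)
  (convex1 : convex_set (omega1 : set (convex_lmodType 'rV[R]_m)))
  (zero1 : omega1 0)
  (open2 : open omega2) (bounded2 : bounded_set omega2)
  (p : R) (hp : 2 <= p)
  (c1 theta1 theta2 : R)
  (hc1 : 0 < c1) (htheta1 : 0 < theta1) (htheta2 : 0 < theta2)
  (F : 'rV[R]_m -> R) (G : 'rV[R]_k -> R)
  (hF : integrand p c1 theta1 theta2 F) (hG : integrand p c1 theta1 theta2 G)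
  (f : 'rV[R]_k -> R) (hf : in_Lp omega2 (p / (p - 1)) f)
  (u_inf : 'rV[R]_k -> R)
  (hu_inf : weak_solution omega2 p (flux2 p (Htilde p F G)) f u_inf) :
  exists C beta : R, [/\ 0 < C, 0 < beta &
    forall (l : R) (u : 'rV[R]_(m + k) -> R), 0 < l ->
      weak_solution (cylinder l omega1 omega2) p (flux p (Htilde p F G))
        (f \o rsubmx) u ->
      exists Dv : 'rV[R]_(m + k) -> 'rV[R]_(m + k),
        W1p (cylinder l omega1 omega2) p (u \- (u_inf \o rsubmx)) Dv /\
        (LpN (cylinder (l / 2) omega1 omega2) p (enorm \o Dv) <=
          (C * expR (- (beta * l)))%:E)%E].
Proof.
have p0 : 0 < p by lra.
have [M1 M10 o1M] := bounded_set_box bounded1.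
have [M2 M20 o2M] := bounded_set_box bounded2.
have [r r0 ro] := open_sub_box open1 zero1.
have [ys [yso cover]] := @half_cylinder_cover R m k omega1 r bounded1 r0.
have [Dw [hw eqw]] := hu_inf.
have m2 : measurable omega2 := open_measurable_rV open2.
have oo2 : (lebesgue_rV k omega2 < +oo)%E.
  apply: le_lt_trans (box_fin M2).
  by apply: le_measure; rewrite ?inE //; exact: box_measurable.
pose L := @decay_length R m p c1 theta2 M2.
have L0 : 0 < L by exact: decay_length_gt0.
pose K := @energy_const R k p c1 omega2 M2 f Dw.
have K0 : 0 <= K by exact: energy_const_ge0.
(* With at most g l steps of width 2 L, the half-width grows from l r / 8 by at most 2 L g l = l r /
   8, and so stays below l r / 2. *)
pose g := r / (16 * L).
have g0 : 0 < g by rewrite divr_gt0// mulr_gt0.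
(* In order: the number of cubes, the factor e lost in rounding g l down, the bound on the total
   energy with l^m taken out, and the price of absorbing l^m. *)
pose A := (size ys)%:R * expR 1 * (2 * M1) ^+ m * K `^ p * ((2 / g) ^+ m * m`!%:R).
have A0 : 0 <= A.
  have M10' := ltW M10; have g0' := ltW g0.
  by rewrite /A !mulr_ge0 ?expR_ge0 ?powR_ge0 ?exprn_ge0 ?mulr_ge0 ?invr_ge0.
(* The summand 1 makes C positive even when A = 0. In beta, the 2 is the half of the rate spent on
   l^m, and p comes from the p-th root. *)
exists (A `^ p^-1 + 1), (g / (2 * p)); split.
- by rewrite ltr_wpDl ?powR_ge0.
- by rewrite divr_gt0// mulr_gt0.
move=> l u l0 [Du [hu equ]].
have ln0 : l != 0 by rewrite gt_eqF.
have l20 : 0 < l / 2 by rewrite divr_gt0.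
set D := cylinder l omega1 omega2 in hu equ *.
have mD : measurable D by apply: open_measurable_rV; exact: cylinder_open.
have Doo : (lebesgue_rV (m + k) D < +oo)%E by exact: cylinder_fin l0 open1 open2 o1M o2M.
have DM x : D x -> box (l * M1) (lsubmx x) /\ omega2 (rsubmx x).
  by move=> Dx; split; [have [] := cylinder_box l0 o1M o2M Dx|case: Dx].
set D' := cylinder (l / 2) omega1 omega2.
have mD' : measurable D'.
  by apply: open_measurable_rV; apply: cylinder_open => //; rewrite gt_eqF.
have cubeD y : y \in ys -> forall x : 'rV[R]_(m + k),
    cube ((l / 2) *: y) (l * r / 2) x -> omega2 (rsubmx x) -> D x.
  by move=> /yso oy; exact: cube_sub_cylinder l0 convex1 ro oy.
(* The covering cubes of half-width l r / 8 are inside those of half-width l r / 2, which [cubeD]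
   places in [D]. *)
have D'D : D' `<=` D.
  move=> x D'x; have [y yys xy] := cover l omega2 x l0 D'x.
  apply: (cubeD y yys); last by case: D'x.
  apply: cubeS xy; have lr : 0 < l * r by rewrite mulr_gt0.
  by lra.
have W := W1p_err hp mD m2 Doo oo2 DM hw hu.
exists (Derr Dw Du); split; first exact: W.
have ie := integrable_energy hp mD m2 Doo oo2 DM hw hu.
have ie' := integrableS mD mD' D'D ie.
set E := \int[lebesgue_rV (m + k)]_(x in D) (enorm (Derr Dw Du x) `^ p).
have EB : E <= (2 * (l * M1)) ^+ m * K `^ p.
  (* Since k > 0, the first coordinate of X_2 can serve as the direction of the Poincare
     inequality. *)
  have := energy_bound hp hc1 htheta2 hF hG mD m2 Doo oo2 DM (ltW M20) o2M
    (Ordinal hk) hf hw hu equ.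
  by rewrite (max_idPl _)// mulr_ge0// ltW.
have cover' x : D' x -> exists2 y, y \in ys & cube ((l / 2) *: y) (l * r / 8) x.
  by move=> D'x; exact: (cover l omega2 x l0 D'x).
have E0 : 0 <= E by apply: Rintegral_ge0 => x _; exact: powR_ge0.
have each y : y \in ys ->
    local_energy (p := p) D Dw Du ((l / 2) *: y) (l * r / 8) <= expR (1 - g * l) * E.
  move=> yys; have gl0 : 0 <= g * l by rewrite mulr_ge0// ltW.
  (* From j > g l - 1 follows e^(-j) <= e^(1 - g l). For small l no step is made and the bound still
     holds. *)
  have /andP[j1 j2] := truncn_itv gl0; set j := Num.truncn _ in j1 j2.
  have h2 : l * r / 8 + 2 * L * j%:R <= l * r / 2.
    have h3 : L * j%:R <= l * r / 16.
      have -> : l * r / 16 = L * (g * l) by rewrite /g; field; rewrite gt_eqF.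
      by rewrite ler_pM2l.
    have lr : 0 < l * r by rewrite mulr_gt0.
    by lra.
  have zD x : cube ((l / 2) *: y) (l * r / 8 + 2 * L * j%:R) x -> omega2 (rsubmx x) -> D x.
    by move=> xs; exact: cubeD yys _ (cubeS h2 xs).
  apply: le_trans (energy_decay_iter hp hc1 htheta2 hF hG mD m2 Doo oo2 DM (ltW M20) o2M
    (Ordinal hk) hf hw eqw hu equ zD) _.
  apply: ler_pM; rewrite ?expR_ge0//.
  - exact: local_energy_ge0.
  - by rewrite ler_expR; move: j2; rewrite -natr1; lra.
  exact (local_energy_le hp mD m2 Doo oo2 DM hw hu _ _).
have I'B : \int[lebesgue_rV (m + k)]_(x in D') (enorm (Derr Dw Du x) `^ p) <=
    A * expR (- (g / 2 * l)).
  apply: le_trans (energy_cover hp mD m2 Doo oo2 DM hw hu mD' D'D cover') _.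
  apply: (@le_trans _ _ (\sum_(y <- ys) expR (1 - g * l) * E)).
    by rewrite big_seq [leRHS]big_seq; apply: ler_sum => y; exact: each.
  rewrite big_const_seq count_predT iter_addr_0 -[leLHS]mulr_natl.
  have -> : A * expR (- (g / 2 * l)) = (size ys)%:R * (expR 1 * ((2 * M1) ^+ m * K `^ p *
    ((2 / g) ^+ m * m`!%:R * expR (- (g / 2 * l))))) by rewrite /A; ring.
  apply: ler_wpM2l => //; rewrite expRD -mulrA; apply: ler_wpM2l; first exact: expR_ge0.
  have MK0 : 0 <= (2 * M1) ^+ m * K `^ p.
    by rewrite mulr_ge0 ?powR_ge0// exprn_ge0// mulr_ge0// ltW.
  apply: le_trans (ler_wpM2l MK0 (expr_expR_le m g0 (ltW l0))).
  have -> : (2 * M1) ^+ m * K `^ p * (l ^+ m * expR (- (g * l))) =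
    expR (- (g * l)) * ((2 * (l * M1)) ^+ m * K `^ p) by rewrite !exprMn; ring.
  by apply: ler_wpM2l => //; exact: expR_ge0.
have -> : LpN D' p (enorm \o Derr Dw Du) =
    ((\int[lebesgue_rV (m + k)]_(x in D') (enorm (Derr Dw Du x) `^ p)) `^ p^-1)%:E.
  rewrite LpNE// -poweR_EFin fineK; last exact: (integrable_fin_num mD' ie').
  by congr (_ `^ _)%E; apply: eq_integral => x _; rewrite /= norm_enorm.
rewrite lee_fin; apply: (@le_trans _ _ ((A * expR (- (g / 2 * l))) `^ p^-1)).
  apply: ge0_ler_powR; rewrite ?invr_ge0 ?(ltW p0)// nnegrE.
    by apply: Rintegral_ge0 => x _; exact: powR_ge0.
  by rewrite mulr_ge0// expR_ge0.
rewrite powRM ?expR_ge0//; apply: ler_pM; rewrite ?powR_ge0 ?lerDl//.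
rewrite -expRM le_eqVlt; apply/orP; left; apply/eqP; congr expR.
by field; rewrite gt_eqF.
Qed.
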